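(* Let $E\to M$ be a smooth vector bundle and let $j\colon TM\oplus E^*\to TM\oplus E^*$ be a vector bundle morphism over $\mathrm{id}_M$ with $j^2=-\mathrm{id}$. Linear generalised complex structures $\mathcal J$ on $E$ with side morphism $j$ are equivalent to (i.e. in bijective correspondence with) quasi-real complex Lie algebroid structures on $(TM\oplus E^*,j)$ with anchor $$\mathrm{pr}_{TM,j}\colon TM\oplus E^*\to T_{\mathbb C}M,\qquad \nu\mapsto \tfrac12\bigl(\mathrm{pr}_{TM}\nu\otimes 1-\mathrm{pr}_{TM}(j\nu)\otimes i\bigr).$$ Under this equivalence a quasi-real complex Lie algebroid structure is sent to the linear generalised complex structure $\mathcal J$ with side $j$ such that any dull bracket on $TM\oplus E^*$ realising the complex Lie bracket on $(TM\oplus E^*,j)$ is adapted to $\mathcal J$.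
   Context: Manifolds and vector bundles are smooth and real; $T_{\mathbb C}M=TM\otimes\mathbb C$. Double vector bundle. For $q_E\colon E\to M$, $TE$ is a vector bundle over $E$ and over $TM$ (projection $Tq_E$, structure maps the derivatives of those of $E$), and $T^*E$ is a vector bundle over $E$ and over $E^*$ (projection $r_E$, $\langle r_E(\theta_{e_m}),e'_m\rangle=\theta_{e_m}(\frac{d}{dt}|_{t=0}(e_m+te'_m))$). So $TE\oplus T^*E$ (sum over $E$) is a double vector bundle with sides $E$ and $TM\oplus E^*$ and core $E\oplus T^*M$. For $(e,\theta)\in\Gamma(E\oplus T^*M)$ the core section is $(e,\theta)^\uparrow(e'_m)=\bigl(\frac{d}{dt}|_{t=0}(e'_m+te(m)),(T_{e'_m}q_E)^t\theta(m)\bigr)$. The bundles $TM\oplus E^*$ and $E\oplus T^*M$ are dual by $\langle(X,\epsilon),(e,\theta)\rangle=\epsilon(e)+\theta(X)$. The bundle $TE\oplus T^*E\to E$ is the standard Courant algebroid over the manifold $E$: anchor $\mathrm{pr}_{TE}$, pairing $\langle(v,\theta),(w,\omega)\rangle=\theta(w)+\omega(v)$, bracket $[\![(X,\theta),(Y,\omega)]\!]=([X,Y],\mathcal L_X\omega-\iota_Y d\theta)$. A generalised complex structure on the manifold $E$ is a vector bundle morphism $\mathcal J$ of $TE\oplus T^*E$ over $\mathrm{id}_E$ with $\mathcal J^2=-1$, orthogonal for the pairing, and with vanishing Nijenhuis tensor $N_{\mathcal J}(e_1,e_2)=[\![e_1,e_2]\!]-[\![\mathcal Je_1,\mathcal Je_2]\!]+\mathcal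 J([\![\mathcal Je_1,e_2]\!]+[\![e_1,\mathcal Je_2]\!])$. It is linear if it is also a vector bundle morphism of $TE\oplus T^*E\to TM\oplus E^*$ over some $j\colon TM\oplus E^*\to TM\oplus E^*$, called its side morphism. Dull brackets. For a vector bundle $Q\to M$ with a morphism $\rho\colon Q\to TM$, a dull bracket on $(Q,\rho)$ is an $\mathbb R$-bilinear $[\![\cdot,\cdot]\!]$ on $\Gamma(Q)$ with $\rho[\![q_1,q_2]\!]=[\rho q_1,\rho q_2]$ and $[\![f_1q_1,f_2q_2]\!]=f_1f_2[\![q_1,q_2]\!]+f_1\rho(q_1)(f_2)q_2-f_2\rho(q_2)(f_1)q_1$. On $TM\oplus E^*$ the anchor is $\rho=\mathrm{pr}_{TM}$. A dull bracket on $TM\oplus E^*$ is equivalent to its dual Dorfman connection $\Delta\colon\Gamma(TM\oplus E^* )\times\Gamma(E\oplus T^*M)\to\Gamma(E\oplus T^*M)$, defined by $\mathrm{pr}_{TM}(\nu_1)\langle\nu_2,\tau\rangle=\langle[\![\nu_1,\nu_2]\!],\tau\rangle+\langle\nu_2,\Delta_{\nu_1}\tau\rangle$, and defines the horizontal lift $\sigma^\Delta\colon\Gamma(TM\oplus E^* )\to\Gamma_E(TE\oplus T^*E)$, $\sigma^\Delta(X,\epsilon)(e(m))=(T_me\,X(m),d\ell_\epsilon(e(m)))-(\Delta_{(X,\epsilon)}(e,0))^\uparrow(e(m))$ for $e\in\Gamma(E)$, where $\ell_\epsilon\colon E\to\mathbb R$ is the linear function defined by $\epsilon$. The dull bracket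 (or $\Delta$) is adapted to $\mathcal J$ (with side $j$) if $\mathcal J(\sigma^\Delta(\nu))=\sigma^\Delta(j\nu)$ for all $\nu\in\Gamma(TM\oplus E^* )$. Quasi-real complex Lie algebroids. Let $Q\to M$ be a vector bundle with $j\colon Q\to Q$, $j^2=-\mathrm{id}_Q$, considered as a complex vector bundle with $j$ as multiplication by $i$. A complex Lie algebroid structure on $(Q,j)$ is a $\mathbb C$-bilinear Lie bracket $[\cdot,\cdot]$ on $\Gamma(Q)$ and a complex vector bundle morphism (anchor) $\lambda\colon Q\to T_{\mathbb C}M$ with $[q_1,fq_2]=\lambda(q_1)(f)q_2+f[q_1,q_2]$ for $f\in C^\infty(M,\mathbb C)$. It is quasi-real if there exist (1) a real vector bundle morphism $\rho\colon Q\to TM$ with $\lambda=\rho_j$, $\rho_j(q)=\frac12(\rho(q)\otimes1-\rho(jq)\otimes i)$, and (2) a dull bracket $[\![\cdot,\cdot]\!]$ on $(Q,\rho)$ such that the complexification $(Q_{\mathbb C},\rho_{\mathbb C},[\![\cdot,\cdot]\!]_{\mathbb C})$ restricts to the $i$-eigenbundle $Q^{1,0}$ of $j_{\mathbb C}$, and this restriction coincides with the complex Lie algebroid $(Q,j,\lambda,[\cdot,\cdot])$ via the canonical isomorphism $Q\to Q^{1,0}$, $q\mapsto\frac12(q\otimes1-j(q)\otimes i)$. A dull bracket as in (2) is said to realise the complex Lie bracket. *)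

(* Defs.v *)
From HB Require Import structures.
From mathcomp Require Import all_boot all_order all_algebra.
From mathcomp Require Import all_classical all_reals all_analysis.
From mathcomp Require Import complex.

Set Implicit Arguments.
Unset Strict Implicit.
Unset Printing Implicit Defensive.

Import Order.TTheory GRing.Theory Num.Theory.
Import numFieldNormedType.Exports.
Local Open Scope classical_set_scope.
Local Open Scope ring_scope.

Section euclidean_smoothness.
Context {R : realType} {n : nat}.
Implicit Types (f g : 'rV[R]_n -> R) (x : 'rV[R]_n) (vs : seq 'rV[R]_n).

Definition iter_derive vs f : 'rV[R]_n -> R :=
  foldr (fun v (g : 'rV[R]_n -> R) => fun x => 'D_v g x) f vs.

(* On an open set this is C^oo at every point of the set. *)
Definition smooth_at f x := forall vs, \forall y \near x,
  {for y, continuous (iter_derive vs f)} /\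
  forall v, derivable (iter_derive vs f) y v.


Let ok m f x := forall vs, (size vs <= m)%N -> \forall y \near x,
  {for y, continuous (iter_derive vs f)} /\
  forall v, derivable (iter_derive vs f) y v.

Let iter_derive_rcons vs v f :
  iter_derive (rcons vs v) f = iter_derive vs (fun x => 'D_v f x).
Proof. by rewrite /iter_derive foldr_rcons. Qed.

Let near_iter_derive vs f g x : (\forall y \near x, f y = g y) ->
  \forall y \near x, iter_derive vs f y = iter_derive vs g y.
Proof.
move=> fg; elim: vs => [//|v vs /near_join IH] /=.
by apply: filterS IH => y; exact: near_eq_derive.
Qed.

Let near_ok m f g x : (\forall y \near x, f y = g y) -> ok m f x -> ok m g x.
Proof.
move=> fg fx vs /fx; have /near_join := near_iter_derive vs fg.
move=> + H; apply: filterS2 H => y [fc fd] E; split => [|v].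
  move: fc; rewrite /prop_for /continuous_at (nbhs_singleton E).
  by apply: cvg_trans; exact: (near_eq_cvg E).
exact: near_eq_derivable (fd v).
Qed.

Let okS m f x : ok m.+1 f x <-> ok 0 f x /\ forall v, ok m (fun y => 'D_v f y) x.
Proof.
split=> [fx|[f0 fS] vs].
  split=> [vs|v vs hs]; first by rewrite leqn0 => /nilP ->; exact: (fx [::]).
  by rewrite -iter_derive_rcons; apply: fx; rewrite size_rcons.
elim/last_ind: vs => [_|vs v _]; first exact: f0.
by rewrite size_rcons iter_derive_rcons; exact: fS.
Qed.

Let okW m f x : ok m.+1 f x -> ok m f x.
Proof. by move=> fx vs hs; apply: fx; exact: leqW. Qed.

Let ok_cst m a x : ok m (fun=> a) x.
Proof.
elim: m a => [|m IH] a.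
  move=> [|//] _; near=> y; split=> [|v]; first exact: cst_continuous.
  exact: derivable_cst.
apply/okS; split=> [vs|v]; first by rewrite leqn0 => /nilP ->; exact: (IH a [::]).
apply: (@near_ok _ (fun=> 0)) (IH 0).
by near=> y; rewrite derive_cst.
Unshelve. all: by end_near. Qed.

Let okD m f g x : ok m f x -> ok m g x -> ok m (fun y => f y + g y) x.
Proof.
elim: m f g => [|m IH] f g fx gx.
  move=> [|//] hs; move: (fx _ hs) (gx _ hs); apply: filterS2 => y /=.
  move=> [fc fd] [gc gd]; split=> [|v]; first exact: (continuousD fc gc).
  exact: derivableD.
move/okS : (fx) => [f0 fS]; move/okS : (gx) => [g0 gS].
apply/okS; split=> [vs|v].
  by rewrite leqn0 => /nilP ->; apply: (IH _ _ (okW fx) (okW gx) [::]).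
apply: near_ok (IH _ _ (fS v) (gS v)).
move: (f0 [::] isT) (g0 [::] isT); apply: filterS2 => y [_ fd] [_ gd].
by rewrite [RHS]deriveD.
Qed.

Let okM m f g x : ok m f x -> ok m g x -> ok m (fun y => f y * g y) x.
Proof.
elim: m f g => [|m IH] f g fx gx.
  move=> [|//] hs; move: (fx _ hs) (gx _ hs); apply: filterS2 => y /=.
  move=> [fc fd] [gc gd]; split=> [|v]; first exact: (continuousM fc gc).
  exact: derivableM.
move/okS : (fx) => [f0 fS]; move/okS : (gx) => [g0 gS].
apply/okS; split=> [vs|v].
  by rewrite leqn0 => /nilP ->; apply: (IH _ _ (okW fx) (okW gx) [::]).
apply: near_ok (okD (IH _ _ (okW fx) (gS v)) (IH _ _ (okW gx) (fS v))).
move: (f0 [::] isT) (g0 [::] isT); apply: filterS2 => y [_ fd] [_ gd].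
by rewrite [RHS]deriveM.
Qed.

Let smooth_atE f x : smooth_at f x <-> forall m, ok m f x.
Proof. by split=> [fx m vs _|fx vs]; [exact: fx|exact: (fx (size vs))]. Qed.

Lemma smooth_at_cst a x : smooth_at (fun=> a) x.
Proof. by apply/smooth_atE. Qed.

Lemma smooth_atD f g x :
  smooth_at f x -> smooth_at g x -> smooth_at (fun y => f y + g y) x.
Proof. by move=> /smooth_atE fx /smooth_atE gx; apply/smooth_atE => m; apply: okD. Qed.

Lemma smooth_atM f g x :
  smooth_at f x -> smooth_at g x -> smooth_at (fun y => f y * g y) x.
Proof. by move=> /smooth_atE fx /smooth_atE gx; apply/smooth_atE => m; apply: okM. Qed.

End euclidean_smoothness.

(* An atlas carries no axioms; they are collected in is_manifold, so that the
   total space of a vector bundle has an atlas by definition.  The value of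
   cmap outside cdom, and of cinv outside cmap @` cdom, is irrelevant. *)
Record chart (R : realType) (T : Type) (n : nat) := Chart {
  cdom : set T;
  cmap : T -> 'rV[R]_n;
  cinv : 'rV[R]_n -> T }.

Notation atlas R T n := (set (chart R T n)).

Section manifolds.
Context {R : realType} {T : Type} {n : nat}.
Variable A : atlas R T n.

Definition smooth_on (W : set T) (f : T -> R) := forall c, A c ->
  forall p, W p -> cdom c p -> smooth_at (f \o cinv c) (cmap c p).

Definition smooth (f : T -> R) := smooth_on setT f.

Definition atlas_open (W : set T) :=
  forall c, A c -> open (cmap c @` (W `&` cdom c)).

Record is_manifold : Prop := IsManifold {
  mf_cover : forall p, exists2 c, A c & cdom c p;
  mf_chart : forall c, A c -> forall p, cdom c p -> cinv c (cmap c p) = p;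
  mf_open : forall c, A c -> atlas_open (cdom c);
  mf_compat : forall c, A c -> forall i,
    smooth_on (cdom c) (fun p => cmap c p 0 i);
  mf_hausdorff : forall p q, p <> q -> exists U V,
    [/\ atlas_open U, atlas_open V, U p, V q & U `&` V = set0];
  mf_second_countable : exists B : set (set T),
    [/\ countable B, B `<=` atlas_open &
        forall W p, atlas_open W -> W p -> exists2 U, B U & U p /\ U `<=` W] }.

End manifolds.

Section smooth_functions.
Context {R : realType} {T : Type} {n : nat} {A : atlas R T n}.
Implicit Types (f g : T -> R) (W : set T).

Lemma smooth_on_cst W (a : R) : smooth_on A W (fun=> a).
Proof. by move=> c _ p _ _; exact: smooth_at_cst. Qed.

Lemma smooth_onD W f g : smooth_on A W f -> smooth_on A W g ->
  smooth_on A W (fun p => f p + g p).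
Proof.
move=> sf sg c Ac p Wp cp.
exact: (smooth_atD (sf c Ac p Wp cp) (sg c Ac p Wp cp)).
Qed.

Lemma smooth_onM W f g : smooth_on A W f -> smooth_on A W g ->
  smooth_on A W (fun p => f p * g p).
Proof.
move=> sf sg c Ac p Wp cp.
exact: (smooth_atM (sf c Ac p Wp cp) (sg c Ac p Wp cp)).
Qed.

Lemma smooth_onS W f : smooth A f -> smooth_on A W f.
Proof. by move=> sf c Ac p _ cp; exact: sf. Qed.

End smooth_functions.

Section dual_space.
Context {R : realType} (V : lmodType R).

Definition functional_pred : {pred (V -> R)} := fun a =>
  `[< forall c u v, a (c *: u + v) = c * a u + a v >].

Record dual := Dual {
  dual_val :> V -> R;
  dual_prop : dual_val \in functional_pred }.

HB.instance Definition _ := [isSub for dual_val].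
HB.instance Definition _ := [Choice of dual by <:].

Fact functional_submod : submod_closed functional_pred.
Proof.
split=> [|c a b /asboolP la /asboolP lb]; apply/asboolP => d u v /=.
  by rewrite /= mulr0 addr0.
have E w : (c *: a + b) w = c * a w + b w by [].
rewrite !E la lb !mulrDr !mulrA [d * c]mulrC !addrA.
by congr (_ + _); rewrite addrAC.
Qed.

HB.instance Definition _ :=
  GRing.isSubmodClosed.Build R (V -> R) functional_pred functional_submod.
HB.instance Definition _ := [SubChoice_isSubLmodule of dual by <:].

(* The linear functional with values phi, for a map phi known to be linear. *)
Definition dual_of (phi : V -> R) : dual :=
  xget 0 [set a : dual | forall v, a v = phi v].

End dual_space.

Section tangent_space.
Context {R : realType} {T : Type} {n : nat}.
Variables (A : atlas R T n) (p : T).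

(* Derivations at p of C^oo(T).  The value on non-smooth functions is fixed to
   0, so that two tangent vectors agreeing on C^oo(T) are equal. *)
Definition derivation_pred : {pred ((T -> R) -> R)} := fun v => `[<
  [/\ forall f, ~ smooth A f -> v f = 0,
      forall a f g, smooth A f -> smooth A g ->
        v (fun x => a * f x + g x) = a * v f + v g
    & forall f g, smooth A f -> smooth A g ->
        v (fun x => f x * g x) = f p * v g + g p * v f] >].

Record tangent := Tangent {
  tangent_val :> (T -> R) -> R;
  tangent_prop : tangent_val \in derivation_pred }.

HB.instance Definition _ := [isSub for tangent_val].
HB.instance Definition _ := [Choice of tangent by <:].

Fact derivation_submod : submod_closed derivation_pred.
Proof.
split=> [|c u v /asboolP[u0 uD uM] /asboolP[v0 vD vM]]; apply/asboolP.
  by split=> // *; rewrite /= ?mulr0 ?addr0.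
have E f : (c *: u + v) f = c * u f + v f by [].
split=> [f nf|a f g sf sg|f g sf sg]; rewrite !E.
- by rewrite u0 // v0 // mulr0 addr0.
- rewrite uD // vD // !mulrDr !mulrA [a * c]mulrC !addrA.
  by congr (_ + _); rewrite addrAC.
- rewrite uM // vM // !mulrDr !mulrA [f p * c]mulrC [g p * c]mulrC !addrA.
  by congr (_ + _); rewrite addrAC.
Qed.

HB.instance Definition _ := GRing.isSubmodClosed.Build R ((T -> R) -> R)
  derivation_pred derivation_submod.
HB.instance Definition _ := [SubChoice_isSubLmodule of tangent by <:].

(* The tangent vector f |-> phi f, for phi known to be a derivation at p. *)
Definition tangent_of (phi : (T -> R) -> R) : tangent :=
  xget 0 [set v : tangent | forall f, smooth A f -> v f = phi f].

End tangent_space.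

(* A family of vector spaces with its C^oo-module of smooth sections: what
   brackets on sections and morphisms over the identity depend on.  Local
   triviality is stated for E in is_vector_bundle. *)
Record bundle (R : realType) (T : Type) (n : nat) (A : atlas R T n) := Bundle {
  fibre :> T -> lmodType R;
  smooth_section : set (forall p, fibre p);
  smooth_section0 : smooth_section (fun=> 0);
  smooth_sectionD : forall s t, smooth_section s -> smooth_section t ->
    smooth_section (fun p => s p + t p);
  smooth_sectionM : forall (f : T -> R) s, smooth A f -> smooth_section s ->
    smooth_section (fun p => f p *: s p) }.
Arguments smooth_section {R T n A} b.

Section sections.
Context {R : realType} {T : Type} {n : nat} {A : atlas R T n}.

Record cinf := Cinf { cinf_val :> T -> R; cinfP : smooth A cinf_val }.

Record ccinf := Ccinf {
  ccinf_val :> T -> R[i];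
  ccinf_re : smooth A (fun p => complex.Re (ccinf_val p));
  ccinf_im : smooth A (fun p => complex.Im (ccinf_val p)) }.

Definition cinf_re (f : ccinf) : cinf := Cinf (ccinf_re f).
Definition cinf_im (f : ccinf) : cinf := Cinf (ccinf_im f).

Record Gamma (B : bundle A) := MkGamma {
  gamma_val :> forall p, B p;
  gammaP : smooth_section B gamma_val }.

Section section_lmodType.
Variable B : bundle A.
Implicit Types s t : Gamma B.

Lemma gamma_eq s t : (forall p, s p = t p) -> s = t.
Proof.
case: s t => s sP [t tP] /= st.
have E : s = t by exact: functional_extensionality_dep.
by subst t; congr MkGamma; exact: Prop_irrelevance.
Qed.

HB.instance Definition _ := gen_eqMixin (Gamma B).
HB.instance Definition _ := gen_choiceMixin (Gamma B).

Definition fscale (f : cinf) s : Gamma B :=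
  MkGamma (smooth_sectionM (cinfP f) (gammaP s)).

Definition gamma_zero : Gamma B := MkGamma (smooth_section0 B).
Definition gamma_add s t : Gamma B :=
  MkGamma (smooth_sectionD (gammaP s) (gammaP t)).
Definition gamma_scale (a : R) s : Gamma B :=
  fscale (Cinf (@smooth_on_cst R T n A setT a)) s.
Definition gamma_opp s : Gamma B := gamma_scale (-1) s.

Fact gamma_addA : associative gamma_add.
Proof. by move=> s t u; apply: gamma_eq => p /=; rewrite addrA. Qed.
Fact gamma_addC : commutative gamma_add.
Proof. by move=> s t; apply: gamma_eq => p /=; rewrite addrC. Qed.
Fact gamma_add0 : left_id gamma_zero gamma_add.
Proof. by move=> s; apply: gamma_eq => p /=; rewrite add0r. Qed.
Fact gamma_addN : left_inverse gamma_zero gamma_opp gamma_add.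
Proof. by move=> s; apply: gamma_eq => p /=; rewrite scaleN1r addNr. Qed.

HB.instance Definition _ :=
  GRing.isZmodule.Build (Gamma B) gamma_addA gamma_addC
    gamma_add0 gamma_addN.

Fact gamma_scaleA a b s :
  gamma_scale a (gamma_scale b s) = gamma_scale (a * b) s.
Proof. by apply: gamma_eq => p /=; rewrite scalerA. Qed.
Fact gamma_scale1 : left_id 1 gamma_scale.
Proof. by move=> s; apply: gamma_eq => p /=; rewrite scale1r. Qed.
Fact gamma_scaleDr : right_distributive gamma_scale +%R.
Proof. by move=> a s t; apply: gamma_eq => p /=; rewrite scalerDr. Qed.
Fact gamma_scaleDl s : {morph gamma_scale^~ s : a b / a + b}.
Proof. by move=> a b; apply: gamma_eq => p /=; rewrite scalerDl. Qed.

HB.instance Definition _ := GRing.Zmodule_isLmodule.Build R (Gamma B)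
  gamma_scaleA gamma_scale1 gamma_scaleDr gamma_scaleDl.

End section_lmodType.

(* Smooth vector bundle morphisms over the identity of the base. *)
Record bmor (B C : bundle A) := Bmor {
  bmor_val :> forall p, B p -> C p;
  bmor_linear : forall p a x y,
    @bmor_val p (a *: x + y) = a *: @bmor_val p x + @bmor_val p y;
  bmor_smooth : forall s, smooth_section B s ->
    smooth_section C (fun p => @bmor_val p (s p)) }.
Arguments bmor_val {B C} b p x.

Definition bmap (B C : bundle A) (F : bmor B C) (s : Gamma B) : Gamma C :=
  MkGamma (bmor_smooth F (gammaP s)).

Section sum_bundle.
Variables B C : bundle A.

Definition sum_fibre p : lmodType R := (B p * C p)%type.
Definition sum_section_smooth : set (forall p, sum_fibre p) := [set s |
  smooth_section B (fun p => (s p).1) /\ smooth_section C (fun p => (s p).2)].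
Fact sum_section_smooth0 : sum_section_smooth (fun=> 0).
Proof. by split; exact: smooth_section0. Qed.
Fact sum_section_smoothD s t : sum_section_smooth s -> sum_section_smooth t -> sum_section_smooth (fun p => s p + t p).
Proof. by move=> [s1 s2] [t1 t2]; split; exact: smooth_sectionD. Qed.
Fact sum_section_smoothM (f : T -> R) s :
  smooth A f -> sum_section_smooth s -> sum_section_smooth (fun p => f p *: s p).
Proof. by move=> sf [s1 s2]; split; exact: smooth_sectionM. Qed.

Definition bsum : bundle A := Bundle sum_section_smooth0 sum_section_smoothD sum_section_smoothM.

End sum_bundle.

End sections.
Arguments cinf {R T n} A.
Arguments ccinf {R T n} A.

Section tangent_bundles.
Context {R : realType} {T : Type} {n : nat}.
Variable A : atlas R T n.

Definition vector_field_smooth : set (forall p, tangent A p) :=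
  [set X | forall f, smooth A f -> smooth A (fun p => X p f)].
Fact vector_field_smooth0 : vector_field_smooth (fun=> 0).
Proof. by move=> f _; exact: smooth_on_cst. Qed.
Fact vector_field_smoothD X Y : vector_field_smooth X -> vector_field_smooth Y -> vector_field_smooth (fun p => X p + Y p).
Proof. by move=> sX sY f sf; apply: smooth_onD; [exact: sX|exact: sY]. Qed.
Fact vector_field_smoothM (g : T -> R) X : smooth A g -> vector_field_smooth X -> vector_field_smooth (fun p => g p *: X p).
Proof. by move=> sg sX f sf; exact: (smooth_onM sg (sX f sf)). Qed.

Definition tangent_bundle : bundle A := Bundle vector_field_smooth0 vector_field_smoothD vector_field_smoothM.

Definition covector_field_smooth : set (forall p, dual (tangent A p)) := [set w |
  forall X, smooth_section tangent_bundle X -> smooth A (fun p => w p (X p))].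
Fact covector_field_smooth0 : covector_field_smooth (fun=> 0).
Proof. by move=> X _; exact: smooth_on_cst. Qed.
Fact covector_field_smoothD v w : covector_field_smooth v -> covector_field_smooth w -> covector_field_smooth (fun p => v p + w p).
Proof. by move=> sv sw X sX; apply: smooth_onD; [exact: sv|exact: sw]. Qed.
Fact covector_field_smoothM (g : T -> R) w : smooth A g -> covector_field_smooth w -> covector_field_smooth (fun p => g p *: w p).
Proof. by move=> sg sw X sX; exact: (smooth_onM sg (sw X sX)). Qed.

Definition cotangent_bundle : bundle A := Bundle covector_field_smooth0 covector_field_smoothD covector_field_smoothM.

Definition pontryagin_bundle : bundle A := bsum tangent_bundle cotangent_bundle.

Implicit Types (X Y : forall p, tangent A p)
  (w : forall p, dual (tangent A p)) (f : T -> R).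

Definition lie X Y p : tangent A p :=
  tangent_of A p (fun f => X p (fun q => Y q f) - Y p (fun q => X q f)).

(* The covector at p with V p |-> W V for all vector fields V, for W known to
   depend on V p only. *)
Definition covector_of p (W : (forall q, tangent A q) -> R) :
    dual (tangent A p) :=
  xget 0 [set a : dual (tangent A p) |
    forall V, smooth_section tangent_bundle V -> a (V p) = W V].

Definition differential f p : dual (tangent A p) := dual_of (fun v : tangent A p => v f).

Definition lie_derivative X w p : dual (tangent A p) :=
  covector_of p (fun V => X p (fun q => w q (V q)) - w p (lie X V p)).

(* iota_Y d w *)
Definition contract_d Y w p : dual (tangent A p) :=
  covector_of p (fun V => Y p (fun q => w q (V q)) - V p (fun q => w q (Y q))
                          - w p (lie Y V p)).

Implicit Types x y : forall p, pontryagin_bundle p.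

Definition courant_bracket x y p : pontryagin_bundle p :=
  let X q := (x q).1 in let Y q := (y q).1 in
  (lie X Y p,
   lie_derivative X (fun q => (y q).2) p - contract_d Y (fun q => (x q).2) p).

Definition courant_pairing p (u v : pontryagin_bundle p) : R :=
  u.2 v.1 + v.2 u.1.

Record is_gcs (J : bmor pontryagin_bundle pontryagin_bundle) : Prop := IsGcs {
  gcs_square : forall p u, J p (J p u) = - u;
  gcs_orthogonal : forall p u v,
    courant_pairing (J p u) (J p v) = courant_pairing u v;
  gcs_nijenhuis : forall x y,
    smooth_section pontryagin_bundle x -> smooth_section pontryagin_bundle y ->
    let Jx q := J q (x q) in let Jy q := J q (y q) in
    forall p, courant_bracket x y p - courant_bracket Jx Jy p
      + J p (courant_bracket Jx y p + courant_bracket x Jy p) = 0 }.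

End tangent_bundles.

Section tangent_map.
Context {R : realType} {T T' : Type} {n n' : nat}.

Definition tangent_map (A : atlas R T n) (A' : atlas R T' n') (F : T -> T') p
    (v : tangent A p) : tangent A' (F p) :=
  tangent_of A' (F p) (fun g => v (g \o F)).

End tangent_map.

(* A trivialisation over tdom; tinv m is the inverse of tmap m for m in tdom. *)
Record triv (R : realType) (M : Type) (E : M -> lmodType R) (k : nat) := Triv {
  tdom : set M;
  tmap : forall m, {linear E m -> 'rV[R]_k};
  tinv : forall m, 'rV[R]_k -> E m }.

Section vector_bundles.
Context {R : realType} {M : Type} {n k : nat} {E : M -> lmodType R}.
Variables (A : atlas R M n) (F : set (triv E k)).

Record is_vector_bundle : Prop := IsVectorBundle {
  vb_cover : forall m, exists2 t, F t & tdom t m;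
  vb_open : forall t, F t -> atlas_open A (tdom t);
  vb_tmapK : forall t, F t -> forall m, tdom t m ->
    cancel (tmap t m) (tinv t m);
  vb_tinvK : forall t, F t -> forall m, tdom t m ->
    cancel (tinv t m) (tmap t m);
  vb_compat : forall t t', F t -> F t' -> forall a i,
    smooth_on A (tdom t `&` tdom t') (fun m => tmap t' m (tinv t m a) 0 i) }.

Definition vsection_smooth : set (forall m, E m) := [set s | forall t, F t -> forall i,
  smooth_on A (tdom t) (fun m => tmap t m (s m) 0 i)].
Fact vsection_smooth0 : vsection_smooth (fun=> 0).
Proof.
move=> t _ i; have -> : (fun m => tmap t m 0 0 i) = fun=> 0.
  by apply/funext => m; rewrite linear0 mxE.
exact: smooth_on_cst.
Qed.
Fact vsection_smoothD r s : vsection_smooth r -> vsection_smooth s -> vsection_smooth (fun m => r m + s m).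
Proof.
move=> sr ss t Ft i; have -> : (fun m => tmap t m (r m + s m) 0 i) =
    fun m => tmap t m (r m) 0 i + tmap t m (s m) 0 i.
  by apply/funext => m; rewrite linearD mxE.
by apply: smooth_onD; [exact: sr|exact: ss].
Qed.
Fact vsection_smoothM (f : M -> R) s : smooth A f -> vsection_smooth s -> vsection_smooth (fun m => f m *: s m).
Proof.
move=> sf ss t Ft i; have -> : (fun m => tmap t m (f m *: s m) 0 i) =
    fun m => f m * tmap t m (s m) 0 i.
  by apply/funext => m; rewrite linearZ mxE.
by apply: smooth_onM; [exact: smooth_onS|exact: ss].
Qed.

Definition vbundle : bundle A := Bundle vsection_smooth0 vsection_smoothD vsection_smoothM.

Definition dual_section_smooth : set (forall m, dual (E m)) := [set s | forall t, F t -> forall a,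
  smooth_on A (tdom t) (fun m => s m (tinv t m a))].
Fact dual_section_smooth0 : dual_section_smooth (fun=> 0).
Proof. by move=> t _ a; exact: smooth_on_cst. Qed.
Fact dual_section_smoothD r s : dual_section_smooth r -> dual_section_smooth s -> dual_section_smooth (fun m => r m + s m).
Proof. by move=> sr ss t Ft a; apply: smooth_onD; [exact: sr|exact: ss]. Qed.
Fact dual_section_smoothM (f : M -> R) s : smooth A f -> dual_section_smooth s -> dual_section_smooth (fun m => f m *: s m).
Proof.
by move=> sf ss t Ft a; exact: (smooth_onM (smooth_onS sf) (ss t Ft a)).
Qed.

Definition dual_bundle : bundle A := Bundle dual_section_smooth0 dual_section_smoothD dual_section_smoothM.

(* The total space, with charts (m, e) |-> (c m, t e). *)
Definition total := {m : M & E m}.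

Definition total_chart (c : chart R M n) (t : triv E k) :
    chart R total (n + k) :=
  Chart [set e : total | cdom c (projT1 e) /\ tdom t (projT1 e)]
    (fun e => row_mx (cmap c (projT1 e)) (tmap t (projT1 e) (projT2 e)))
    (fun x => existT _ (cinv c (lsubmx x))
                (tinv t (cinv c (lsubmx x)) (rsubmx x))).

Definition total_atlas : atlas R total (n + k) :=
  [set total_chart c t | c in A & t in F].

End vector_bundles.
Arguments total {R M} E.

Section double.
Context {R : realType} {M : Type} {k : nat} {E : M -> lmodType R}.

Definition double m : lmodType R := (E m * E m)%type.

Section double_triv.
Variable t : triv E k.

Definition double_tmap m (x : double m) : 'rV[R]_(k + k) :=
  row_mx (tmap t m x.1) (tmap t m x.2).

Fact double_tmap_linear m : linear (@double_tmap m).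
Proof.
move=> a x y; rewrite /double_tmap !linearP.
by rewrite scale_row_mx add_row_mx.
Qed.

HB.instance Definition _ m := GRing.isLinear.Build R (double m)
  'rV[R]_(k + k) _ (@double_tmap m) (@double_tmap_linear m).

Definition double_triv : triv double (k + k) :=
  Triv (tdom t) (fun m => @double_tmap m : {linear double m -> 'rV[R]_(k + k)})
    (fun m a => (tinv t m (lsubmx a), tinv t m (rsubmx a))).

End double_triv.

End double.

Section linear_generalised_complex.
Context {R : realType} {M : Type} {n k : nat} {E : M -> lmodType R}.
Variables (A : atlas R M n) (F : set (triv E k)).

Local Notation TA := (total_atlas A F).
Local Notation P := (pontryagin_bundle TA).
Local Notation pt m a := (existT (fun m0 => GRing.Lmodule.sort (E m0)) m a).

(* Q = TM + E^* and B = E + T^*M, with their duality. *)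
Definition side_bundle : bundle A := bsum (tangent_bundle A) (dual_bundle A F).
Definition core_bundle : bundle A := bsum (vbundle A F) (cotangent_bundle A).

Definition side_core_pairing m (nu : side_bundle m) (tau : core_bundle m) : R :=
  nu.2 tau.1 + tau.2 nu.1.

Definition bproj : total E -> M := fun e => projT1 e.

(* d/dt|_{t=0} (a + t b) *)
Definition vertical m (a b : E m) : tangent TA (pt m a) :=
  tangent_of TA (pt m a) 
    (fun f => derive1 (fun t : R => f (pt m (a + t *: b))) 0).

Definition rproj m (a : E m) (w : dual (tangent TA (pt m a))) : dual (E m) :=
  dual_of (fun b => w (vertical a b)).

(* The projection TE + T^*E -> TM + E^*. *)
Definition side_proj m (a : E m) (x : P (pt m a)) : side_bundle m :=
  (tangent_map A bproj x.1, rproj x.2).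

(* Graphs of the addition and of the scalar multiplication of the vector bundle
   TE + T^*E -> TM + E^*.  On TE they are the derivatives of those of E, the
   domain T(E x_M E) being the tangent bundle of the total space of E + E.
   On T^*E they are the ones making the pairing with TE additive and
   homogeneous. *)
Local Notation TA2 := (total_atlas A (double_triv @` F)).
Local Notation pt2 m a b :=
  (existT (fun m0 => GRing.Lmodule.sort (@double _ _ E m0)) m (a, b)).

Definition double_fst : total (@double _ _ E) -> total E :=
  fun z => pt (projT1 z) (projT2 z).1.
Definition double_snd : total (@double _ _ E) -> total E :=
  fun z => pt (projT1 z) (projT2 z).2.
Definition double_add : total (@double _ _ E) -> total E :=
  fun z => pt (projT1 z) ((projT2 z).1 + (projT2 z).2).
Definition total_scale (c : R) : total E -> total E :=
  fun e => pt (projT1 e) (c *: projT2 e).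

Definition tangent_sum m (a b : E m) (u : tangent TA (pt m a))
    (v : tangent TA (pt m b)) (w : tangent TA (pt m (a + b))) :=
  exists z : tangent TA2 (pt2 m a b),
    [/\ tangent_map TA double_fst z = u, tangent_map TA double_snd z = v
      & tangent_map TA double_add z = w].

Definition cotangent_sum m (a b : E m) (al : dual (tangent TA (pt m a)))
    (be : dual (tangent TA (pt m b))) (ga : dual (tangent TA (pt m (a + b)))) :=
  rproj al = rproj be /\
  forall u v w, tangent_sum u v w -> ga w = al u + be v.

Definition cotangent_scaled (c : R) m (a : E m)
    (al : dual (tangent TA (pt m a))) (be : dual (tangent TA (pt m (c *: a)))) :=
  rproj be = rproj al /\
  forall u : tangent TA (pt m a),
    be (tangent_map TA (total_scale c) u) = c * al u.

Definition side_sum m (a b : E m) (x : P (pt m a)) (y : P (pt m b))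
    (z : P (pt m (a + b))) :=
  tangent_sum x.1 y.1 z.1 /\ cotangent_sum x.2 y.2 z.2.

Definition side_scaled (c : R) m (a : E m) (x : P (pt m a))
    (y : P (pt m (c *: a))) :=
  y.1 = tangent_map TA (total_scale c) x.1 /\ cotangent_scaled x.2 y.2.

Record is_linear_over (j : bmor side_bundle side_bundle) (J : bmor P P) :
    Prop := IsLinearOver {
  lo_side : forall m (a : E m) (x : P (pt m a)),
    side_proj (J (pt m a) x) = j m (side_proj x);
  lo_sum : forall m (a b : E m) (x : P (pt m a)) (y : P (pt m b))
      (z : P (pt m (a + b))),
    side_sum x y z ->
    side_sum (J (pt m a) x) (J (pt m b) y) (J (pt m (a + b)) z);
  lo_scale : forall (c : R) m (a : E m) (x : P (pt m a))
      (y : P (pt m (c *: a))),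
    side_scaled x y -> side_scaled (J (pt m a) x) (J (pt m (c *: a)) y) }.

Definition core_section (tau : forall m, core_bundle m) m (a : E m) :
    P (pt m a) :=
  (vertical a (tau m).1,
   dual_of (fun v : tangent TA (pt m a) => (tau m).2 (tangent_map A bproj v))).

Definition linear_function (eps : forall m, dual (E m)) : total E -> R :=
  fun e => eps (projT1 e) (projT2 e).

Implicit Types (D : Gamma side_bundle -> Gamma side_bundle -> Gamma side_bundle)
  (nu : Gamma side_bundle).

Definition dorfman D nu (tau : forall m, core_bundle m) m : core_bundle m :=
  xget 0 [set b | forall nu2,
    (nu m).1 (fun x => side_core_pairing (nu2 x) (tau x)) =
    side_core_pairing (D nu nu2 m) (tau m) + side_core_pairing (nu2 m) b].

(* The horizontal lift of nu at the point e m of E. *)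
Definition horizontal_lift D nu (e : Gamma (vbundle A F)) m : P (pt m (e m)) :=
  (tangent_map TA (fun x => pt x (e x)) (nu m).1,
   differential TA (linear_function (fun x => (nu x).2)) (pt m (e m)))
  - core_section (dorfman D nu (fun x => (e x, 0))) (e m).

Definition adapted D (j : bmor side_bundle side_bundle) (J : bmor P P) :=
  forall nu (e : Gamma (vbundle A F)) m,
    J (pt m (e m)) (horizontal_lift D nu e m)
    = horizontal_lift D (bmap j nu) e m.

Definition side_anchor_fun m (nu : side_bundle m) : tangent A m := nu.1.

Fact side_anchor_linear m (a : R) (x y : side_bundle m) :
  side_anchor_fun (a *: x + y) = a *: side_anchor_fun x + side_anchor_fun y.
Proof. by []. Qed.

Fact side_anchor_smooth s : smooth_section side_bundle s ->
  smooth_section (tangent_bundle A) (fun m => side_anchor_fun (s m)).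
Proof. by case. Qed.

Definition side_anchor : bmor side_bundle (tangent_bundle A) :=
  Bmor (B := side_bundle) (C := tangent_bundle A) (bmor_val := @side_anchor_fun)
    side_anchor_linear side_anchor_smooth.

End linear_generalised_complex.

Section quasi_real.
Context {R : realType} {M : Type} {n : nat} {A : atlas R M n}.
Variable Q : bundle A.

Local Notation TM := (tangent_bundle A).

Record is_dull (rho : bmor Q TM) (D : Gamma Q -> Gamma Q -> Gamma Q) : Prop :=
  IsDull {
  dull_linearl : forall a q1 q2 q, D (a *: q1 + q2) q = a *: D q1 q + D q2 q;
  dull_linearr : forall a q q1 q2, D q (a *: q1 + q2) = a *: D q q1 + D q q2;
  dull_anchor : forall q1 q2 m,
    rho m (D q1 q2 m) = lie (bmap rho q1) (bmap rho q2) m;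
  dull_leibniz : forall (f1 f2 : cinf A) q1 q2 m,
    D (fscale f1 q1) (fscale f2 q2) m =
      (f1 m * f2 m) *: D q1 q2 m + (f1 m * rho m (q1 m) f2) *: q2 m
      - (f2 m * rho m (q2 m) f1) *: q1 m }.

(* The complexification of a real bundle: (x, y) stands for x (x) 1 + y (x) i;
   likewise pairs of sections of B are the sections of its complexification. *)
Definition cplx (B : bundle A) : bundle A := bsum B B.

Definition cplx_scale (V : lmodType R) (z : R[i]) (x : V * V) : V * V :=
  (complex.Re z *: x.1 - complex.Im z *: x.2,
   complex.Re z *: x.2 + complex.Im z *: x.1).

Definition cplx_act m (v : cplx TM m) (f : ccinf A) : R[i] :=
  Complex (v.1 (cinf_re f) - v.2 (cinf_im f))
          (v.1 (cinf_im f) + v.2 (cinf_re f)).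

Variable j : bmor Q Q.

Definition jscale m (z : R[i]) (x : Q m) : Q m :=
  complex.Re z *: x + complex.Im z *: j m x.

Definition jscale_const (z : R[i]) (q : Gamma Q) : Gamma Q :=
  complex.Re z *: q + complex.Im z *: bmap j q.

Definition jscale_fun (f : ccinf A) (q : Gamma Q) : Gamma Q :=
  fscale (cinf_re f) q + fscale (cinf_im f) (bmap j q).

Record is_complex_lie_algebroid (lambda : bmor Q (cplx TM))
    (br : Gamma Q -> Gamma Q -> Gamma Q) : Prop := IsComplexLieAlgebroid {
  cla_anchor : forall z m (x : Q m),
    lambda m (jscale z x) = cplx_scale z (lambda m x);
  cla_linearl : forall z q1 q2 q,
    br (jscale_const z q1 + q2) q = jscale_const z (br q1 q) + br q2 q;
  cla_linearr : forall z q q1 q2,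
    br q (jscale_const z q1 + q2) = jscale_const z (br q q1) + br q q2;
  cla_alternating : forall q, br q q = 0;
  cla_jacobi : forall q1 q2 q3,
    br q1 (br q2 q3) + br q2 (br q3 q1) + br q3 (br q1 q2) = 0;
  cla_leibniz : forall q1 (f : ccinf A) q2 m,
    br q1 (jscale_fun f q2) m =
      jscale (cplx_act (lambda m (q1 m)) f) (q2 m)
      + jscale (f m) (br q1 q2 m) }.

Section real_anchor.
Variable rho : bmor Q TM.

Definition rho_j_fun m (x : Q m) : cplx TM m :=
  2^-1 *: ((rho m x, - rho m (j m x)) : cplx TM m).

Fact rho_j_linear m (a : R) (x y : Q m) :
  rho_j_fun (a *: x + y) = a *: rho_j_fun x + rho_j_fun y.
Proof.
rewrite /rho_j_fun !bmor_linear scalerA mulrC -scalerA -scalerDr.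
congr (_ *: _).
by congr pair; rewrite /= opprD scalerN.
Qed.

Fact rho_j_smooth s : smooth_section Q s ->
  smooth_section (cplx TM) (fun m => rho_j_fun (s m)).
Proof.
move=> sQ; have s1 := bmor_smooth rho sQ.
have s2 := bmor_smooth rho (bmor_smooth j sQ).
have sc (a : R) := @smooth_on_cst R M n A setT a.
split; first exact: (smooth_sectionM (sc 2^-1) s1).
have := smooth_sectionM (sc 2^-1) (smooth_sectionM (sc (-1)) s2).
congr smooth_section; apply: functional_extensionality_dep => m /=.
by rewrite scaleN1r.
Qed.

Definition rho_j : bmor Q (cplx TM) :=
  Bmor (B := Q) (C := cplx TM) (bmor_val := @rho_j_fun) rho_j_linear rho_j_smooth.

End real_anchor.

Definition cplx_anchor (rho : bmor Q TM) m (x : cplx Q m) : cplx TM m :=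
  (rho m x.1, rho m x.2).

Definition cplx_bracket (D : Gamma Q -> Gamma Q -> Gamma Q)
    (s t : Gamma Q * Gamma Q) : Gamma Q * Gamma Q :=
  (D s.1 t.1 - D s.2 t.2, D s.1 t.2 + D s.2 t.1).

(* Sections of the i-eigenbundle of the complexification of j. *)
Definition in_Q10 (s : Gamma Q * Gamma Q) :=
  (bmap j s.1, bmap j s.2) = cplx_scale (Complex 0 1) s.

Definition to_Q10 m (x : Q m) : cplx Q m :=
  2^-1 *: ((x, - j m x) : cplx Q m).

Definition section_to_Q10 (q : Gamma Q) : Gamma Q * Gamma Q :=
  2^-1 *: ((q, - bmap j q) : (Gamma Q * Gamma Q)%type).

Record realises (rho : bmor Q TM) (D : Gamma Q -> Gamma Q -> Gamma Q)
    (lambda : bmor Q (cplx TM)) (br : Gamma Q -> Gamma Q -> Gamma Q) : Prop :=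
  Realises {
  rl_restricts : forall s t,
    in_Q10 s -> in_Q10 t -> in_Q10 (cplx_bracket D s t);
  rl_anchor : forall m (x : Q m), cplx_anchor rho (to_Q10 x) = lambda m x;
  rl_bracket : forall q1 q2,
    cplx_bracket D (section_to_Q10 q1) (section_to_Q10 q2)
    = section_to_Q10 (br q1 q2) }.

Definition is_quasi_real (lambda : bmor Q (cplx TM))
    (br : Gamma Q -> Gamma Q -> Gamma Q) :=
  exists rho : bmor Q TM, (forall m (x : Q m), lambda m x = rho_j rho m x) /\
  exists D, is_dull rho D /\ realises rho D lambda br.

End quasi_real.

Section correspondence.
Context {R : realType} {M : Type} {n k : nat} {E : M -> lmodType R}.
Variables (A : atlas R M n) (F : set (triv E k)).
Variable j : bmor (side_bundle A F) (side_bundle A F).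

Definition linear_gcs :=
  {J : bmor (pontryagin_bundle (total_atlas A F))
            (pontryagin_bundle (total_atlas A F))
  | is_gcs J /\ is_linear_over j J}.

Definition side_lambda := rho_j j (side_anchor A F).

Definition quasi_real_cla :=
  {br : Gamma (side_bundle A F) -> Gamma (side_bundle A F) ->
        Gamma (side_bundle A F)
  | is_complex_lie_algebroid j side_lambda br
    /\ is_quasi_real j side_lambda br}.

End correspondence.

(* Main.v *)
(* A section of TE + T^*E is, over the functions on E, a combination of the
   horizontal lifts sigma^D(nu) of a dull bracket D and of the core sections, and
   the Courant bracket, pairing and linear structure are explicit on these: if t
   denotes the pairing of the bracket of two sections with a third one, then
   t(sigma nu1, sigma nu2, sigma nu3) is the linear function of the E^*-part of
     D(nu1, D(nu2, nu3)) - D(nu2, D(nu1, nu3)) + D(nu3, D(nu1, nu2)),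
   t(sigma nu1, sigma nu2, core tau) = <D(nu1, nu2), tau>, and t vanishes on two
   or more core sections.  Tangent vectors are derivations, so everything on E is
   tested on functions pulled back from M and on linear functions.

   Put S(p, q) = D(p, q) - D(jp, jq).  If D realises the complex bracket, then
   S is twice this bracket and D(jp, q) + D(p, jq) = j S(p, q); the structure J
   sends sigma(nu) to sigma(j nu) and acts on the core by minus the transpose of
   j.  Its Nijenhuis tensor is totally skew, hence determined by generators, where
   it is the Jacobiator of S (three lifts), the relation above (two lifts and a
   core section), or zero.  Conversely, for a linear J and any dull D0 (a
   connection gives one), the averages (sigma^D0(nu) - J sigma^D0(j nu)) / 2 are
   the lifts of a dull bracket D adapted to J, and S / 2 is the complex bracket. *)

From HB Require Import structures.
Require Import Defs.
From mathcomp Require Import all_boot all_order all_algebra.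
From mathcomp Require Import all_classical all_reals all_analysis.
From mathcomp Require Import finmap complex ring lra.

Set Implicit Arguments.
Unset Strict Implicit.
Unset Printing Implicit Defensive.

Import Order.TTheory GRing.Theory Num.Theory.
Import numFieldNormedType.Exports.
Local Open Scope classical_set_scope.
Local Open Scope ring_scope.

(** * Smooth functions on Euclidean space *)

(** Testing derivations on pullbacks and linear functions rests on two analytic facts: bump
    functions, for locality, and Hadamard's lemma with smooth quotients, for expansion in
    coordinates. Only the chart axioms are established for the total space; its cutoffs are pulled
    back from M, where Hausdorffness makes coordinate balls closed and second countability yields a
    global connection. No dimensions are counted on TE + T^*E: an element is recovered from its
    pairings with lifts and core sections. The bijection is extracted from a relation between C and
    J: some dull bracket realises C and is adapted to J. Uniqueness on both sides is one comparison.
    At a point a of E, the lifts of q for two dull brackets differ by a core element b, and the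
    values D(q, q2) differ at a by the pairing of q2 with b. If both brackets are adapted to one J,
    or both realise one C, the lifts of jq differ by minus the transpose of j applied to b. In the
    first case the changes cancel in S; in the second, a J adapted to one bracket and acting on the
    core as it must is adapted to the other. *)

Lemma half_add {R : realType} (e a : R) : e / 2 * a * a + e / 2 * a * a = e * a * a.
Proof. by field. Qed.

(** The quotient rule for the Taylor quotients [hquot], with analytic quantities replaced by
    variables: [c] is k!, [t] the offset from the hyperplane, [p], [q], [r] the k-th pure derivative
    on the hyperplane and two of its derivatives, [h1], [h2], [h3] quotients of order k. *)
Lemma hquot_identity {R : realType} (c k t p q r s h1 h2 h3 : R) :
  c != 0 -> k + 1 != 0 -> t != 0 ->
  (h1 - p / c) * (- (t^-1 / t) * s) +
  t^-1 * (h2 + s * (h3 - k * ((h1 - p / c) / t)) - c^-1 * q) =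
  (h2 - q / c) / t +
  s * ((h3 - r / c) / t -
   (k + 1) * (((h1 - p / c) / t - r / ((k + 1) * c)) / t)).
Proof. by move=> c0 k0 t0; field; rewrite c0 k0 t0. Qed.

Lemma norm_mul2_le {R : realType} (s e u : R) : s != 0 ->
  `|s * (s * u)| <= e * `|s| * `|s| -> `|u| <= e.
Proof.
move=> s0; rewrite !normrM [e * _]mulrC -[_ * e * _]mulrA [e * _]mulrC.
by rewrite !ler_pM2l// normr_gt0.
Qed.

Section ck.
Context {R : realType} {n : nat}.
Local Notation V := 'rV[R]_n.
Implicit Types (f g : V -> R) (x y v : V).

(** A finite-order version of [smooth_at] that peels off the innermost derivative. Inductions run on
    it: the order drops by one whenever [f] is replaced by a directional derivative. *)
Fixpoint ck m f x : Prop :=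
  (\forall y \near x, {for y, continuous f} /\ forall v, derivable f y v) /\
  if m is m'.+1 then forall v, ck m' (fun y => 'D_v f y) x else True.

Lemma smooth_at_ck f x : smooth_at f x <-> forall m, ck m f x.
Proof.
split=> [fx m|fx].
  elim: m f fx => [|m IH] f fx; split => //; try exact: (fx [::]).
  move=> v; apply: IH => vs; have := fx (rcons vs v).
  by rewrite /iter_derive foldr_rcons.
move=> vs; move: (fx (size vs)); elim/last_ind: vs f fx => [|vs v IH] f fx.
  by case.
rewrite size_rcons => -[_ /(_ v) H].
have := IH (fun y => 'D_v f y); rewrite /iter_derive foldr_rcons; apply => //.
by move=> m; case: (fx m.+1) => _ /(_ v).
Qed.

Lemma near_reg f g x : (\forall y \near x, f y = g y) ->
  (\forall y \near x, {for y, continuous f} /\ forall v, derivable f y v) ->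
  \forall y \near x, {for y, continuous g} /\ forall v, derivable g y v.
Proof.
move/near_join => fg; apply: filterS2 fg => y fg [fc fd].
split=> [|v]; last exact: near_eq_derivable (fd v).
move: fc; rewrite /prop_for /continuous_at (nbhs_singleton fg).
by apply: cvg_trans; exact: (near_eq_cvg fg).
Qed.

Lemma ck_near m f g x : (\forall y \near x, f y = g y) -> ck m f x -> ck m g x.
Proof.
elim: m f g => [|m IH] f g fg [f0 fS]; (split; first exact: near_reg fg f0).
  exact: I.
move=> v; apply: IH (fS v); move/near_join: fg; apply: filterS => y.
exact: near_eq_derive.
Qed.

Lemma ckW m f x : ck m.+1 f x -> ck m f x.
Proof.
elim: m f => [|m IH] f [f0 fS]; split => // v.
by apply: IH; exact: fS.
Qed.

Lemma ck_le m m' f x : (m <= m')%N -> ck m' f x -> ck m f x.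
Proof.
move=> /subnK <-; elim: (m' - m)%N => [//|d IH]; rewrite addSn => fx.
by apply: IH; exact: ckW.
Qed.

Lemma ck_cst m a x : ck m (fun=> a) x.
Proof.
elim: m a => [|m IH] a; split => //; try by near=> y; split=> [|v];
  [exact: cst_continuous|exact: derivable_cst].
move=> v; apply: ck_near (IH 0); near=> y.
by rewrite derive_cst.
Unshelve. all: by end_near. Qed.

Lemma ckD m f g x : ck m f x -> ck m g x -> ck m (fun y => f y + g y) x.
Proof.
elim: m f g => [|m IH] f g [f0 fS] [g0 gS]; (split; first by
   move: f0 g0; apply: filterS2 => y [fc fd] [gc gd];
   split=> [|v]; [exact: (continuousD fc gc)|exact: derivableD]).
  exact: I.
move=> v; apply: ck_near (IH _ _ (fS v) (gS v)).
move: f0 g0; apply: filterS2 => y [_ fd] [_ gd].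
by rewrite [RHS]deriveD.
Qed.

Lemma ckM m f g x : ck m f x -> ck m g x -> ck m (fun y => f y * g y) x.
Proof.
elim: m f g => [|m IH] f g fx gx; (split; first by
   case: fx gx => [f0 _] [g0 _]; move: f0 g0; apply: filterS2 => y [fc fd] [gc gd];
   split=> [|v]; [exact: (continuousM fc gc)|exact: derivableM]).
  exact: I.
move=> v; move: (fx) (gx) => [f0 fS] [g0 gS].
apply: ck_near (ckD (IH _ _ (ckW fx) (gS v)) (IH _ _ (ckW gx) (fS v))).
move: f0 g0; apply: filterS2 => y [_ fd] [_ gd].
by rewrite [RHS]deriveM.
Qed.

Lemma ck_sum m I (r : seq I) (F : I -> V -> R) x :
  (forall i, ck m (F i) x) -> ck m (fun y => \sum_(i <- r) F i y) x.
Proof.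
move=> H; elim: r => [|i r IH].
  by apply: ck_near (ck_cst m 0 x); near=> y; rewrite big_nil.
by apply: ck_near (ckD (H i) IH); near=> y; rewrite big_cons.
Unshelve. all: by end_near. Qed.

Lemma smooth_at_near f g x :
  (\forall y \near x, f y = g y) -> smooth_at f x -> smooth_at g x.
Proof. by move=> fg /smooth_at_ck fx; apply/smooth_at_ck => m; apply: ck_near (fx m). Qed.

Lemma smooth_at_derive f x v : smooth_at f x -> smooth_at (fun y => 'D_v f y) x.
Proof. by move=> /smooth_at_ck fx; apply/smooth_at_ck => m; case: (fx m.+1) => _ /(_ v). Qed.

Lemma smooth_at_sum I (r : seq I) (F : I -> V -> R) x :
  (forall i, smooth_at (F i) x) -> smooth_at (fun y => \sum_(i <- r) F i y) x.
Proof.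
by move=> H; apply/smooth_at_ck => m; apply: ck_sum => i; apply/smooth_at_ck: m.
Qed.

Lemma smooth_at_continuous f x : smooth_at f x -> {for x, continuous f}.
Proof. by move/(_ [::]) => /nbhs_singleton []. Qed.

Lemma smooth_at_derivable f x v : smooth_at f x -> derivable f x v.
Proof. by move/(_ [::]) => /nbhs_singleton [_]; apply. Qed.

Lemma diff_quot_line f x v (t : R) :
  (fun h : R => h^-1 *: ((f \o shift (x + t *: v)) (h *: v) - f (x + t *: v))) =
  (fun h : R => h^-1 *: (((fun s : R => f (x + s *: v)) \o shift t) (h *: (1 : R))
     - f (x + t *: v))).
Proof.
apply/funext => h /=.
by rewrite [h%:A]mulr1 scalerDl; congr (_ *: (f _ - _)); rewrite addrCA.
Qed.

Lemma derive_line f x v (t : R) :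
  'D_v f (x + t *: v) = 'D_(1 : R) (fun s : R => f (x + s *: v)) t.
Proof. by rewrite /derive diff_quot_line. Qed.

Lemma derivable_line f x v (t : R) :
  derivable f (x + t *: v) v <-> derivable (fun s : R => f (x + s *: v)) t 1.
Proof. by rewrite /derivable diff_quot_line. Qed.

(** The mean value theorem on the segment, for both signs of [t]. Differentiability of C^1
    functions, Schwarz's theorem and the bound on Taylor remainders all reduce to this estimate. *)
Lemma line_bound f (z v : V) (t c eps : R) :
  (forall s : R, `|s| <= `|t| ->
     derivable f (z + s *: v) v /\ `|'D_v f (z + s *: v) - c| <= eps) ->
  `|f (z + t *: v) - f z - t * c| <= eps * `|t|.
Proof.
move=> H; pose g (s : R) := f (z + s *: v).
have dg (s : R) : `|s| <= `|t| -> is_derive s (1 : R) g ('D_v f (z + s *: v)).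
  move=> st; rewrite derive_line; apply: derivableP.
  by apply/derivable_line; have [] := H s st.
have g0 : f z = g 0 by rewrite /g scale0r addr0.
have cont (a b : R) : (forall s : R, a <= s <= b -> `|s| <= `|t|) ->
    {within `[a, b], continuous g}.
  move=> ab; apply: derivable_within_continuous => s; rewrite in_itv /= => /ab st.
  by apply: (@ex_derive _ _ _ _ _ _ _ (dg s st)).
rewrite g0 -/(g t).
case: (lerP 0 t) => t0.
  have bnd (s : R) : 0 <= s <= t -> `|s| <= `|t|.
    by move=> /andP[s0 st]; rewrite !ger0_norm// (le_trans s0).
  have [s sI E] := @MVT_segment _ g (fun s => 'D_v f (z + s *: v)) 0 t t0
    (fun s sI => dg s (bnd s (subset_itv_oo_cc sI))) (cont _ _ bnd).
  rewrite in_itv /= in sI.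
  rewrite E subr0 [_ * t]mulrC -mulrBr normrM mulrC ler_wpM2r//.
  by have [] := H s (bnd _ sI).
have bnd (s : R) : t <= s <= 0 -> `|s| <= `|t|.
  by move=> /andP[ts s0]; rewrite !ler0_norm// ?lerN2// ltW.
have [s sI E] := @MVT_segment _ g (fun s => 'D_v f (z + s *: v)) t 0 (ltW t0)
    (fun s sI => dg s (bnd s (subset_itv_oo_cc sI))) (cont _ _ bnd).
rewrite in_itv /= in sI.
have -> : g t - g 0 - t * c = t * ('D_v f (z + s *: v) - c).
  by rewrite -[g t - g 0]opprB E; ring.
rewrite normrM mulrC ler_wpM2r//.
by have [] := H s (bnd _ sI).
Qed.


Lemma row_coord_le (v : V) i : `|v 0 i| <= `|v|.
Proof.
rewrite [leRHS]/Num.Def.normr /= mx_normrE.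
exact: (@le_bigmax _ _ _ 0 (fun ij : 'I_1 * 'I_n => `|v ij.1 ij.2|) (0, i)).
Qed.

Lemma row_norm_le (v : V) (r : R) :
  0 <= r -> (forall i, `|v 0 i| <= r) -> `|v| <= r.
Proof.
move=> r0 H; rewrite [leLHS]/Num.Def.normr /= mx_normrE.
by apply: bigmax_le => // -[i j] _ /=; rewrite (ord1 i).
Qed.

Definition partial_fun (c : 'I_n -> R) (h : V) : R := (h *m \col_i c i) 0 0.

Lemma partial_funE c h : partial_fun c h = \sum_i h 0 i * c i.
Proof. by rewrite /partial_fun mxE; apply: eq_bigr => i _; rewrite mxE. Qed.

Fact partial_fun_linear c : linear (partial_fun c).
Proof. by move=> a x y; rewrite /partial_fun mulmxDl -scalemxAl !mxE. Qed.

HB.instance Definition _ c :=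
  GRing.isLinear.Build R V R _ (partial_fun c) (partial_fun_linear c).

Lemma partial_fun_continuous c : continuous (partial_fun c).
Proof.
move=> x; rewrite (_ : partial_fun c = fun h => \sum_i h 0 i * c i); last first.
  by apply/funext => h; rewrite partial_funE.
elim: (index_enum _) => [|i r IH].
  rewrite (_ : (fun _ => _) = fun=> 0); first exact: cst_continuous.
  by apply/funext => h; rewrite big_nil.
rewrite (_ : (fun _ => _) = fun h : V => h 0 i * c i + \sum_(j <- r) h 0 j * c j).
  by apply: continuousD IH; apply: continuousM; [exact: coord_continuous|exact: cst_continuous].
by apply/funext => h; rewrite big_cons.
Qed.

(** The increment [h] is added one coordinate at a time, so that each step moves along a basis
    vector and falls under [line_bound]. *)
Lemma C1_differentiable_basis f x :
  (\forall y \near x, forall v, derivable f y v) ->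
  (forall i : 'I_n, {for x, continuous (fun y => 'D_(delta_mx 0 i) f y)}) ->
  differentiable f x /\
  ('d f x : V -> R) = partial_fun (fun i => 'D_(delta_mx 0 i) f x).
Proof.
move=> fd fc; set L := partial_fun _.
have key : f \o shift x = cst (f x) + (L : V -> R) +o_ (0 : V) id.
  apply/eqaddoP => e e0.
  (* Each of the n steps costs at most [e'] times the norm of [h]; [n.+1] keeps the denominator
     nonzero when n = 0. *)
  pose e' := e / n.+1%:R.
  have e'0 : 0 < e' by rewrite divr_gt0// ltr0n.
  have : \forall y \near x, (forall v, derivable f y v) /\
      forall i, `|'D_(delta_mx 0 i) f y - 'D_(delta_mx 0 i) f x| <= e'.
    apply: filterS2 fd _ => [y fdy H|]; first by split; [exact: fdy|exact: H].
    apply: (@filter_forall _ _ (fun (i : 'I_n) (y : V) => `|'D_(delta_mx 0 i) f y - 'D_(delta_mx 0 i) f x| <= e') (nbhs x)) => i.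
    have /cvgrPdist_le/(_ _ e'0) := fc i.
    by apply: filterS => y; rewrite distrC.
  move=> /nbhs_ballP[d d0 H].
  apply/nbhs_ballP; exists d => // h; rewrite -ball_normE /= sub0r normrN => hd.
  pose p k : V := \row_i (if (i < k)%N then h 0 i else 0).
  have pd k (s : R) (i : 'I_n) : `|s| <= `|h 0 i| -> (i : nat) = k ->
      ball x d (x + p k + s *: delta_mx 0 i).
    move=> sh ik; rewrite -ball_normE /= -addrA opprD addrA subrr sub0r normrN.
    apply: le_lt_trans hd; apply: row_norm_le => // l; rewrite !mxE eqxx /=.
    have [->|li] := eqVneq l i; first by rewrite ik ltnn add0r mulr1 (le_trans sh)// row_coord_le.
    by rewrite mulr0 addr0; case: ifP => _; rewrite ?normr0// row_coord_le.
  have step k : (k <= n)%N ->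
     `|f (x + p k) - f x - \sum_(i < n | (i < k)%N) h 0 i * 'D_(delta_mx 0 i) f x|
      <= k%:R * (e' * `|h|).
    elim: k => [_|k IH kn].
      rewrite big_pred0 // subr0 mul0r (_ : p 0%N = 0) ?addr0 ?subrr ?normr0//.
      by apply/rowP => i; rewrite !mxE ltn0.
    pose i := Ordinal kn.
    have pS : x + p k.+1 = x + p k + h 0 i *: delta_mx 0 i.
      rewrite -addrA; congr (_ + _); apply/rowP => l; rewrite !mxE eqxx /= ltnS leq_eqVlt.
      have [->|li] := eqVneq l i; first by rewrite eqxx ltnn add0r mulr1.
      by rewrite (_ : (nat_of_ord l == k) = false) ?mulr0 ?addr0//; apply: contraNF li => /eqP lk; apply/eqP/val_inj.
    have := @line_bound f (x + p k) (delta_mx 0 i) (h 0 i) ('D_(delta_mx 0 i) f x) e' _.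
    rewrite -pS => /(_ _)/[dup] _ LB.
    have {}LB : `|f (x + p k.+1) - f (x + p k) - h 0 i * 'D_(delta_mx 0 i) f x| <= e' * `|h 0 i|.
      by apply: LB => s sh; have [fdy De] := H _ (pd k s i sh erefl); split; [exact: fdy|exact: De].
    rewrite (bigD1 i) //= (eq_bigl (fun l : 'I_n => (l < k)%N)); last first.
      move=> l; rewrite ltnS leq_eqVlt -val_eqE /=.
      by case: eqP => [->|_]; rewrite /= ?ltnn ?andbT// andbF.
    set S := \sum_(_ < _ | _) _ in IH *.
    rewrite (_ : _ - _ = (f (x + p k.+1) - f (x + p k) - h 0 i * 'D_(delta_mx 0 i) f x)
       + (f (x + p k) - f x - S)); last by ring.
    apply: le_trans (ler_normD _ _) _; rewrite -natr1 mulrDl mul1r addrC lerD //.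
      by apply: IH; exact: ltnW.
    by apply: le_trans LB _; rewrite ler_wpM2l ?row_coord_le// ltW.
  have pn : p n = h by apply/rowP => i; rewrite mxE ltn_ord.
  have := step n (leqnn n); rewrite pn => st.
  rewrite /= -![(_ + _ : _ -> _) _]/(_ + _) -![(- _ : _ -> _) _]/(- _) /cst /=.
  rewrite [(_ + _ : _ -> _) h]/(_ + _) /= opprD addrA [h + x]addrC.
  have -> : L h = \sum_(i < n | (i < n)%N) h 0 i * 'D_(delta_mx 0 i) f x.
    by rewrite /L partial_funE; apply: eq_bigl => i; rewrite ltn_ord.
  apply: le_trans st _; rewrite mulrA ler_wpM2r// /e' mulrCA ler_piMr ?ltW//.
  by rewrite ltr_pdivrMr ?ltr0n// mul1r ltr_nat.
have dE : ('d f x : V -> R) = L := diff_unique (@partial_fun_continuous _) key.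
split=> //; apply/diff_locallyP; split.
  by rewrite dE; exact: partial_fun_continuous.
by rewrite key dE.
Qed.

End ck.

#[local] Instance row_nbhs_filter {R : realType} (q : nat) (x : 'rV[R]_q) :
  Filter (nbhs x).
Proof. exact: nbhs_filter. Qed.

Section composition.
Context {R : realType} {n p : nat}.
Implicit Types (f : 'rV[R]_n -> R) (g : 'I_n -> 'rV[R]_p -> R) (y v : 'rV[R]_p).

Definition row_fun g y : 'rV[R]_n := \row_i g i y.

Lemma derive_comp f g y v :
  differentiable f (row_fun g y) -> (forall i, derivable (g i) y v) ->
  derivable (fun y => f (row_fun g y)) y v /\
  'D_v (fun y => f (row_fun g y)) y = 'd f (row_fun g y) (\row_i 'D_v (g i) y).
Proof.
move=> df dg; pose h (s : R) := row_fun g (y + s *: v).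
have h0 : h 0 = row_fun g y by rewrite /h scale0r addr0.
have dh : derivable h 0 1.
  apply/derivable_mxP => i l.
  rewrite (_ : (fun _ => _) = fun s => g l (y + s *: v)); last first.
    by apply/funext => s; rewrite /h mxE.
  by apply/derivable_line; rewrite scale0r addr0; exact: dg.
have dh' : differentiable h 0 by apply/derivable1_diffP.
have dfh : differentiable f (h 0) by rewrite h0.
have d := differentiable_comp dh' dfh.
have y0 : y = y + (0 : R) *: v by rewrite scale0r addr0.
split.
  by rewrite y0; apply/derivable_line/derivable1_diffP.
rewrite {1}y0 derive_line.
rewrite [LHS](_ : _ = 'D_1 (f \o h) 0); last by [].
rewrite (deriveE _ d) (diff_comp dh' dfh) /= -(deriveE _ dh') h0.
congr ('d f _ _); rewrite derive_mx//; apply/rowP => i; rewrite !mxE.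
rewrite (_ : (fun _ => _) = fun s => g i (y + s *: v)); last first.
  by apply/funext => s; rewrite /h mxE.
by rewrite -derive_line scale0r addr0.
Qed.

Lemma row_fun_continuous g y :
  (forall i, {for y, continuous (g i)}) -> {for y, continuous (row_fun g)}.
Proof.
move=> gc; apply/(@cvgrPdist_le _ _ _ (nbhs y) (nbhs_filter y)) => e e0.
have : \forall z \near y, forall i, `|g i y - g i z| <= e.
  apply: (@filter_forall _ _ (fun (i : 'I_n) z => `|g i y - g i z| <= e) (nbhs y)) => i.
  by have /cvgrPdist_le/(_ _ e0) := gc i.
by apply: filterS => z gz; apply: row_norm_le => [|i]; [exact: ltW|rewrite !mxE].
Qed.

Lemma near_forall (I : finType) (T : topologicalType) (x : T) (P : I -> T -> Prop) :
  (forall i, \forall y \near x, P i y) -> \forall y \near x, forall i, P i y.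
Proof. exact: filter_forall. Qed.

Lemma C1_near f x : ck 1 f x -> \forall y \near x, {for y, continuous f} /\
  differentiable f y /\
  ('d f y : 'rV[R]_n -> R) = partial_fun (fun i => 'D_(delta_mx 0 i) f y).
Proof.
move=> [fx fS].
have fS' : \forall y \near x, forall i : 'I_n,
    {for y, continuous (fun z => 'D_(delta_mx 0 i) f z)}.
  apply: near_forall => i.
  by have [H _] := fS (delta_mx 0 i); apply: filterS H => y [].
move/near_join: (fx) => fx2.
near=> y.
have [fc fd] : {for y, continuous f} /\ forall v : 'rV[R]_n, derivable f y v by near: y.
split; first exact: fc.
apply: C1_differentiable_basis.
  by near: y; move: fx2; apply: filterS => y; apply: filterS => z [].
by near: y.
Unshelve. all: by end_near. Qed.

Lemma near_row_fun g y (P : 'rV[R]_n -> Prop) :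
  (forall i, {for y, continuous (g i)}) ->
  (\forall z \near row_fun g y, P z) -> \forall z \near y, P (row_fun g z).
Proof. by move=> gc; exact: (row_fun_continuous gc). Qed.

(** One order is lost because differentiability of [f] near the point is drawn from its being C^1
    there. The loss is harmless for smooth functions. *)
Lemma ck_comp m f g y : ck m.+1 f (row_fun g y) ->
  (forall i, ck m.+1 (g i) y) -> ck m (fun y => f (row_fun g y)) y.
Proof.
elim: m f g => [|m IH] f g fx gx.
all: have gc i : {for y, continuous (g i)} by
  have [/nbhs_singleton[]] := gx i.
all: have ng : \forall z \near y, forall i, {for z, continuous (g i)} /\
   forall v, derivable (g i) z v by
  apply: near_forall => i; have [] := gx i.
all: have nf : \forall z \near y, {for row_fun g z, continuous f} /\
     differentiable f (row_fun g z) /\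
     ('d f (row_fun g z) : 'rV[R]_n -> R) =
     partial_fun (fun i => 'D_(delta_mx 0 i) f (row_fun g z)) by
   apply: (near_row_fun gc (C1_near _)); first [exact: fx | exact: (@ck_le _ _ 1 _ _ _ _ fx)].
all: have main : \forall z \near y,
   ({for z, continuous (fun y => f (row_fun g y))} /\
    forall v, derivable (fun y => f (row_fun g y)) z v) /\
   forall v, 'D_v (fun y => f (row_fun g y)) z =
     \sum_i 'D_v (g i) z * 'D_(delta_mx 0 i) f (row_fun g z).
1,3: move: ng nf; apply: filterS2 => z gz [fc [fd fE]];
  have dv v := derive_comp fd (fun i => (gz i).2 v); split=> [|v]; first split=> [|v];
  [exact: (continuous_comp (row_fun_continuous (fun i => (gz i).1)) fc)
  |exact: (dv v).1|].
1,2: by rewrite (dv v).2 fE partial_funE; apply: eq_bigr => i _; rewrite mxE.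
- by split; [move: main; apply: filterS => z []|exact: I].
- split; first by move: main; apply: filterS => z [].
  move=> v; apply: (@ck_near _ _ _ (fun z => \sum_i 'D_v (g i) z * 'D_(delta_mx 0 i) f (row_fun g z))).
    by move: main; apply: filterS => z [_ ->].
  apply: ck_sum => i; apply: ckM.
    by case: (ckW (gx i)) => _ /(_ v); apply.
  apply: (IH (fun z => 'D_(delta_mx 0 i) f z)); first by case: fx => _ /(_ (delta_mx 0 i)).
  by move=> l; apply: ckW.
Qed.

Lemma smooth_at_comp f g y : smooth_at f (row_fun g y) ->
  (forall i, smooth_at (g i) y) -> smooth_at (fun y => f (row_fun g y)) y.
Proof.
move=> /smooth_at_ck fx gx; apply/smooth_at_ck => m; apply: ck_comp => // i.
by apply/smooth_at_ck: m.+1; exact: gx.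
Qed.

End composition.

Section coordinates.
Context {R : realType} {n : nat}.
Local Notation V := 'rV[R]_n.
Implicit Types (f : V -> R) (x v w : V) (i : 'I_n).

Lemma derive_coord i x v : 'D_v (fun y : V => y 0 i) x = v 0 i.
Proof.
have -> : x = x + (0 : R) *: v by rewrite scale0r addr0.
rewrite derive_line.
rewrite (_ : (fun _ => _) = fun s : R => x 0 i + v 0 i * s); last first.
  by apply/funext => s; rewrite !mxE mulrC.
rewrite deriveD; [|exact: derivable_cst|by apply: derivableM; [exact: derivable_cst|exact: derivable_id]].
rewrite derive_cst add0r deriveM; [|exact: derivable_cst|exact: derivable_id].
by rewrite derive_cst derive_id scaler0 addr0 [_%:A]mulr1.
Qed.

Lemma derivable_coord i x v : derivable (fun y : V => y 0 i) x v.
Proof. by apply: diff_derivable; exact: differentiable_coord. Qed.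

Lemma smooth_at_coord i x : smooth_at (fun y : V => y 0 i) x.
Proof.
apply/smooth_at_ck => -[|m]; split; first [exact: I|idtac].
1,2: by near=> y; split=> [|v]; [exact: coord_continuous|exact: derivable_coord].
move=> v; apply: (@ck_near _ _ _ (fun=> v 0 i)); last exact: ck_cst.
by near=> y; rewrite derive_coord.
Unshelve. all: by end_near. Qed.

Lemma differentiable_smooth f x : smooth_at f x -> differentiable f x /\
  ('d f x : V -> R) = partial_fun (fun i => 'D_(delta_mx 0 i) f x).
Proof. by move/smooth_at_ck/(_ 1%N)/C1_near/nbhs_singleton => -[]. Qed.

Lemma derive_sumE f x v : smooth_at f x ->
  'D_v f x = \sum_i v 0 i * 'D_(delta_mx 0 i) f x.
Proof. by move/differentiable_smooth => [df E]; rewrite deriveE// E partial_funE. Qed.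

(** [line_bound] is used twice: along [v] for the difference [f (z + s *: w) - f z], whose
    derivative is a difference of values of D_v f, and then along [w] for D_v f itself. *)
Lemma second_difference f x v w (c e : R) : 0 <= e ->
  (\forall y \near x, derivable f y v) ->
  (\forall y \near x, derivable (fun z => 'D_v f z) y w /\
      `|'D_w (fun z => 'D_v f z) y - c| <= e) ->
  \forall s \near (0 : R), `|f (x + s *: v + s *: w) - f (x + s *: v) -
     (f (x + s *: w) - f x) - s * (s * c)| <= e * `|s| * `|s|.
Proof.
move=> e0 /nbhs_ballP[d1 d10 H1] /nbhs_ballP[d2 d20 H2].
pose d := Num.min d1 d2.
have d0 : 0 < d by rewrite lt_min; apply/andP.
pose K := `|v| + `|w| + 1.
have K0 : 0 < K by rewrite ltr_wpDl// addr_ge0.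
apply/nbhs_ballP; exists (d / K); first by rewrite /= divr_gt0.
move=> s; rewrite -ball_normE /= sub0r normrN ltr_pdivlMr// => sd.
have B (a b : R) : `|a| <= `|s| -> `|b| <= `|s| -> ball x d (x + a *: v + b *: w).
  move=> la lb; rewrite -ball_normE /= -addrA opprD addrA subrr sub0r normrN.
  apply: le_lt_trans (ler_normD _ _) _; rewrite !normrZ.
  apply: le_lt_trans (lerD (ler_wpM2r _ la) (ler_wpM2r _ lb)) _ => //.
  by apply: le_lt_trans sd; rewrite -mulrDr ler_wpM2l// lerDl.
have B1 z : ball x d z -> ball x d1 z by apply: le_ball; rewrite /d ge_min lexx.
have B2 z : ball x d z -> ball x d2 z by apply: le_ball; rewrite /d ge_min lexx orbT.
pose g z := f (z + s *: w) - f z.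
rewrite -[f (x + s *: v + s *: w) - _]/(g (x + s *: v)) -/(g x).
apply: (@line_bound _ _ g x v s (s * c) (e * `|s|)) => r rs.
have b1 := B1 _ (B r s rs (lexx _)).
have b2 := B1 _ (B r 0 rs _); rewrite normr0 scale0r addr0 in b2.
have fs : derivable (fun z => f (z + s *: w)) (x + r *: v) v.
  have := H1 _ b1; rewrite addrAC => /derivable_line dl; apply/derivable_line.
  rewrite (_ : (fun _ => _) = (fun s0 : R => f (x + s *: w + s0 *: v)))//.
  by apply/funext => s0; rewrite addrAC.
have fr : derivable f (x + r *: v) v by apply: H1; apply: b2.
have Eg : 'D_v g (x + r *: v) = 'D_v f (x + r *: v + s *: w) - 'D_v f (x + r *: v).
  rewrite [LHS](deriveB fs fr); congr (_ - _).
  rewrite derive_line (addrAC x (r *: v)) derive_line.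
  set h1 := (fun _ => _); set h2 := (fun _ => _).
  have -> : h1 = h2 by apply/funext => s0; rewrite /h1 /h2 addrAC.
  exact: erefl.
split; first exact: (derivableB fs fr).
rewrite Eg; apply: (@line_bound _ _ (fun z => 'D_v f z) (x + r *: v) w s c e) => q qs.
exact/H2/B2/B.
Qed.

(** The second difference is symmetric in [v] and [w], so it lies within e' s^2 of both s^2 c and
    s^2 c'; one small nonzero s then compares the two constants. *)
Lemma schwarz f x v w : smooth_at f x ->
  'D_w (fun z => 'D_v f z) x = 'D_v (fun z => 'D_w f z) x.
Proof.
move=> fx; set c := LHS; set c' := RHS.
have nd u : \forall y \near x, derivable f y u.
  by apply: filterS (fx [::]) => y [].
have nd2 u u' (e : R) : 0 < e -> \forall y \near x, derivable (fun z => 'D_u f z) y u' /\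
      `|'D_u' (fun z => 'D_u f z) y - 'D_u' (fun z => 'D_u f z) x| <= e.
  move=> e0; have := smooth_at_continuous (smooth_at_derive u' (smooth_at_derive u fx)).
  move=> /(@cvgrPdist_le _ _ _ (nbhs x) (nbhs_filter x))/(_ _ e0) near1.
  apply: filterS2 near1 (smooth_at_derive u fx [::]) => y.
  by move=> H [_ dd]; split; [exact: (dd u')|rewrite distrC].
apply: subr0_eq; apply/eqP; rewrite -normr_le0; apply/ler_addgt0Pr => e e0; rewrite add0r.
pose e' := e / 2; have e'0 : 0 < e' by rewrite divr_gt0.
have n1 := second_difference (ltW e'0) (nd v) (nd2 v w e' e'0).
have n2 := second_difference (ltW e'0) (nd w) (nd2 w v e' e'0).
have [s [s0 [k1 k2]]] : exists s : R, s != 0 /\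
    (`|f (x + s *: v + s *: w) - f (x + s *: v) -
     (f (x + s *: w) - f x) - s * (s * c)| <= e' * `|s| * `|s| /\
    `|f (x + s *: w + s *: v) - f (x + s *: w) -
     (f (x + s *: v) - f x) - s * (s * c')| <= e' * `|s| * `|s|).
  have [d d0 H] := (nbhs_ballP (0 : R) _).1 (filterI n1 n2).
  exists (d / 2); split; first by rewrite gt_eqF// divr_gt0.
  apply: H; rewrite -ball_normE /= sub0r normrN gtr0_norm ?divr_gt0//.
  by rewrite ltr_pdivrMr// ltr_pMr// ltr1n.
have : `|s * (s * (c - c'))| <= e * `|s| * `|s|.
  rewrite (addrAC x (s *: w)) in k2.
  rewrite (_ : s * _ = (f (x + s *: v + s *: w) - f (x + s *: w) -
     (f (x + s *: v) - f x) - s * (s * c')) - (f (x + s *: v + s *: w) - f (x + s *: v) -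
     (f (x + s *: w) - f x) - s * (s * c))); last by ring.
  apply: le_trans (ler_normB _ _) _; apply: le_trans (lerD k2 k1) _.
  by rewrite le_eqVlt; apply/orP; left; apply/eqP; exact: half_add.
exact: norm_mul2_le.
Qed.

End coordinates.

(** * Hadamard's lemma through iterated difference quotients *)

Section hadamard.
Context {R : realType} {n : nat}.
Local Notation V := 'rV[R]_n.
Implicit Types (f : V -> R) (x v : V).

Definition smooth_all f := forall x, smooth_at f x.

Lemma smooth_all_derive f v : smooth_all f -> smooth_all (fun x => 'D_v f x).
Proof. by move=> sf x; apply: smooth_at_derive. Qed.

Variables (i : 'I_n) (a : R).

Definition freeze x : V := \row_l (if l == i then a else x 0 l).
Definition freeze_dir v : V := \row_l (if l == i then 0 else v 0 l).

Lemma freezeD x v (h : R) : freeze (h *: v + x) = h *: freeze_dir v + freeze x.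
Proof. by apply/rowP => l; rewrite !mxE; case: ifP => _; rewrite ?mulr0 ?add0r. Qed.

Lemma freeze_id x : x 0 i = a -> freeze x = x.
Proof. by move=> xa; apply/rowP => l; rewrite mxE; case: eqP => [->|//]. Qed.

Lemma smooth_freeze f : smooth_all f -> smooth_all (fun x => f (freeze x)).
Proof.
move=> sf x.
have E y : freeze y = row_fun (fun l y => if l == i then a else y 0 l) y.
  by apply/rowP => l; rewrite !mxE.
apply: (@smooth_at_near _ _ (fun y => f (row_fun (fun l y => if l == i then a else y 0 l) y))).
  by near=> y; rewrite E.
apply: smooth_at_comp => [|l]; first exact: sf.
by case: (l == i); [exact: smooth_at_cst|exact: smooth_at_coord].
Unshelve. all: by end_near. Qed.

Lemma derive_freeze f x v :
  'D_v (fun y => f (freeze y)) x = 'D_(freeze_dir v) f (freeze x).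
Proof.
rewrite /derive; set q1 := (fun _ : R => _); set q2 := (fun _ : R => _).
suff -> : q1 = q2 by [].
by apply/funext => h; rewrite /q1 /q2 /= freezeD.
Qed.

Local Notation t x := (x 0 i - a).
Local Notation e := (delta_mx 0 i : V).

Definition dpow k f : V -> R := iter k (fun g x => 'D_e g x) f.

Lemma dpowSr k f : dpow k.+1 f = dpow k (fun x => 'D_e f x).
Proof. by rewrite /dpow iterSr. Qed.

Lemma smooth_dpow k f : smooth_all f -> smooth_all (dpow k f).
Proof. by move=> sf; elim: k => [|k IH]; [exact: sf|exact: smooth_all_derive]. Qed.

Lemma dpow_derive k f v : smooth_all f ->
  dpow k (fun x => 'D_v f x) = fun x => 'D_v (dpow k f) x.
Proof.
move=> sf; elim: k => [//|k IH] /=; rewrite IH.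
by apply/funext => x; apply: schwarz; exact: smooth_dpow.
Qed.

(** The Taylor quotient of order k in the i-th coordinate: f minus its Taylor polynomial of degree
    less than k along the hyperplane x_i = a, divided by (x_i - a)^k, with the limit value on the
    hyperplane. Hadamard's lemma uses order 1, but differentiation raises the order, so smoothness
    is proved for all orders at once. *)
Fixpoint hquot k f x : R := if k is k'.+1 then
  if t x == 0 then dpow k f x / k`!%:R
  else (hquot k' f x - dpow k' f (freeze x) / k'`!%:R) / t x else f x.

Lemma hquot0 k f x : t x = 0 -> hquot k f x = dpow k f x / k`!%:R.
Proof. by case: k => [|k] /= => [_|->]; rewrite ?divr1 ?eqxx. Qed.

Lemma hquotS k f x : hquot k f x = dpow k f (freeze x) / k`!%:R + t x * hquot k.+1 f x.
Proof.
rewrite [hquot k.+1 f x]/=; case: eqP => [t0|/eqP t0].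
  by rewrite t0 mul0r addr0 hquot0// freeze_id//; apply: subr0_eq.
by rewrite [t x * _]mulrC divfK// addrC subrK.
Qed.

Definition taylor_rest k f x :=
  f x - \sum_(l < k) t x ^+ l / l`!%:R * dpow l f (freeze x).

Lemma taylor_hquot k f x : taylor_rest k f x = t x ^+ k * hquot k f x.
Proof.
rewrite /taylor_rest; elim: k => [|k IH]; first by rewrite big_ord0 subr0 mul1r.
move: (hquotS k f x); set u := hquot k.+1 f x => E.
rewrite big_ord_recr /= opprD addrA IH exprS E.
move: {E}u (dpow k f (freeze x)) (t x ^+ k) (k`!%:R^-1) => u d p c.
ring.
Qed.

Lemma derive_e_freeze f x : 'D_e (fun y => f (freeze y)) x = 0.
Proof.
rewrite derive_freeze (_ : freeze_dir _ = 0) ?derive0//.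
by apply/rowP => l; rewrite !mxE eqxx; case: eqP.
Qed.

Lemma derive_tpow l x : derivable (fun z : V => t z ^+ l.+1) x e /\
  'D_e (fun z : V => t z ^+ l.+1) x = l.+1%:R * t x ^+ l.
Proof.
have d1 : derivable (fun z : V => t z) x e.
  by apply: derivableD; [exact: derivable_coord|exact: derivable_cst].
have v1 : 'D_e (fun z : V => t z) x = 1.
  rewrite deriveD; [|exact: derivable_coord|exact: derivable_cst].
  by rewrite derive_coord derive_cst addr0 mxE !eqxx.
elim: l => [|l [d2 v2]]; first by rewrite expr0 mulr1; split; [exact: d1|exact: v1].
have E : (fun z : V => t z ^+ l.+2) = (fun x => t x * t x ^+ l.+1).
  by apply/funext => y; rewrite exprS.
rewrite E; split; first exact: (derivableM d1 d2).
rewrite (deriveM d1 d2) v1 v2 /GRing.scale /= mulr1 -[in RHS](natr1 l.+1) (exprS _ l).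
by move: (t x ^+ l) (l.+1%:R : R) => p q; ring.
Qed.

(** Differentiating term by term in the i-th direction shifts the Taylor polynomial of f to that of
    its derivative; this lowers the order in the induction for [taylor_rest_bound]. *)
Lemma derive_taylor_rest k f : smooth_all f ->
  smooth_all (taylor_rest k f) /\
  forall x, 'D_e (taylor_rest k.+1 f) x = taylor_rest k (fun x => 'D_e f x) x.
Proof.
move=> sf.
have st l : smooth_all (fun x => t x ^+ l / l`!%:R * dpow l f (freeze x)).
  move=> x; apply: smooth_atM; last exact: (smooth_freeze (smooth_dpow l sf)).
  apply: smooth_atM; last exact: smooth_at_cst.
  elim: l => [|l IH]; first exact: smooth_at_cst.
  rewrite (_ : (fun _ => _) = (fun x => t x * t x ^+ l)); last first.
    by apply/funext => z; rewrite exprS.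
  apply: smooth_atM IH; apply: smooth_atD; first exact: smooth_at_coord.
  exact: smooth_at_cst.
have TS q : taylor_rest q.+1 f =
    fun x => taylor_rest q f x + -1 * (t x ^+ q / q`!%:R * dpow q f (freeze x)).
  by apply/funext => x; rewrite /taylor_rest big_ord_recr /= mulN1r opprD addrA.
have sT q : smooth_all (taylor_rest q f).
  elim: q => [|q IH] x.
    apply: smooth_at_near (sf x); near=> y.
    by rewrite /taylor_rest big_ord0 subr0.
  rewrite TS; apply: smooth_atD; first exact: IH.
  by apply: smooth_atM; [exact: smooth_at_cst|exact: st].
split; first exact: sT.
elim: k => [|k IH] x.
  rewrite [in RHS]/taylor_rest big_ord0 subr0 TS.
  rewrite deriveD; [|exact: smooth_at_derivable (sT 0%N x)|
    by apply: smooth_at_derivable; apply: smooth_atM; [exact: smooth_at_cst|exact: st]].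
  rewrite (_ : taylor_rest 0 f = f); last first.
    by apply/funext => z; rewrite /taylor_rest big_ord0 subr0.
  rewrite (_ : (fun _ => -1 * _) = fun z => (- f) (freeze z)); last first.
    by apply/funext => z; rewrite expr0 fact0 divr1 mul1r mulN1r.
  by rewrite derive_e_freeze addr0.
rewrite TS deriveD; [|exact: smooth_at_derivable (sT k.+1 x)|
    by apply: smooth_at_derivable; apply: smooth_atM; [exact: smooth_at_cst|exact: st]].
rewrite IH [in RHS]/taylor_rest big_ord_recr /= opprD addrA -/(taylor_rest k _ x).
congr (_ + _); rewrite -dpowSr.
pose d z := dpow k.+1 f (freeze z).
have sd : smooth_all d by exact: smooth_freeze (smooth_dpow _ sf).
have d2 := (derive_tpow k x).1.
rewrite (_ : (fun _ : V => _) = fun z : V => (- (k.+1`!%:R^-1)) * (t z ^+ k.+1 * d z)); last first.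
  by apply/funext => z; rewrite /d /=; ring.
have dm : derivable (fun z : V => t z ^+ k.+1 * d z) x e.
  by apply: derivableM; [exact: d2|exact: smooth_at_derivable].
rewrite deriveM; [|exact: derivable_cst|exact: dm].
rewrite derive_cst scaler0 addr0.
rewrite deriveM; [|exact: d2|exact: smooth_at_derivable].
rewrite (derive_tpow k x).2 /d derive_e_freeze scaler0 add0r /GRing.scale /=.
rewrite factS natrM invfM.
have k0 : k.+1%:R != 0 :> R by rewrite pnatr_eq0.
have k1 : k`!%:R != 0 :> R by rewrite pnatr_eq0 -lt0n fact_gt0.
move: (dpow k.+1 f (freeze x)) (t x ^+ k) => u p.
by field; apply/andP.
Unshelve. all: by end_near. Qed.

(** Induction on k: the function [g] below vanishes on the hyperplane and its derivative is the same
    expression one order lower, so [line_bound] with slope 0 gains one factor of [t x]. *)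
Lemma taylor_rest_bound k f x (c eps : R) : smooth_all f ->
  (forall s : R, `|s| <= `|t x| -> `|dpow k f (freeze x + s *: e) - c| <= eps) ->
  `|taylor_rest k f x - t x ^+ k * (c / k`!%:R)| <= eps * `|t x| ^+ k.
Proof.
elim: k f x => [|k IH] f x sf H.
  rewrite /taylor_rest big_ord0 subr0 mul1r divr1 mulr1.
  have := H (t x) (lexx _); rewrite (_ : freeze x + _ = x) //.
  apply/rowP => l; rewrite !mxE eqxx /=.
  by have [->|_] := eqVneq l i; rewrite ?mulr1 ?mulr0 ?addr0// addrC subrK.
have tz (s : R) : (freeze x + s *: e) 0 i - a = s.
  by rewrite !mxE !eqxx mulr1 addrAC subrr add0r.
have fz (s : R) : freeze (freeze x + s *: e) = freeze x.
  by apply/rowP => l; rewrite !mxE; case: eqP => //= _; rewrite mulr0 addr0.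
have xE : x = freeze x + t x *: e.
  apply/rowP => l; rewrite !mxE eqxx /=.
  by have [->|_] := eqVneq l i; rewrite ?mulr1 ?mulr0 ?addr0// addrC subrK.
pose g z := taylor_rest k.+1 f z - t z ^+ k.+1 * (c / k.+1`!%:R).
have g0 : g (freeze x) = 0.
  rewrite /g (_ : freeze x 0 i - a = 0); last by rewrite mxE eqxx subrr.
  rewrite exprS mul0r mul0r subr0 taylor_hquot.
  by rewrite (_ : freeze x 0 i - a = 0) ?exprS ?mul0r// mxE eqxx subrr.
have [sT dT] := derive_taylor_rest k.+1 sf.
have dT' := (derive_taylor_rest k sf).2.
have lb := @line_bound _ _ g (freeze x) e (t x) 0 (eps * `|t x| ^+ k).
rewrite g0 subr0 mulr0 subr0 -xE in lb.
rewrite [ `|t x| ^+ k.+1]exprSr [eps * _]mulrA; apply: lb => s st.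
set z := freeze x + s *: e.
have d1 : derivable (taylor_rest k.+1 f) z e by apply: smooth_at_derivable; exact: sT.
have [d2 v2] := derive_tpow k z.
have d3 : derivable (fun z : V => t z ^+ k.+1 * (c / k.+1`!%:R)) z e.
  by apply: derivableM; [exact: d2|exact: derivable_cst].
split; first exact: (derivableB d1 d3).
rewrite subr0 [X in `|X|](deriveB d1 d3) dT' deriveM; [|exact: d2|exact: derivable_cst].
rewrite derive_cst scaler0 add0r v2 /GRing.scale /=.
rewrite (_ : c / _ * _ = t z ^+ k * (c / k`!%:R)); last first.
  rewrite factS natrM invfM.
  have k0 : k.+1%:R != 0 :> R by rewrite pnatr_eq0.
  have k1 : k`!%:R != 0 :> R by rewrite pnatr_eq0 -lt0n fact_gt0.
  by move: (t z ^+ k) => q; field; apply/andP.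
apply: le_trans (IH _ z (smooth_all_derive _ sf) _) _.
  move=> s' s't; rewrite /z fz -dpowSr; apply: H.
  by apply: le_trans s't _; rewrite /z tz.
have eps0 : 0 <= eps by apply: le_trans (H 0 _) => //; rewrite normr0.
by rewrite ler_wpM2l// lerXn2r ?nnegrE// /z tz.
Qed.

Lemma freeze_continuous x : {for x, continuous freeze}.
Proof.
rewrite (_ : freeze = row_fun (fun l y => if l == i then a else y 0 l)); last first.
  by apply/funext => y; apply/rowP => l; rewrite !mxE.
apply: row_fun_continuous => l.
by case: (l == i); [exact: cst_continuous|exact: coord_continuous].
Qed.

(** Dividing [taylor_rest_bound] by (x_i - a)^k compares the quotient at nearby points off the
    hyperplane with its limit value; on the hyperplane it is continuity of the k-th derivative. *)
Lemma hquot_near k f x : smooth_all f -> t x = 0 -> {for x, continuous (hquot k f)}.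
Proof.
move=> sf x0; apply/(@cvgrPdist_le _ _ _ (nbhs x) (nbhs_filter x)) => eps eps0.
rewrite hquot0//; set c := dpow k f x.
have := smooth_at_continuous (smooth_dpow k sf x).
move=> /(@cvgrPdist_le _ _ _ (nbhs x) (nbhs_filter x))/(_ _ eps0).
move=> /nbhs_ballP[d d0 H].
have [d' d'0 H'] := (nbhs_ballP x _).1 (@freeze_continuous x _ (nbhsx_ballx (freeze x) d d0)).
apply/nbhs_ballP; exists (Num.min d' d).
  by rewrite /= lt_min; apply/andP.
move=> y xy.
have dy (s : R) : `|s| <= `|t y| -> `|dpow k f (freeze y + s *: e) - c| <= eps.
  move=> sy; rewrite distrC; apply: H.
  have /H' : ball x d' y by apply: le_ball xy; rewrite ge_min lexx.
  have : ball x d y by apply: le_ball xy; rewrite ge_min lexx orbT.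
  rewrite (freeze_id (subr0_eq x0)) -!ball_normE /= => xyd fyd.
  (* In the sup norm, the i-th coordinate is bounded by that of [x - y], since [x] lies on the
     hyperplane, and the other coordinates are those of [x - freeze y]. *)
  apply: le_lt_trans (_ : Num.max `|x - y| `|x - freeze y| < d); last first.
    by rewrite gt_max; apply/andP.
  apply: row_norm_le => [|l]; first by rewrite le_max normr_ge0.
  rewrite le_max; have [li|li] := eqVneq l i.
    apply/orP; left; apply: le_trans (row_coord_le _ i).
    rewrite !mxE li !eqxx mulr1 opprD addrA (subr0_eq x0) subrr sub0r normrN.
    by rewrite distrC.
  apply/orP; right; apply: le_trans (row_coord_le _ l).
  by rewrite !mxE (negbTE li) andbF mulr0 addr0.
have := taylor_rest_bound sf dy.
rewrite taylor_hquot -mulrBr normrM normrX [eps * _]mulrC.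
have [t0 _|t0] := eqVneq (t y) 0.
  rewrite hquot0// -mulrBl normrM.
  have yE : freeze y + 0 *: e = y by rewrite scale0r addr0 freeze_id//; apply: subr0_eq.
  have := dy 0 _; rewrite normr0 yE => /(_ (normr_ge0 _)).
  rewrite distrC => ce; apply: le_trans (_ : eps * 1 <= _); last by rewrite mulr1.
  apply: ler_pM => //.
  by rewrite ger0_norm ?invr_ge0// invf_le1 ?ltr0n ?fact_gt0// ler1n fact_gt0.
rewrite ler_pM2l ?exprn_gt0 ?normr_gt0//.
by rewrite distrC.
Qed.

Lemma near_t_neq0 x : t x != 0 -> \forall y \near x, t (y : V) != 0.
Proof.
move=> tx; have ct : {for x, continuous (fun y : V => t y)}.
  by apply: continuousD; [exact: coord_continuous|exact: cst_continuous].
exact: (cvgr_neq0 _ ct tx).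
Qed.

Lemma hquotS_neq0 k f x : t x != 0 -> \forall y \near x,
  (hquot k f y - dpow k f (freeze y) / k`!%:R) * (t y)^-1 = hquot k.+1 f y.
Proof. by move/near_t_neq0; apply: filterS => y ty; rewrite /= (negbTE ty). Qed.

Lemma derivable_t x v : derivable (fun y : V => t y) x v.
Proof. by apply: derivableD; [exact: derivable_coord|exact: derivable_cst]. Qed.

Lemma derive_t x v : 'D_v (fun y : V => t y) x = v 0 i.
Proof.
rewrite deriveD; [|exact: derivable_coord|exact: derivable_cst].
by rewrite derive_coord derive_cst addr0.
Qed.

(** Continuity of [h] suffices because the other factor vanishes at [x]. Through [hquotS] this makes
    [hquot k] derivable on the hyperplane from mere continuity of [hquot k.+1]. *)
Lemma derive_tmul (h : V -> R) x v : t x = 0 -> {for x, continuous h} ->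
  derivable (fun y : V => t y * h y) x v /\ 'D_v (fun y : V => t y * h y) x = v 0 i * h x.
Proof.
move=> tx hc.
have C : (fun s : R => s^-1 *: (((fun y : V => t y * h y) \o shift x) (s *: v) - t x * h x)) @ 0^'
    --> v 0 i * h x.
  have C1 : (fun s : R => v 0 i * h (s *: v + x)) @ 0^' --> v 0 i * h x.
    apply: cvgM; first exact: cvg_cst.
    apply: (@cvg_comp _ _ _ (fun s : R => s *: v + x) h _ (nbhs x)); last exact: hc.
    have L : {for (0 : R), continuous (fun s : R => s *: v + x)}.
      by apply: continuousD; [exact: scalel_continuous|exact: cst_continuous].
    rewrite /prop_for /continuous_at scale0r add0r in L.
    by apply: cvg_trans L; apply: cvg_app; exact: cvg_within.
  apply: cvg_trans C1; apply: near_eq_cvg.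
  near=> s.
  have s0 : s != 0 by near: s; exact: nbhs_dnbhs_neq.
  rewrite /= tx mul0r subr0 !mxE -addrA tx addr0 /GRing.scale /=.
  by rewrite !mulrA mulVf// mul1r.
split; first by apply/cvg_ex; exists (v 0 i * h x).
by apply: cvg_lim.
Unshelve. all: by end_near. Qed.

Lemma derivable_freeze f x v : smooth_all f -> derivable (fun y => f (freeze y)) x v.
Proof. by move=> sf; apply: smooth_at_derivable; exact: smooth_freeze. Qed.

Lemma hquot_continuous k f : smooth_all f -> continuous (hquot k f).
Proof.
move=> sf; suff H (x : V) : {for x, continuous (hquot k f)} by move=> x; exact: H.
have [t0|tx] := eqVneq (t x) 0; first exact: hquot_near.
elim: k => [|k IH]; first exact: smooth_at_continuous (sf x).
have := hquotS_neq0 k f tx => /[dup] /nbhs_singleton E /near_eq_cvg H.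
rewrite /prop_for /continuous_at -E; apply: cvg_trans H _.
have c1 : {for x, continuous (fun y => dpow k f (freeze y) / k`!%:R)}.
  apply: continuousM; last exact: cst_continuous.
  exact: smooth_at_continuous (smooth_freeze (smooth_dpow k sf) x).
have c2 : {for x, continuous (fun y : V => t y)}.
  by apply: continuousD; [exact: coord_continuous|exact: cst_continuous].
have c3 : {for x, continuous (fun y => (hquot k f y - dpow k f (freeze y) / k`!%:R) / t y)}.
  exact: (cvgM (cvgB IH c1) (cvgV tx c2)).
exact: c3.
Qed.

(** The family of all Taylor quotients is closed under differentiation. On the hyperplane the
    formula comes from [hquotS] and [derive_tmul], off it from the quotient rule by induction on
    k. *)
Lemma derive_hquot k f x v : smooth_all f ->
  derivable (hquot k f) x v /\
  'D_v (hquot k f) x = hquot k (fun y => 'D_(freeze_dir v) f y) x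
    + v 0 i * (hquot k (fun y => 'D_e f y) x - k%:R * hquot k.+1 f x).
Proof.
move=> sf; have [t0|tx] := eqVneq (t x) 0.
  have E : hquot k f = fun x => dpow k f (freeze x) * k`!%:R^-1 + t x * hquot k.+1 f x.
    by apply/funext => y; rewrite -hquotS.
  have [d2 v2] := derive_tmul v t0 (@hquot_continuous k.+1 f sf x).
  have d1 := @derivable_freeze _ x v (smooth_dpow k sf).
  have d3 : derivable (fun y => dpow k f (freeze y) * k`!%:R^-1) x v.
    by apply: derivableM; [exact: d1|exact: derivable_cst].
  rewrite E; split; first exact: (derivableD d3 d2).
  rewrite (deriveD d3 d2) v2 deriveM; [|exact: d1|exact: derivable_cst].
  rewrite derive_cst scaler0 add0r derive_freeze (freeze_id (subr0_eq t0)).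
  rewrite !hquot0// dpow_derive// -dpowSr factS natrM invfM /GRing.scale /=.
  have k0 : k.+1%:R != 0 :> R by rewrite pnatr_eq0.
  have k1 : k`!%:R != 0 :> R by rewrite pnatr_eq0 -lt0n fact_gt0.
  move: ('D_(freeze_dir v) _ _) ('D_e _ _) (v 0 i) => p q r.
  by rewrite -[k.+1%:R]natr1 in k0 *; field; apply/andP.
elim: k => [|k [d1 v1]].
  split; first exact: smooth_at_derivable (sf x).
  rewrite mul0r subr0 /= (derive_sumE v (sf x)) (derive_sumE (freeze_dir v) (sf x)) (bigD1 i)//= addrC.
  rewrite [in RHS](bigD1 i)//= mxE eqxx mul0r add0r; congr (_ + _).
  by apply: eq_bigr => l li; rewrite mxE (negbTE li).
have d2 := @derivable_freeze _ x v (smooth_dpow k sf).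
have d3 : derivable (fun y => dpow k f (freeze y) / k`!%:R) x v.
  by apply: derivableM; [exact: d2|exact: derivable_cst].
have d4 := derivableB d1 d3.
have d5 : derivable (fun y : V => (t y)^-1) x v.
  exact: (@derivableV _ _ (fun y : V => t y) x v tx (@derivable_t x v)).
have d6 := derivableM d4 d5.
have nE := hquotS_neq0 k f tx.
split; first exact: near_eq_derivable nE d6.
rewrite -(near_eq_derive _ nE) (deriveM d4 d5) (deriveB d1 d3) v1.
have -> : (hquot k f - (fun y => dpow k f (freeze y) / k`!%:R)) x =
  hquot k f x - dpow k f (freeze x) / k`!%:R by [].
rewrite deriveM; [|exact: d2|exact: derivable_cst].
rewrite derive_cst scaler0 add0r derive_freeze (@deriveV _ _ (fun y : V => t y) x v tx (@derivable_t x v)) derive_t.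
rewrite -(nbhs_singleton (hquotS_neq0 k (fun y => 'D_(freeze_dir v) f y) tx)).
rewrite -(nbhs_singleton (hquotS_neq0 k (fun y => 'D_e f y) tx)).
rewrite -(nbhs_singleton (hquotS_neq0 k.+1 f tx)) -(nbhs_singleton nE).
rewrite !dpow_derive// factS natrM invfM /GRing.scale /=.
have k0 : k.+1%:R != 0 :> R by rewrite pnatr_eq0.
have k1 : k`!%:R != 0 :> R by rewrite pnatr_eq0 -lt0n fact_gt0.
move: (t x) tx (dpow k f (freeze x)) ('D_(freeze_dir v) (dpow k f) _) ('D_e (dpow k f) _) (v 0 i) (hquot k f x)
  (hquot k (fun y => 'D_(freeze_dir v) f y) x) (hquot k (fun y => 'D_e f y) x)
  => tt tt0 p q r s h1 h2 h3.
rewrite -[k.+1%:R]natr1 in k0 *.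
exact: hquot_identity.
Qed.

Lemma smooth_hquot k f : smooth_all f -> smooth_all (hquot k f).
Proof.
move=> sf x; apply/smooth_at_ck => m; elim: m k f sf x => [|m IH] k f sf x.
all: split; first by near=> y; split=> [|v];
  [exact: (hquot_continuous sf)|exact: (derive_hquot k y v sf).1].
  exact: I.
move=> v; apply: (@ck_near _ _ _ (fun x => hquot k (fun y => 'D_(freeze_dir v) f y) x
    + v 0 i * (hquot k (fun y => 'D_e f y) x + (- k%:R) * hquot k.+1 f x))).
  by near=> y; rewrite (derive_hquot k y v sf).2 mulNr.
apply: ckD; first by apply: IH; exact: smooth_all_derive.
apply: ckM; first exact: ck_cst.
apply: ckD; first by apply: IH; exact: smooth_all_derive.
by apply: ckM; [exact: ck_cst|exact: IH].
Unshelve. all: by end_near. Qed.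

End hadamard.

(** Coordinates are moved to those of [a] one after the other ([p k] has moved the first k). Each
    move contributes one quotient of order 1, and the sum telescopes. *)
Lemma hadamard {R : realType} {n : nat} (f : 'rV[R]_n -> R) (a : 'rV[R]_n) :
  smooth_all f -> exists g : 'I_n -> 'rV[R]_n -> R,
  (forall i, smooth_all (g i)) /\ forall x, f x = f a + \sum_i (x 0 i - a 0 i) * g i x.
Proof.
move=> sf; pose p (k : nat) (x : 'rV[R]_n) : 'rV[R]_n := \row_i (if (i < k)%N then a 0 i else x 0 i).
have pS k (kn : (k < n)%N) x : p k.+1 x = p k (freeze (Ordinal kn) (a 0 (Ordinal kn)) x).
  apply/rowP => i; rewrite !mxE ltnS leq_eqVlt -val_eqE /=.
  by case: eqP => [ik|_] //=; rewrite ik ltnn; congr (a 0 _); apply: val_inj.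
have sp k : (k <= n)%N -> smooth_all (fun x => f (p k x)).
  elim: k => [_|k IH kn].
    by rewrite (_ : (fun x => _) = f)//; apply/funext => x; congr f; apply/rowP => i; rewrite mxE.
  rewrite (_ : (fun x => _) = fun x => f (p k (freeze (Ordinal kn) (a 0 (Ordinal kn)) x))).
    exact: (smooth_freeze _ _ (IH (ltnW kn))).
  by apply/funext => x; rewrite pS.
exists (fun i => hquot i (a 0 i) 1 (fun x => f (p i x))); split=> [i|x].
  by apply: smooth_hquot; apply: sp; exact: ltnW.
have step k : (k <= n)%N -> f x = f (p k x) +
    \sum_(i < n | (i < k)%N) (x 0 i - a 0 i) * hquot i (a 0 i) 1 (fun x => f (p i x)) x.
  elim: k => [_|k IH kn].
    by rewrite big_pred0// addr0; congr f; apply/rowP => i; rewrite mxE.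
  rewrite (IH (ltnW kn)) [in RHS](bigD1 (Ordinal kn))//= addrA; congr (_ + _).
    rewrite pS; have := @hquotS _ _ (Ordinal kn) (a 0 (Ordinal kn)) 0 (fun x => f (p k x)) x.
    by rewrite /= divr1.
  apply: eq_bigl => l; rewrite ltnS (leq_eqVlt l k) -val_eqE /=.
  by case: eqP => [->|_]; rewrite /= ?ltnn ?andbT// andbF.
rewrite {1}(step n (leqnn n)); congr (_ + _).
  by congr f; apply/rowP => i; rewrite mxE ltn_ord.
by apply: eq_bigl => i; rewrite ltn_ord.
Qed.


(** * Bump functions on Euclidean space *)

Section flat.
Context {R : realType}.
Implicit Types (s : R) (k : nat).

(** The cutoffs are built from k = 0; the powers of 1/s make the family closed under
    differentiation, which is how smoothness is proved. *)
Definition flat k s : R := if 0 < s then s^-1 ^+ k * expR (- s^-1) else 0.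

Lemma flat_ge0 k s : 0 <= flat k s.
Proof.
by rewrite /flat; case: ifP => // s0; rewrite mulr_ge0 ?expR_ge0// exprn_ge0// invr_ge0 ltW.
Qed.

Lemma flat_le0 k s : s <= 0 -> flat k s = 0.
Proof. by rewrite /flat ltNge => ->. Qed.

Lemma flat_gt0 k s : 0 < s -> 0 < flat k s.
Proof. by move=> s0; rewrite /flat s0 mulr_gt0 ?expR_gt0// exprn_gt0// invr_gt0. Qed.

Lemma flatS k s : flat k.+1 s = s^-1 * flat k s.
Proof. by rewrite /flat; case: ifP; rewrite ?mulr0// exprS mulrA. Qed.

Lemma flat0_le s s' : s <= s' -> flat 0 s <= flat 0 s'.
Proof.
move=> ss; rewrite {1}/flat; case: ifPn => [s0|_]; last exact: flat_ge0.
rewrite /flat (lt_le_trans s0 ss) !expr0 !mul1r ler_expR lerN2.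
by rewrite lef_pV2 ?posrE// (lt_le_trans s0 ss).
Qed.

(** With u = 1/s this is exp u >= (u / (k + 1))^(k + 1). The linear bound gives continuity at 0 for
    every k, and then the derivative 0 there, because [flat k s] divided by s is [flat k.+1 s]. *)
Lemma flat_bound k s : 0 <= s -> flat k s <= k.+1%:R ^+ k.+1 * s.
Proof.
rewrite le_eqVlt => /orP[/eqP <-|s0]; first by rewrite flat_le0// mulr0.
rewrite /flat s0; set u := s^-1; have u0 : 0 < u by rewrite invr_gt0.
have kp : 0 < k.+1%:R :> R by rewrite ltr0n.
have E : (u / k.+1%:R) ^+ k.+1 <= expR u.
  have -> : expR u = expR (u / k.+1%:R) ^+ k.+1 by rewrite -expRM_natl mulrC divfK// lt0r_neq0.
  apply: lerXn2r; rewrite ?nnegrE ?expR_ge0 ?divr_ge0// ?ltW//.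
  by apply: le_lt_trans (expR_gt1Dx _); rewrite ?lerDr// mulf_neq0// ?lt0r_neq0// invr_gt0.
rewrite expRN.
have -> : s = u^-1 by rewrite invrK.
rewrite ler_pdivrMr ?expR_gt0// -ler_pdivrMl; last by rewrite mulr_gt0 ?exprn_gt0 ?invr_gt0.
apply: le_trans E; rewrite expr_div_n (exprS u).
have un : u != 0 by rewrite lt0r_neq0.
have kn : k.+1%:R ^+ k.+1 != 0 :> R by rewrite expf_neq0// lt0r_neq0.
move: (u ^+ k) (k.+1%:R ^+ k.+1) kn => p q qn.
by rewrite le_eqVlt; apply/orP; left; apply/eqP; field; rewrite un qn.
Qed.

Lemma flat_cvg0 k : flat k @ (0 : R) --> (0 : R).
Proof.
apply/(@cvgrPdist_le _ _ _ (nbhs (0 : R)) (nbhs_filter _)) => e e0.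
pose C : R := k.+1%:R ^+ k.+1; have C0 : 0 < C by rewrite exprn_gt0// ltr0n.
apply/nbhs_ballP; exists (e / C); first by rewrite /= divr_gt0.
move=> s; rewrite -ball_normE /= !sub0r !normrN ltr_pdivlMr// => se.
rewrite ger0_norm ?flat_ge0//; have [s0|s0] := leP 0 s; last by rewrite flat_le0 ltW.
by rewrite (le_trans (flat_bound k s0))// mulrC ltW// -(ger0_norm s0).
Qed.

Lemma derive_flat k s : is_derive s (1 : R) (flat k) (flat k.+2 s - k%:R * flat k.+1 s).
Proof.
have [s0|s0|s0] := ltgtP 0 s.
- have d1 : is_derive s (1 : R) (fun t : R => t^-1) (- s ^- 2).
    apply: DeriveDef; first by apply: derivableV; [exact: lt0r_neq0|exact: derivable_id].
    rewrite (@deriveV _ _ id); [|exact: lt0r_neq0|exact: derivable_id].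
    by rewrite derive_id [_ *: _]mulr1.
  elim: k => [|k IH].
    have near1 : \forall t \near s, expR (- t^-1) = flat 0 t.
      by near=> t; rewrite /flat ifT ?expr0 ?mul1r//; near: t; exact: lt_nbhsr.
    have d4 : is_derive s (1 : R) (fun t : R => - t^-1) (s ^- 2).
      by rewrite -[s ^- 2]opprK; exact: is_deriveN.
    have [d5 v5] := @is_derive1_comp R expR (fun t : R => - t^-1) s _ _ (is_derive_expR _) d4.
    apply: DeriveDef; first exact: near_eq_derivable near1 d5.
    rewrite -(near_eq_derive _ near1) [LHS]v5 mul0r subr0 /flat s0 mulrC.
    by rewrite exprVn.
  have near1 : \forall t \near s, t^-1 * flat k t = flat k.+1 t.
    by near=> t; rewrite flatS.
  have [d4 v4] := is_deriveM d1 IH.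
  apply: DeriveDef; first exact: near_eq_derivable near1 d4.
  rewrite -(near_eq_derive _ near1) [LHS]v4 !flatS /GRing.scale /= -natr1.
  by rewrite -exprVn; ring.
- have near1 : \forall t \near s, 0 = flat k t.
    by near=> t; rewrite flat_le0// ltW//; near: t; exact: lt_nbhsl.
  apply: DeriveDef; first exact: near_eq_derivable near1 (derivable_cst _ _ _).
  by rewrite -(near_eq_derive _ near1) !flat_le0 ?ltW// derive_cst mulr0 subr0.
- rewrite -s0 !flat_le0// mulr0 subr0.
  have C : (fun h : R => h^-1 *: ((flat k \o shift 0) (h *: (1 : R)) - flat k 0)) @ 0^' --> (0 : R).
    rewrite (_ : (fun h => _) = flat k.+1).
      by apply: cvg_trans (flat_cvg0 k.+1); apply: cvg_app; exact: cvg_within.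
    by apply/funext => h; rewrite /= [_ *: 1]mulr1 addr0 (flat_le0 k (lexx 0)) subr0 flatS.
  apply: DeriveDef; first by apply/cvg_ex; exists 0.
  exact: cvg_lim.
Unshelve. all: by end_near. Qed.

Lemma flat_continuous k : continuous (flat k).
Proof.
move=> s; apply: differentiable_continuous; apply/derivable1_diffP.
exact: (@ex_derive _ _ _ _ _ _ _ (derive_flat k s)).
Qed.

Context {n : nat}.
Implicit Types (g : 'rV[R]_n -> R) (x v : 'rV[R]_n).

Lemma derive_flat_comp k g x v : derivable g x v ->
  derivable (fun y => flat k (g y)) x v /\
  'D_v (fun y => flat k (g y)) x = (flat k.+2 (g x) - k%:R * flat k.+1 (g x)) * 'D_v g x.
Proof.
move=> dg; have x0 : x = x + (0 : R) *: v by rewrite scale0r addr0.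
have dl : is_derive (0 : R) (1 : R) (fun s : R => g (x + s *: v)) ('D_v g x).
  rewrite {2}x0 derive_line; apply: derivableP; apply/derivable_line.
  by rewrite -x0.
have := @is_derive1_comp R (flat k) (fun s : R => g (x + s *: v)) 0 _ _
  (derive_flat k _) dl.
rewrite -x0 => -[d1 v1]; split.
  by rewrite x0; apply/derivable_line.
by rewrite {1}x0 derive_line.
Qed.

Lemma smooth_flat_comp k g x : smooth_at g x -> smooth_at (fun y => flat k (g y)) x.
Proof.
move=> sg; apply/smooth_at_ck => m; elim: m k => [|m IH] k.
all: have gx := sg [::].
all: split; first by move: gx; apply: filterS => y [gc gd]; split=> [|v];
  [exact: (continuous_comp gc (@flat_continuous k _))|exact: (derive_flat_comp k (gd v)).1].
  exact: I.
move=> v; apply: (@ck_near _ _ _ (fun y => (flat k.+2 (g y) + - k%:R * flat k.+1 (g y)) * 'D_v g y)).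
  by move: gx; apply: filterS => y [gc gd]; rewrite (derive_flat_comp k (gd v)).2 mulNr.
apply: ckM; last by move/smooth_at_ck: (smooth_at_derive v sg).
by apply: ckD; [exact: IH|apply: ckM; [exact: ck_cst|exact: IH]].
Qed.

End flat.

Section euclidean_bump.
Context {R : realType} {n : nat}.
Variables (a : 'rV[R]_n) (r : R).

(** The inner [flat] is at least [c] for |s| <= r/2 and is 0 for |s| >= r. Subtracted from [c] and
    passed through [flat] again, it gives 0 in the first case and [flat 0 c] in the second. The
    nesting avoids a quotient of functions: sums, products and [smooth_flat_comp] give
    smoothness. *)
Definition cutoff (s : R) : R :=
  let c := flat 0 (r ^+ 2 - (r / 2) ^+ 2) in
  1 + - (flat 0 c)^-1 * flat 0 (c + -1 * flat 0 (r ^+ 2 + -1 * (s * s))).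

Definition bump_fun (x : 'rV[R]_n) : R := \prod_i cutoff (x 0 i + - a 0 i).

Lemma smooth_bump_fun : smooth_all bump_fun.
Proof.
move=> x; rewrite /bump_fun; elim: (index_enum _) => [|i l IH].
  by apply: smooth_at_near (smooth_at_cst 1 x); near=> y; rewrite big_nil.
apply: (@smooth_at_near _ _ (fun y => cutoff (y 0 i + - a 0 i) *
   \prod_(j <- l) cutoff (y 0 j + - a 0 j))).
  by near=> y; rewrite big_cons.
apply: smooth_atM IH; apply: smooth_atD; first exact: smooth_at_cst.
apply: smooth_atM; first exact: smooth_at_cst.
apply: smooth_flat_comp; apply: smooth_atD; first exact: smooth_at_cst.
apply: smooth_atM; first exact: smooth_at_cst.
apply: smooth_flat_comp; apply: smooth_atD; first exact: smooth_at_cst.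
apply: smooth_atM; first exact: smooth_at_cst.
by apply: smooth_atM; apply: smooth_atD; do ?[exact: smooth_at_coord|exact: smooth_at_cst].
Unshelve. all: by end_near. Qed.

Lemma bump_fun1 x : 0 < r -> `|x - a| <= r / 2 -> bump_fun x = 1.
Proof.
move=> r0 xa; rewrite /bump_fun big1// => i _; rewrite /cutoff.
rewrite [X in _ * X]flat_le0 ?mulr0 ?addr0//.
rewrite mulN1r subr_le0; apply: flat0_le; rewrite mulN1r lerD2l lerN2.
have le1 : `|x 0 i - a 0 i| <= r / 2.
  by apply: le_trans xa; have := row_coord_le (x - a) i; rewrite !mxE.
by rewrite -expr2 -(real_normK (num_real _)) lerXn2r ?nnegrE// divr_ge0// ltW.
Qed.

Lemma bump_fun0 x : 0 < r -> r <= `|x - a| -> bump_fun x = 0.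
Proof.
move=> r0 xa; have [i ri] : exists i, r <= `|x 0 i - a 0 i|.
  apply: contrapT => /forallNP H.
  have : `|x - a| < r.
    have [->|] := eqVneq (x - a) 0; first by rewrite normr0.
    rewrite -normr_eq0 => /mx_norm_neq0 [[i0 i] /= E].
    rewrite [ltLHS]E (ord1 i0); have := H i; move/negP; rewrite -ltNge.
    by rewrite !mxE.
  by rewrite ltNge xa.
rewrite /bump_fun (bigD1 i)//= /cutoff.
have rr : 0 < r ^+ 2 - (r / 2) ^+ 2.
  by rewrite subr_gt0 ltrXn2r// ?nnegrE ?divr_ge0 ?ltW// ltr_pdivrMr// ltr_pMr// ltr1n.
rewrite [X in _ + -1 * X]flat_le0.
  by rewrite mulr0 addr0 mulNr mulVf ?subrr ?mul0r// gt_eqF// !flat_gt0.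
rewrite mulN1r subr_le0 -expr2 -(real_normK (num_real (_ + _))).
by rewrite lerXn2r ?nnegrE// ltW.
Qed.

End euclidean_bump.

(** * Smooth functions and derivations on manifolds *)

(** The axioms on charts, which are what the total space of E is shown to satisfy. Whatever rests on
    Hausdorffness or a countable base is done on M and pulled back. *)
Record premanifold (R : realType) (T : Type) (n : nat) (A : atlas R T n) : Prop :=
  PreManifold {
  pm_cover : forall p, exists2 c, A c & cdom c p;
  pm_chart : forall c, A c -> forall p, cdom c p -> cinv c (cmap c p) = p;
  pm_open : forall c, A c -> atlas_open A (cdom c);
  pm_compat : forall c, A c -> forall i,
    smooth_on A (cdom c) (fun p => cmap c p 0 i) }.

Lemma manifold_premanifold (R : realType) (T : Type) (n : nat) (A : atlas R T n) :
  is_manifold A -> premanifold A.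
Proof. by case=> *; split. Qed.

Section premanifold_theory.
Context {R : realType} {T : Type} {n : nat} {A : atlas R T n}.
Hypothesis pmA : premanifold A.
Local Notation V := 'rV[R]_n.
Implicit Types (f g : T -> R) (p q : T) (c : chart R T n) (W U : set T).

Definition smooth_pt f p := forall c, A c -> cdom c p ->
  smooth_at (f \o cinv c) (cmap c p).

Lemma smoothP f : smooth A f <-> forall p, smooth_pt f p.
Proof.
split=> [sf p c Ac cp|sf c Ac p _ cp]; first exact: sf.
exact: sf.
Qed.

Lemma smoothW f p : smooth A f -> smooth_pt f p.
Proof. by move=> sf; apply: (smoothP f).1. Qed.

Lemma nbhs_chart c W p : A c -> atlas_open A W -> W p -> cdom c p ->
  \forall y \near cmap c p, exists q, [/\ W q, cdom c q, cmap c q = y & cinv c y = q].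
Proof.
move=> Ac oW Wp cp.
have nb : nbhs (cmap c p) (cmap c @` (W `&` cdom c)).
  by apply: open_nbhs_nbhs; split; [exact: oW|exists p].
apply: filterS nb => y [q [Wq cq] <-].
by exists q; split=> //; exact: (pm_chart pmA Ac).
Qed.

Lemma smooth_pt_local W f g p : atlas_open A W -> W p ->
  (forall q, W q -> f q = g q) -> smooth_pt f p -> smooth_pt g p.
Proof.
move=> oW Wp fg sf c Ac cp; apply: smooth_at_near (sf c Ac cp).
by apply: filterS (nbhs_chart Ac oW Wp cp) => y [q [Wq cq _ yq]] /=; rewrite yq fg.
Qed.

(** Any other chart is reached by a smooth transition map, so one chart decides. *)
Lemma smooth_pt_chart f p c : A c -> cdom c p ->
  smooth_at (f \o cinv c) (cmap c p) -> smooth_pt f p.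
Proof.
move=> Ac cp sf c' Ac' cp'.
pose g (i : 'I_n) (y : V) := cmap c (cinv c' y) 0 i.
have gE y : row_fun g y = cmap c (cinv c' y) by apply/rowP => i; rewrite mxE.
have pE : row_fun g (cmap c' p) = cmap c p by rewrite gE (pm_chart pmA Ac').
apply: (@smooth_at_near _ _ (fun y => (f \o cinv c) (row_fun g y))).
  apply: filterS (nbhs_chart Ac' (pm_open pmA Ac) cp cp') => y [q [cq _ _ yq]] /=.
  by rewrite gE yq (pm_chart pmA Ac).
apply: smooth_at_comp; first by rewrite pE.
by move=> i; exact: (pm_compat pmA Ac i Ac' cp cp').
Qed.

Lemma smooth_pt_cmap c p i : A c -> cdom c p -> smooth_pt (fun q => cmap c q 0 i) p.
Proof. by move=> Ac cp c' Ac' cp'; exact: (pm_compat pmA Ac i Ac' cp cp'). Qed.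

Lemma smooth_pt_comp c p (phi : V -> R) : A c -> cdom c p ->
  smooth_at phi (cmap c p) -> smooth_pt (fun q => phi (cmap c q)) p.
Proof.
move=> Ac cp sphi; apply: (smooth_pt_chart Ac cp).
apply: smooth_at_near sphi.
apply: filterS (nbhs_chart Ac (pm_open pmA Ac) cp cp) => y [q [cq _ qy yq]] /=.
by rewrite yq qy.
Qed.

Lemma smooth_ptD f g p : smooth_pt f p -> smooth_pt g p -> smooth_pt (fun q => f q + g q) p.
Proof. by move=> sf sg c Ac cp; exact: (smooth_atD (sf c Ac cp) (sg c Ac cp)). Qed.

Lemma smooth_ptM f g p : smooth_pt f p -> smooth_pt g p -> smooth_pt (fun q => f q * g q) p.
Proof. by move=> sf sg c Ac cp; exact: (smooth_atM (sf c Ac cp) (sg c Ac cp)). Qed.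

Lemma smooth_pt_cst a p : smooth_pt (fun=> a) p.
Proof. by move=> c Ac cp; exact: smooth_at_cst. Qed.

Lemma smooth_pt_sum I (r : seq I) (F : I -> T -> R) p :
  (forall i, smooth_pt (F i) p) -> smooth_pt (fun q => \sum_(i <- r) F i q) p.
Proof.
move=> sF; elim: r => [|i r IH].
  by rewrite (_ : (fun _ => _) = fun=> 0); [exact: smooth_pt_cst|apply/funext => q; rewrite big_nil].
rewrite (_ : (fun _ => _) = fun q => F i q + \sum_(j <- r) F j q); last first.
  by apply/funext => q; rewrite big_cons.
by apply: smooth_ptD; [exact: sF|exact: IH].
Qed.

Lemma smooth_sum I (r : seq I) (F : I -> T -> R) :
  (forall i, smooth A (F i)) -> smooth A (fun q => \sum_(i <- r) F i q).
Proof. by move=> sF; apply/smoothP => p; apply: smooth_pt_sum => i; apply: smoothW. Qed.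

Lemma atlas_openI W U : atlas_open A W -> atlas_open A U -> atlas_open A (W `&` U).
Proof.
move=> oW oU c Ac.
rewrite (_ : _ @` _ = (cmap c @` (W `&` cdom c)) `&` (cmap c @` (U `&` cdom c))).
  by apply: openI; [exact: oW|exact: oU].
apply/seteqP; split=> [_ [q [[Wq Uq] cq] <-]|y [[q [Wq cq] <-] [q' [Uq' cq'] E]]].
  by split; exists q.
have qq : q = q' by rewrite -(pm_chart pmA Ac cq) -E (pm_chart pmA Ac).
by exists q => //; split=> //; split=> //; rewrite qq.
Qed.

Lemma atlas_openT : atlas_open A setT.
Proof. by move=> c Ac; rewrite setTI; have := pm_open pmA Ac Ac; rewrite setIid. Qed.

Lemma atlas_open_bigcup I (D : set I) (F : I -> set T) :
  (forall i, D i -> atlas_open A (F i)) -> atlas_open A (\bigcup_(i in D) F i).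
Proof.
move=> oF c Ac.
rewrite (_ : _ @` _ = \bigcup_(i in D) (cmap c @` (F i `&` cdom c))).
  by apply: bigcup_open => i Di; exact: oF.
apply/seteqP; split=> [_ [q [[i Di Fq] cq] <-]|y [i Di [q [Fq cq] <-]]].
  by exists i => //; exists q.
by exists q => //; split=> //; exists i.
Qed.

Lemma atlas_open_chart c (O : set V) : A c -> open O ->
  atlas_open A [set q | cdom c q /\ O (cmap c q)].
Proof.
move=> Ac oO c' Ac'; rewrite openE => y [q [[cq Oq] cq'] <-].
have ct : {for cmap c' q, continuous (row_fun (fun i y => cmap c (cinv c' y) 0 i))}.
  apply: row_fun_continuous => i; apply: smooth_at_continuous.
  exact: (pm_compat pmA Ac i Ac' cq cq').
have E z : row_fun (fun i y => cmap c (cinv c' y) 0 i) z = cmap c (cinv c' z).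
  by apply/rowP => i; rewrite mxE.
have nO : nbhs (row_fun (fun i y => cmap c (cinv c' y) 0 i) (cmap c' q)) O.
  by rewrite E (pm_chart pmA Ac')//; apply: open_nbhs_nbhs.
have n1 := ct _ nO; have n2 := nbhs_chart Ac' (pm_open pmA Ac) cq cq'.
rewrite /interior /=; apply: (@filterS2 _ (nbhs (cmap c' q)) (nbhs_filter _) _ _ _ _ n1 n2) => z; rewrite /= E => Oz [q' [cq1 cq2 zq qz]].
by exists q' => //; split=> //; split=> //; rewrite -qz.
Qed.

(** The closed support of [chi] lies in [W], phrased without closures: an open set on which [chi]
    vanishes covers everything together with [W]. A product with [chi] is then smooth as soon as the
    other factor is smooth on [W]. *)
Definition supported W (chi : T -> R) := smooth A chi /\ exists U,
  [/\ atlas_open A U, forall q, U q -> chi q = 0 & forall q, W q \/ U q].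

Lemma supported_ptM W chi g p : supported W chi ->
  (W p -> smooth_pt g p) -> smooth_pt (fun q => chi q * g q) p.
Proof.
move=> [schi [U [oU U0 WU]]] sg.
have [Wp|Up] := WU p.
  by apply: smooth_ptM; [exact: smoothW|exact: sg].
apply: (smooth_pt_local (f := fun=> 0) oU Up); last exact: smooth_pt_cst.
by move=> q Uq; rewrite U0// mul0r.
Qed.

Lemma supportedM W chi g : supported W chi ->
  (forall p, W p -> smooth_pt g p) -> smooth A (fun q => chi q * g q).
Proof.
move=> sup sg; apply/smoothP => p; apply: (supported_ptM sup); exact: sg.
Qed.

Lemma supportedS W W' chi : W `<=` W' -> supported W chi -> supported W' chi.
Proof.
move=> WW [schi [U [oU U0 WU]]]; split=> //; exists U; split=> // q.
by have [/WW|] := WU q; [left|right].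
Qed.

Lemma supported0 W chi q : supported W chi -> ~ W q -> chi q = 0.
Proof. by move=> [_ [U [_ U0 WU]]] nW; have [|/U0] := WU q. Qed.

(** The product of [psi] with f - g is identically 0, while the Leibniz rule gives it the derivative
    u(f - g), since at p the first factor is 1 and the second is 0. *)
Lemma tangent_local U p (u : tangent A p) f g (psi : T -> R) :
  smooth A psi -> psi p = 1 -> (forall q, ~ U q -> psi q = 0) ->
  smooth A f -> smooth A g -> (forall q, U q -> f q = g q) -> u f = u g.
Proof.
move=> spsi psi1 psi0 sf sg fg.
have Up : U p by apply: contrapT => /psi0; rewrite psi1 => /eqP; rewrite oner_eq0.
have /asboolP[_ uD uM] := tangent_prop u.
have sN : smooth A (fun x => -1 * g x + f x).
  apply: smooth_onD; last exact: sf.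
  by apply: smooth_onM; [exact: smooth_on_cst|exact: sg].
have u0 : u (fun=> 0) = 0.
  have := uM _ _ (smooth_on_cst (W := setT) 0) (smooth_on_cst (W := setT) 0).
  by rewrite !mul0r addr0.
have := uM _ _ spsi sN; rewrite (_ : (fun _ => _) = fun=> 0); last first.
  apply/funext => q; have [/fg ->|/psi0 ->] := pselect (U q); last by rewrite mul0r.
  by rewrite mulN1r addNr mulr0.
by rewrite u0 psi1 mul1r fg// mulN1r addNr mul0r addr0 uD// mulN1r addrC => /esym/subr0_eq.
Qed.

(** [gc_ext] lets chi f, read in the chart, be extended by 0 to a smooth function on all of R^n, as
    [hadamard] requires. [gc_bump] gives locality of derivations on [U]. Both are fields because on
    the total space they are pulled back from M. *)
Record good_chart c U (chi : T -> R) : Prop := GoodChart {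
  gc_in : A c;
  gc_sup : supported (cdom c) chi;
  gc_open : atlas_open A U;
  gc_dom : forall p, U p -> cdom c p;
  gc_one : forall p, U p -> chi p = 1;
  gc_ext : exists O : set V, [/\ open O,
     forall p, cdom c p -> O (cmap c p) -> chi p = 0 &
     forall x, O x \/ (cmap c @` cdom c) x];
  gc_bump : forall p, U p -> exists psi : T -> R,
     [/\ smooth A psi, psi p = 1 & forall q, ~ U q -> psi q = 0] }.

Lemma tangent_D p (u : tangent A p) a f g : smooth A f -> smooth A g ->
  u (fun x => a * f x + g x) = a * u f + u g.
Proof. by have /asboolP[_ uD _] := tangent_prop u; exact: uD. Qed.

Lemma tangent_M p (u : tangent A p) f g : smooth A f -> smooth A g ->
  u (fun x => f x * g x) = f p * u g + g p * u f.
Proof. by have /asboolP[_ _ uM] := tangent_prop u; exact: uM. Qed.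

Lemma tangent_cst p (u : tangent A p) a : u (fun=> a) = 0.
Proof.
have s1 : smooth A (fun=> 1) by exact: smooth_on_cst.
have u1 : u (fun=> 1) = 0.
  have := tangent_M u s1 s1; rewrite !mul1r.
  by move/eqP; rewrite -subr_eq subrr => /eqP/esym.
have sa : smooth A (fun=> a) by exact: smooth_on_cst.
have := tangent_D u a s1 (smooth_on_cst (W := setT) 0); rewrite u1 mulr0 add0r.
have -> : u (fun=> 0) = 0.
  have := tangent_M u (smooth_on_cst (W := setT) 0) (smooth_on_cst (W := setT) 0).
  by rewrite !mul0r addr0.
by rewrite mulr1 addr0.
Qed.

Lemma tangent_sum_fun p (u : tangent A p) I (r : seq I) (F : I -> T -> R) :
  (forall i, smooth A (F i)) ->
  u (fun q => \sum_(i <- r) F i q) = \sum_(i <- r) u (F i).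
Proof.
move=> sF; elim: r => [|i r IH].
  rewrite big_nil (_ : (fun _ => _) = fun=> 0) ?tangent_cst//.
  by apply/funext => q; rewrite big_nil.
rewrite big_cons -IH -[u (F i)]mul1r -tangent_D//; last exact: smooth_sum.
by congr (tangent_val u _); apply/funext => q; rewrite big_cons mul1r.
Qed.

Section expansion.
Variables (c : chart R T n) (U : set T) (chi : T -> R).
Hypothesis gc : good_chart c U chi.

Definition chart_fun i q := chi q * cmap c q 0 i.

Lemma smooth_chart_fun i : smooth A (chart_fun i).
Proof.
apply: (supportedM (gc_sup gc)) => p cp.
exact: (smooth_pt_cmap i (gc_in gc) cp).
Qed.

Definition chart_rep f (x : V) : R :=
  if `[< (cmap c @` cdom c) x >] then chi (cinv c x) * f (cinv c x) else 0.

Lemma chart_repE f p : cdom c p -> chart_rep f (cmap c p) = chi p * f p.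
Proof.
move=> cp; rewrite /chart_rep asboolT; last by exists p.
by rewrite (pm_chart pmA (gc_in gc)).
Qed.

Lemma smooth_chart_rep f : smooth A f -> smooth_all (chart_rep f).
Proof.
move=> /smoothP sf x; have Ac := gc_in gc.
have [Z [oZ Z0 Zc]] := gc_ext gc.
have [Zx|[p cp <-]] := Zc x.
  apply: (@smooth_at_near _ _ (fun=> 0)); last exact: smooth_at_cst.
  apply: filterS (open_nbhs_nbhs (conj oZ Zx)) => y Zy; rewrite /chart_rep.
  by case: asboolP => // -[p cp yp]; rewrite -yp (pm_chart pmA Ac)// (Z0 p) ?mul0r// yp.
have [/smoothP schi _] := gc_sup gc.
have := smooth_ptM (schi p) (sf p) => /(_ c Ac cp); apply: smooth_at_near.
apply: filterS (nbhs_chart Ac (pm_open pmA Ac) cp cp) => y [q [cq _ qy yq]] /=.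
by rewrite -qy chart_repE// (pm_chart pmA Ac).
Qed.

Lemma chart_extend (phi : V -> R) : smooth_all phi ->
  smooth A (fun q => chi q * phi (cmap c q)).
Proof.
move=> sphi; apply: (supportedM (gc_sup gc)) => p cp.
exact: (smooth_pt_comp (gc_in gc) cp).
Qed.

Lemma tangent_eq_on f g p (u : tangent A p) : U p -> smooth A f -> smooth A g ->
  (forall q, U q -> f q = g q) -> u f = u g.
Proof.
move=> Up sf sg fg; have [psi [spsi psi1 psi0]] := gc_bump gc Up.
exact: (tangent_local _ spsi psi1 psi0).
Qed.

(** Hadamard's formula in the chart, multiplied back by [chi], is a global function equal to f on
    [U]. In each product [G i] the first factor vanishes at p, so the Leibniz rule keeps only the
    term that differentiates it. *)
Lemma tangent_expansion f p (u : tangent A p) : smooth A f -> U p ->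
  u f = \sum_i 'D_(delta_mx 0 i) (chart_rep f) (cmap c p) * u (chart_fun i).
Proof.
move=> sf Up; have cp := gc_dom gc Up; have sphi := smooth_chart_rep sf.
have [g [sg gE]] := hadamard (cmap c p) sphi.
set a := cmap c p in gE *.
have gD i : 'D_(delta_mx 0 i) (chart_rep f) a = g i a.
  rewrite (_ : chart_rep f = fun x => chart_rep f a + \sum_j (x 0 j + - a 0 j) * g j x); last first.
    by apply/funext => x; rewrite gE.
  have st j x : smooth_at (fun x : V => x 0 j + - a 0 j) x.
    by apply: smooth_atD; [exact: smooth_at_coord|exact: smooth_at_cst].
  have sterm j x : smooth_at (fun x : V => (x 0 j + - a 0 j) * g j x) x.
    by apply: smooth_atM; [exact: st|exact: sg].
  have ssum (r : seq 'I_n) : derivable (fun x : V => \sum_(j <- r) (x 0 j + - a 0 j) * g j x) a (delta_mx 0 i).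
    by apply: smooth_at_derivable; apply: smooth_at_sum => j; exact: sterm.
  rewrite deriveD; [|exact: derivable_cst|exact: ssum].
  rewrite derive_cst add0r.
  have DS (r : seq 'I_n) : 'D_(delta_mx 0 i) (fun x : V => \sum_(j <- r) (x 0 j + - a 0 j) * g j x) a =
     \sum_(j <- r) (i == j)%:R * g j a.
    elim: r => [|j r IH].
      rewrite (_ : (fun _ => _) = fun=> 0); first by rewrite derive_cst big_nil.
      by apply/funext => x; rewrite big_nil.
    rewrite (_ : (fun _ => _) = fun x : V => (x 0 j + - a 0 j) * g j x + \sum_(l <- r) (x 0 l + - a 0 l) * g l x); last first.
      by apply/funext => x; rewrite big_cons.
    rewrite deriveD; [|by apply: smooth_at_derivable; exact: sterm|exact: ssum].
    rewrite IH big_cons; congr (_ + _).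
    rewrite deriveM; [|by apply: smooth_at_derivable; exact: st|by apply: smooth_at_derivable; exact: sg].
    rewrite subrr scale0r add0r deriveD; [|exact: derivable_coord|exact: derivable_cst].
    by rewrite derive_coord derive_cst addr0 mxE eqxx eq_sym /GRing.scale /= mulrC.
  rewrite DS (bigD1 i)//= eqxx mul1r big1 ?addr0// => j ji.
  by rewrite eq_sym (negbTE ji) mul0r.
under eq_bigr do rewrite gD.
pose G i q := (chart_fun i q + - a 0 i * chi q) * (chi q * g i (cmap c q)).
have schi : smooth A chi by case: (gc_sup gc).
have s1 i : smooth A (fun q => chart_fun i q + - a 0 i * chi q).
  apply: smooth_onD; first exact: smooth_chart_fun.
  by apply: smooth_onM; [exact: smooth_on_cst|exact: schi].
have s2 i : smooth A (fun q => chi q * g i (cmap c q)) by exact: (chart_extend (sg i)).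
have sG i : smooth A (G i) by exact: (smooth_onM (s1 i) (s2 i)).
have chi1 := gc_one gc.
have E : u f = u (fun q => 1 * (fun=> f p) q + \sum_i G i q).
  apply: (@tangent_eq_on f _ p u Up sf).
    apply: smooth_onD; last exact: (smooth_sum _ sG).
    by apply: smooth_onM; exact: smooth_on_cst.
  move=> q Uq; have cq := gc_dom gc Uq.
  have -> : f q = chart_rep f (cmap c q) by rewrite chart_repE// chi1// mul1r.
  rewrite gE {1}/a chart_repE// chi1// !mul1r; congr (_ + _); apply: eq_bigr => i _.
  by rewrite /G /chart_fun chi1// !mul1r mulr1.
rewrite E tangent_D; [|exact: smooth_on_cst|exact: (smooth_sum _ sG)].
rewrite tangent_cst mulr0 add0r (tangent_sum_fun _ _ sG); apply: eq_bigr => i _.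
have uchi : u chi = 0.
  by rewrite -(tangent_cst u 1); apply: (@tangent_eq_on chi (fun=> 1) p u Up schi); [exact: smooth_on_cst|exact: chi1].
rewrite [LHS](tangent_M u (s1 i) (s2 i)) chi1// mul1r /chart_fun chi1// mul1r mulr1 -/a subrr mul0r add0r.
congr (_ * _).
rewrite (_ : (fun q => _) = fun q => - a 0 i * chi q + chart_fun i q); last first.
  by apply/funext => q; rewrite addrC.
by rewrite (tangent_D u _ schi (smooth_chart_fun i)) uchi mulr0 add0r.
Qed.

Lemma chart_expansion f : smooth A f -> exists g : 'I_n -> T -> R,
  (forall i, smooth A (g i)) /\
  forall p (u : tangent A p), U p -> u f = \sum_i g i p * u (chart_fun i).
Proof.
move=> sf; exists (fun i q => chi q * 'D_(delta_mx 0 i) (chart_rep f) (cmap c q)).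
split=> [i|p u Up].
  by apply: (chart_extend (phi := fun x => 'D_(delta_mx 0 i) (chart_rep f) x)); apply: smooth_all_derive; exact: smooth_chart_rep.
by rewrite (tangent_expansion u sf Up); apply: eq_bigr => i _; rewrite (gc_one gc)// mul1r.
Qed.

End expansion.

End premanifold_theory.

Section tangent_vectors.
Context {R : realType} {T : Type} {n : nat} {A : atlas R T n}.
Implicit Types (f g : T -> R) (p q : T).

Lemma tangent_ext p (u v : tangent A p) :
  (forall f, smooth A f -> u f = v f) -> u = v.
Proof.
move=> uv; apply: val_inj; apply/funext => f.
have [sf|nf] := pselect (smooth A f); first exact: uv.
have /asboolP[u0 _ _] := tangent_prop u; have /asboolP[v0 _ _] := tangent_prop v.
by rewrite [LHS]u0// [RHS]v0.
Qed.

(** The witness for the choice in [tangent_of] is [phi] set to 0 on functions that are not smooth,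
    as [tangent] demands. *)
Lemma tangent_ofE p (phi : (T -> R) -> R) f :
  (forall a f g, smooth A f -> smooth A g ->
     phi (fun x => a * f x + g x) = a * phi f + phi g) ->
  (forall f g, smooth A f -> smooth A g ->
     phi (fun x => f x * g x) = f p * phi g + g p * phi f) ->
  smooth A f -> tangent_of A p phi f = phi f.
Proof.
move=> phiD phiM sf; pose w f := if `[< smooth A f >] then phi f else 0.
have wE g : smooth A g -> w g = phi g by move=> sg; rewrite /w asboolT.
have wd : w \in @derivation_pred R T n A p.
  apply/asboolP; split=> [g ng|a f1 f2 s1 s2|f1 f2 s1 s2]; first by rewrite /w asboolF.
    have sD : smooth A (fun x => a * f1 x + f2 x).
      by apply: smooth_onD s2; apply: smooth_onM s1; exact: smooth_on_cst.
    by rewrite (wE _ sD) (wE _ s1) (wE _ s2) phiD.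
  by rewrite (wE _ (smooth_onM s1 s2)) (wE _ s1) (wE _ s2) phiM.
have := @xgetPex _ 0 [set v : tangent A p | forall f, smooth A f -> v f = phi f].
by apply=> //; exists (Tangent wd) => g sg; rewrite /= wE.
Qed.

Lemma tangent_addE p (u v : tangent A p) f : (u + v) f = u f + v f.
Proof. by []. Qed.

Lemma tangent_scaleE p (u : tangent A p) a f : (a *: u) f = a * u f.
Proof. by []. Qed.

Lemma tangent_oppE p (u : tangent A p) f : (- u) f = - u f.
Proof. by []. Qed.

Lemma tangent_zeroE p f : (0 : tangent A p) f = 0.
Proof. by []. Qed.

Lemma tangent_sumE p I (r : seq I) (u : I -> tangent A p) f :
  (\sum_(i <- r) u i) f = \sum_(i <- r) u i f.
Proof. by elim/big_rec2: _ => // i y1 y2 _ <-. Qed.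

End tangent_vectors.

Section chart_frame.
Context {R : realType} {T : Type} {n : nat} {A : atlas R T n}.
Hypothesis pmA : premanifold A.
Variables (c : chart R T n) (U : set T) (chi : T -> R).
Hypothesis gc : good_chart (A := A) c U chi.
Implicit Types (f g : T -> R) (p q : T).

Definition chart_partial (i : 'I_n) p : tangent A p :=
  tangent_of A p (fun f => 'D_(delta_mx 0 i) (f \o cinv c) (cmap c p)).

Lemma chart_partialE i p f : cdom c p -> smooth A f ->
  chart_partial i p f = 'D_(delta_mx 0 i) (f \o cinv c) (cmap c p).
Proof.
move=> cp sf; have Ac := gc_in gc.
have ds f1 : smooth A f1 -> derivable (f1 \o cinv c) (cmap c p) (delta_mx 0 i).
  by move=> s1; apply: smooth_at_derivable; exact: (smoothW s1 Ac cp).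
apply: (tangent_ofE (p := p)) sf => [a f1 f2 s1 s2|f1 f2 s1 s2].
  have d0 : derivable (fun y : 'rV[R]_n => a * (f1 \o cinv c) y) (cmap c p) (delta_mx 0 i).
    by apply: derivableM; [exact: derivable_cst|exact: ds].
  rewrite [LHS](deriveD d0 (ds _ s2)); congr (_ + _).
  rewrite deriveM; [|exact: derivable_cst|exact: ds].
  by rewrite derive_cst scaler0 addr0.
rewrite [LHS](deriveM (ds _ s1) (ds _ s2)) /GRing.scale /=.
by rewrite (pm_chart pmA Ac cp).
Qed.

Definition chart_vec (i : 'I_n) p : tangent A p := chi p *: chart_partial i p.

Lemma chart_vec_smooth i : smooth_section (tangent_bundle A) (chart_vec i).
Proof.
move=> f sf; have Ac := gc_in gc.
apply: (supportedM pmA (g := fun p => chart_partial i p f) (gc_sup gc)) => p cp.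
apply: (smooth_pt_local pmA (f := fun q => 'D_(delta_mx 0 i) (f \o cinv c) (cmap c q)) (pm_open pmA Ac) cp).
  by move=> q cq; rewrite chart_partialE.
apply: (smooth_pt_comp pmA (phi := fun x => 'D_(delta_mx 0 i) (f \o cinv c) x) Ac cp).
by apply: smooth_at_derive; exact: (smoothW sf Ac cp).
Qed.

Lemma chart_vec_expansion p (u : tangent A p) : U p ->
  u = \sum_i u (chart_fun c chi i) *: chart_vec i p.
Proof.
move=> Up; apply: tangent_ext => f sf; have cp := gc_dom gc Up; have Ac := gc_in gc.
rewrite (tangent_expansion pmA gc u sf Up) tangent_sumE; apply: eq_bigr => i _.
rewrite !tangent_scaleE (gc_one gc Up) mul1r chart_partialE// mulrC; congr (_ * _).
apply: near_eq_derive.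
apply: filterS (nbhs_chart pmA Ac (gc_open gc) Up cp) => y [q [Uq cq <- qy]] /=.
by rewrite (chart_repE pmA gc f cq) (gc_one gc Uq) mul1r qy.
Qed.

End chart_frame.

Section manifold_bumps.
Context {R : realType} {T : Type} {n : nat} {A : atlas R T n}.
Hypothesis hM : is_manifold A.
Let pmA := manifold_premanifold hM.
Local Notation V := 'rV[R]_n.
Implicit Types (p q : T) (W U : set T).

Lemma atlas_open_all (I : eqType) (s : seq I) (G : I -> set T) :
  (forall i, i \in s -> atlas_open A (G i)) ->
  atlas_open A [set q | forall i, i \in s -> G i q].
Proof.
elim: s => [|i s IH] H.
  rewrite (_ : [set _ | _] = setT); first exact: (atlas_openT pmA).
  by apply/seteqP; split.
rewrite (_ : [set _ | _] = G i `&` [set q | forall i, i \in s -> G i q]).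
  apply: (atlas_openI pmA); first by apply: H; rewrite mem_head.
  by apply: IH => j js; apply: H; rewrite in_cons js orbT.
apply/seteqP; split=> [q Hq|q [Gi Hq] j].
  by split; [apply: Hq; rewrite mem_head|move=> j js; apply: Hq; rewrite in_cons js orbT].
by rewrite in_cons => /orP[/eqP ->//|]; exact: Hq.
Qed.

(** A closed coordinate ball is compact, so Hausdorffness separates it from any outside point by
    finitely many pairs of disjoint open sets. Hence it is closed in M, and a function supported in
    it extends by 0. *)
Lemma closed_ball_open (c : chart R T n) (a : V) (r : R) : A c ->
  (forall x : V, `|x - a| <= r -> (cmap c @` cdom c) x) ->
  atlas_open A [set q | ~ (cdom c q /\ `|cmap c q - a| <= r)].
Proof.
move=> Ac Bc; set K := [set q | cdom c q /\ `|cmap c q - a| <= r].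
pose B : set V := [set x | `|x - a| <= r].
have cB : compact B.
  apply: bounded_closed_compact.
    exists (`|a| + r); split; first exact: num_real.
    move=> M Mlt x /= xB; apply: le_trans (ltW Mlt).
    by rewrite -[x](subrK a) addrC; apply: le_trans (ler_normD _ _) _; rewrite lerD2l.
  rewrite (_ : B = (fun x : V => `|x - a|) @^-1` [set y : R | y <= r]); last by [].
  apply: closed_comp; last exact: closed_le.
  move=> x _; apply: (@continuous_comp _ _ _ (fun x : V => x - a) (fun x : V => `|x|)).
    by apply: continuousB; [exact: cvg_id|exact: cst_continuous].
  exact: norm_continuous.
rewrite (_ : [set q | _] = \bigcup_(q in ~` K) \bigcup_(W in [set W | atlas_open A W /\ W q /\ W `<=` ~` K]) W); last first.
  apply/seteqP; split=> [q nK|q [q' _ [W [_ [_ WK]] Wq]]]; last exact: WK.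
  exists q => //.
  have H (x : V) : exists UV : set T * set T, B x ->
      [/\ atlas_open A UV.1, atlas_open A UV.2, UV.1 (cinv c x), UV.2 q & UV.1 `&` UV.2 = set0].
    have [Bx|nB] := pselect (B x); last by exists (set0, set0).
    have xq : cinv c x <> q.
      have [p cp pE] := Bc x Bx; rewrite -pE (pm_chart pmA Ac cp) => pq.
      by apply: nK; rewrite -pq; split=> //; rewrite pE.
    by have [U1 [V1 H1]] := mf_hausdorff hM xq; exists (U1, V1).
  have [UV HUV] := choice H.
  rewrite compact_cover in cB.
  have := cB V B (fun x => cmap c @` ((UV x).1 `&` cdom c)).
  case=> [x Bx|x Bx|D' D'B D'c].
  - by have [oU1 _ _ _ _] := HUV x Bx; exact: oU1.
  - exists x => //; have [p cp pE] := Bc x Bx; exists p => //; split=> //.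
    by have [_ _ Ux _ _] := HUV x Bx; move: Ux; rewrite -pE (pm_chart pmA Ac cp).
  exists [set q' | forall x, x \in enum_fset D' -> (UV x).2 q'].
    split; first by apply: atlas_open_all => x /D'B/set_mem Bx; have [] := HUV x Bx.
    split; first by move=> x /D'B/set_mem Bx; have [] := HUV x Bx.
    move=> q' Hq' [cq' Bq'].
    have [x /= xD [p [Up cp] pE]] := D'c _ Bq'.
    have pq : p = q' by rewrite -(pm_chart pmA Ac cp) pE (pm_chart pmA Ac).
    have Bx : B x by move/D'B/set_mem: xD.
    have [_ _ _ _ E] := HUV x Bx.
    have : ((UV x).1 `&` (UV x).2) q' by split; [rewrite -pq|exact: Hq'].
    by rewrite E.
  by move=> x /D'B/set_mem Bx; have [] := HUV x Bx.
apply: atlas_open_bigcup => q _; apply: atlas_open_bigcup => W [oW _].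
exact: oW.
Qed.

Lemma bump_chart W p : atlas_open A W -> W p -> exists c, exists2 chi : T -> R,
  supported (A := A) (W `&` cdom c) chi & exists U,
  [/\ A c, atlas_open A U, U p, (forall q, U q -> cdom c q /\ chi q = 1) &
     exists Z : set V, [/\ open Z, forall q, cdom c q -> Z (cmap c q) -> chi q = 0 &
     forall x, Z x \/ (cmap c @` (W `&` cdom c)) x]].
Proof.
move=> oW Wp; have [c Ac cp] := pm_cover pmA p; exists c.
set a := cmap c p.
have nW : nbhs a (cmap c @` (W `&` cdom c)).
  by apply: open_nbhs_nbhs; split; [exact: oW|exists p].
have [d d0 dW] := (nbhs_ballP _ _).1 nW.
(* The bump is supported in the ball of radius [r] and is 1 on that of radius [r / 2]; [r < d] keeps
   the closed ball inside the image of [W]. *)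
pose r := d / 2; have r0 : 0 < r by rewrite divr_gt0.
have rd : r < d by rewrite ltr_pdivrMr// ltr_pMr// ltr1n.
have BW (x : V) : `|x - a| <= r -> (cmap c @` (W `&` cdom c)) x.
  move=> xr; apply: dW; rewrite -ball_normE /= distrC; exact: le_lt_trans rd.
have BC (x : V) : `|x - a| <= r -> (cmap c @` cdom c) x.
  by move=> /BW [q [_ cq] <-]; exists q.
have oK := closed_ball_open Ac BC.
set N := [set q | _] in oK.
pose chi q := if `[< cdom c q >] then bump_fun a r (cmap c q) else 0.
have chi0 q : N q -> chi q = 0.
  move=> Nq; rewrite /chi; case: asboolP => // cq; apply: bump_fun0 => //.
  by rewrite leNgt; apply/negP => /ltW lt; apply: Nq.
have schi : smooth A chi.
  apply/smoothP => q; have [Nq|] := pselect (N q).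
    apply: (smooth_pt_local pmA (f := fun=> 0) oK Nq); last exact: smooth_pt_cst.
    by move=> q' /chi0.
  move=> /contrapT [cq _].
  apply: (smooth_pt_local pmA (f := fun q => bump_fun a r (cmap c q)) (pm_open pmA Ac) cq).
    by move=> q' cq'; rewrite /chi asboolT.
  by apply: (smooth_pt_comp pmA Ac cq); exact: smooth_bump_fun.
exists chi.
  split=> //; exists N; split=> // q; have [Nq|/contrapT [cq qr]] := pselect (N q); first by right.
  have [q' [Wq' cq'] E] := BW _ qr; left.
  by rewrite -(pm_chart pmA Ac cq) -E (pm_chart pmA Ac cq').
exists [set q | cdom c q /\ ball a (r / 2) (cmap c q)]; split=> //.
- by apply: (atlas_open_chart pmA Ac); exact: ball_open.
- by split=> //; apply: ballxx; rewrite divr_gt0.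
- move=> q [cq]; rewrite -ball_normE /= distrC => qr; split=> //.
  by rewrite /chi asboolT// bump_fun1// ltW.
exists [set x : V | r < `|x - a|]; split.
- rewrite (_ : [set _ | _] = (fun x : V => `|x - a|) @^-1` [set y : R | r < y]); last by [].
  apply: open_comp; last exact: open_gt.
  move=> x _; apply: (@continuous_comp _ _ _ (fun x : V => x - a) (fun x : V => `|x|)).
    by apply: continuousB; [exact: cvg_id|exact: cst_continuous].
  exact: norm_continuous.
- by move=> q cq /= rq; apply: chi0 => -[_]; rewrite leNgt rq.
- by move=> x; have [/BW|] := leP `|x - a| r; [right|left].
Qed.

Lemma bump_exists W p : atlas_open A W -> W p ->
  exists c chi U, [/\ good_chart (A := A) c U chi, U p, supported (A := A) (W `&` cdom c) chi &
    exists Z : set V, [/\ open Z, forall q, cdom c q -> Z (cmap c q) -> chi q = 0 &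
     forall x, Z x \/ (cmap c @` (W `&` cdom c)) x]].
Proof.
move=> oW Wp; have [c [chi sup [U [Ac oU Up U1 [Z [oZ Z0 Zc]]]]]] := bump_chart oW Wp.
exists c, chi, U; split=> //; last by exists Z.
split=> //.
- by apply: supportedS sup => q [].
- by move=> q /U1[].
- by move=> q /U1[].
- by exists Z; split=> // x; have [|[q [_ cq] <-]] := Zc x; [left|right; exists q].
move=> q Uq; have [c' [psi sup' [U' [_ _ Uq' U1' _]]]] := bump_chart oU Uq.
exists psi; split; first by case: sup'.
  by have [] := U1' q Uq'.
by move=> q' nU; apply: (supported0 sup') => -[].
Qed.

(** To the i-th set of a countable base is attached some [N x] containing it; [None] is for indices
    where no such set exists. *)
Lemma lindelof (X : Type) (N : X -> set T) :
  (forall x, atlas_open A (N x)) -> (forall p, exists x, N x p) ->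
  exists s : nat -> option X, forall p, exists i x, s i = Some x /\ N x p.
Proof.
move=> oN cN; have [B [cB Bo Bb]] := mf_second_countable hM.
have [f finj] : exists f : set T -> nat, {in B &, injective f}.
  by move/pcard_injP : cB => [f]; exists f.
pose P i (x : option X) := forall U, B U -> f U = i -> (exists y, U `<=` N y) ->
  exists2 y, x = Some y & U `<=` N y.
have H i : exists x, P i x.
  have [[U [BU fU [y Uy]]]|nU] := pselect (exists U, [/\ B U, f U = i & exists y, U `<=` N y]).
    exists (Some y) => U' BU' fU' _; exists y => //.
    have -> : U' = U by apply: finj; rewrite ?fU' ?fU//; exact: mem_set.
    exact: Uy.
  by exists None => U BU fU Uy; case: nU; exists U.
have [s sP] := choice H; exists s => p.
have [x Np] := cN p; have [U BU [Up UN]] := Bb _ _ (oN x) Np.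
have [y sy Uy] := sP (f U) U BU erefl (ex_intro _ x UN).
by exists (f U), y; split=> //; exact: Uy.
Qed.

End manifold_bumps.

(** * Local frames of a vector bundle and of its total space *)

Lemma dual_ofE (R : realType) (V : lmodType R) (phi : V -> R) v :
  (forall c u w, phi (c *: u + w) = c * phi u + phi w) -> dual_of phi v = phi v.
Proof.
move=> phiL; have phid : phi \in @functional_pred R V by apply/asboolP.
have := @xgetPex _ 0 [set a : dual V | forall v, a v = phi v].
by apply; exists (Dual phid).
Qed.

Lemma smooth_at_ext (R : realType) (n : nat) (f g : 'rV[R]_n -> R) x :
  (forall y, f y = g y) -> smooth_at f x -> smooth_at g x.
Proof. by move=> fg; have -> : f = g by apply/funext. Qed.

Section dual_theory.
Context {R : realType} {V : lmodType R}.
Implicit Types (a b : dual V) (v w : V).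

Lemma dual_ext a b : (forall v, a v = b v) -> a = b.
Proof. by move=> ab; apply: val_inj; apply/funext. Qed.

Lemma dual_lin a c u w : a (c *: u + w) = c * a u + a w.
Proof. by have /asboolP := dual_prop a; apply. Qed.

Lemma dual_0 a : a 0 = 0.
Proof.
have := dual_lin a 1 0 0; rewrite scaler0 addr0 mul1r => /eqP.
by rewrite -subr_eq subrr => /eqP/esym.
Qed.

Lemma dual_D a u w : a (u + w) = a u + a w.
Proof. by rewrite -[u]scale1r dual_lin mul1r scale1r. Qed.

Lemma dual_Z a c u : a (c *: u) = c * a u.
Proof. by rewrite -[c *: u]addr0 dual_lin dual_0 addr0. Qed.

Lemma dual_N a u : a (- u) = - a u.
Proof. by rewrite -scaleN1r dual_Z mulN1r. Qed.

Lemma dual_B a u w : a (u - w) = a u - a w.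
Proof. by rewrite dual_D dual_N. Qed.

Lemma dual_sum a I (r : seq I) (F : I -> V) :
  a (\sum_(i <- r) F i) = \sum_(i <- r) a (F i).
Proof. by elim/big_rec2: _ => [|i y1 y2 _ <-]; rewrite ?dual_0// dual_D. Qed.

Lemma dual_addE a b v : (a + b) v = a v + b v. Proof. by []. Qed.
Lemma dual_scaleE c a v : (c *: a) v = c * a v. Proof. by []. Qed.
Lemma dual_oppE a v : (- a) v = - a v. Proof. by []. Qed.
Lemma dual_zeroE v : (0 : dual V) v = 0. Proof. by []. Qed.
Lemma dual_subE a b v : (a - b) v = a v - b v. Proof. by []. Qed.

Lemma dual_sumE I (r : seq I) (F : I -> dual V) v :
  (\sum_(i <- r) F i) v = \sum_(i <- r) F i v.
Proof. by elim/big_rec2: _ => // i y1 y2 _ <-. Qed.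

End dual_theory.

Section vector_bundle.
Context {R : realType} {M : Type} {n k : nat} {E : M -> lmodType R}.
Context {A : atlas R M n} {F : set (triv E k)}.
Hypothesis pmA : premanifold A.
Hypothesis hE : is_vector_bundle A F.
Local Notation TA := (total_atlas A F).
Local Notation pt m a := (existT (fun m0 => GRing.Lmodule.sort (E m0)) m a).
Local Notation de := (delta_mx 0).

Lemma tinv_linear t m c a b : F t -> tdom t m ->
  tinv t m (c *: a + b) = c *: tinv t m a + tinv t m b.
Proof.
move=> Ft tm; apply: (can_inj (vb_tmapK hE Ft tm)).
by rewrite linearP !(vb_tinvK hE Ft tm).
Qed.

Lemma tinv_0 t m : F t -> tdom t m -> tinv t m 0 = 0.
Proof.
by move=> Ft tm; apply: (can_inj (vb_tmapK hE Ft tm)); rewrite linear0 (vb_tinvK hE Ft tm).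
Qed.

Lemma tinv_sum t m I (r : seq I) (x : I -> R) (a : I -> 'rV[R]_k) : F t -> tdom t m ->
  tinv t m (\sum_(i <- r) x i *: a i) = \sum_(i <- r) x i *: tinv t m (a i).
Proof.
move=> Ft tm; elim: r => [|i r IH]; first by rewrite !big_nil tinv_0.
by rewrite !big_cons tinv_linear// IH.
Qed.

Lemma tinv_basis t m (e : E m) : F t -> tdom t m ->
  e = \sum_i tmap t m e 0 i *: tinv t m (de i).
Proof.
move=> Ft tm; rewrite -tinv_sum//; apply: (can_inj (vb_tmapK hE Ft tm)).
by rewrite (vb_tinvK hE Ft tm) -row_sum_delta.
Qed.

Lemma lsubmx_continuous : continuous (@lsubmx R 1 n k).
Proof. by move=> x; apply: differentiable_continuous; exact: differentiable_lsubmx. Qed.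

Lemma total_open W : atlas_open A W -> atlas_open TA [set e : Defs.total E | W (projT1 e)].
Proof.
move=> oW _ [c Ac [t Ft <-]].
rewrite (_ : _ @` _ = lsubmx @^-1` (cmap c @` ((W `&` tdom t) `&` cdom c))).
  apply: open_comp; first by move=> x _; exact: lsubmx_continuous.
  by apply: (atlas_openI pmA oW (vb_open hE Ft)).
apply/seteqP; split=> [_ [[m e] [/= Wm [cm tm]] <-]|x [m [[Wm tm] cm] mx]] /=.
  by exists m => //; rewrite row_mxKl.
exists (pt m (tinv t m (rsubmx x))) => //=.
by rewrite (vb_tinvK hE Ft tm) mx hsubmxK.
Qed.

Lemma smooth_pt_pull (f : M -> R) (e : Defs.total E) :
  smooth_pt (A := A) f (projT1 e) -> smooth_pt (A := TA) (fun e => f (projT1 e)) e.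
Proof.
move=> sf _ [c Ac [t Ft <-]] [ce te] /=.
have E1 x : row_fun (fun i (x : 'rV[R]_(n + k)) => x 0 (lshift k i)) x = lsubmx x.
  by apply/rowP => i; rewrite !mxE.
apply: (@smooth_at_ext _ _ (fun x => (f \o cinv c) (row_fun (fun i (x : 'rV[R]_(n + k)) => x 0 (lshift k i)) x))).
  by move=> x /=; rewrite E1.
apply: smooth_at_comp; last by move=> i; exact: smooth_at_coord.
by rewrite E1 row_mxKl; exact: sf.
Qed.

Lemma smooth_pull (f : M -> R) : smooth A f -> smooth TA (fun e => f (projT1 e)).
Proof. by move=> sf; apply/smoothP => e; apply: smooth_pt_pull; exact: smoothW. Qed.

(** In a bundle chart such a function is a sum of fibre coordinates times functions pulled back from
    M. This covers linear functions of sections of the dual as well as the fibre coordinates of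
    another trivialisation. *)
Lemma smooth_pt_fibrewise (L : forall m, E m -> R) (e : Defs.total E) :
  (forall m c a b, L m (c *: a + b) = c * L m a + L m b) ->
  (forall t, F t -> tdom t (projT1 e) -> forall i,
     smooth_pt (A := A) (fun m => L m (tinv t m (de i))) (projT1 e)) ->
  smooth_pt (A := TA) (fun e => L (projT1 e) (projT2 e)) e.
Proof.
move=> LL sL _ [c Ac [t Ft <-]] [ce te].
have L0 m : L m 0 = 0.
  by have /eqP := LL m 1 0 0; rewrite scaler0 addr0 mul1r -subr_eq subrr => /eqP.
have Lsum m I (r : seq I) (x : I -> R) (a : I -> E m) :
    L m (\sum_(i <- r) x i *: a i) = \sum_(i <- r) x i * L m (a i).
  by elim: r => [|i r IH]; rewrite ?big_nil// !big_cons LL IH.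
pose g (i : 'I_k) : Defs.total E -> R := fun e => L (projT1 e) (tinv t (projT1 e) (de i)).
have sg i : smooth_at (g i \o cinv (total_chart c t)) (cmap (total_chart c t) e).
  apply: (smooth_pt_pull (f := fun m => L m (tinv t m (de i))) (e := e)) => //.
  - by exact: sL.
  - by exists c => //; exists t.
have nb : \forall y \near cmap (total_chart c t) e, (cmap c @` (tdom t `&` cdom c)) (lsubmx y).
  apply: (@lsubmx_continuous (cmap (total_chart c t) e)).
  apply: open_nbhs_nbhs; split; first exact: (vb_open hE Ft Ac).
  by rewrite row_mxKl; exists (projT1 e).
apply: (@smooth_at_near _ _ (fun y : 'rV[R]_(n + k) => \sum_i y 0 (rshift n i) * (g i \o cinv (total_chart c t)) y)).
  apply: filterS nb => y [m [tm cm] my] /=.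
  rewrite -my (pm_chart pmA Ac cm) /g /= [in RHS](row_sum_delta (rsubmx y)).
  by rewrite tinv_sum// Lsum; apply: eq_bigr => i _; rewrite mxE.
apply: smooth_at_sum => i; apply: smooth_atM; first exact: smooth_at_coord.
exact: sg.
Qed.

Lemma smooth_linear_function (eta : forall m, dual (E m)) :
  smooth_section (dual_bundle A F) eta -> smooth TA (linear_function eta).
Proof.
move=> seta; apply/smoothP => e.
apply: (smooth_pt_fibrewise (L := fun m => eta m)) => [m c a b|t Ft te i].
  exact: dual_lin.
by move=> c Ac ce; exact: (seta t Ft (de i) c Ac _ te ce).
Qed.

Lemma total_premanifold : premanifold TA.
Proof.
split=> [[m e]|_ [c Ac [t Ft <-]] [m e] [cm tm] /=|_ [c Ac [t Ft <-]]|_ [c Ac [t Ft <-]] i].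
- have [c Ac cm] := pm_cover pmA m; have [t Ft tm] := vb_cover hE m.
  by exists (total_chart c t) => //; exists c => //; exists t.
- by rewrite row_mxKl row_mxKr (pm_chart pmA Ac cm) (vb_tmapK hE Ft tm).
- rewrite (_ : cdom _ = [set e : Defs.total E | (cdom c `&` tdom t) (projT1 e)])//.
  by apply: total_open; apply: (atlas_openI pmA) (vb_open hE Ft); exact: (pm_open pmA).
- move=> c' Ac' e [ce te] ce'; rewrite /= in ce te *.
  have [[j ->]|[j ->]] : (exists j, i = lshift k j) \/ (exists j, i = rshift n j).
    by case: (split_ordP i) => j ->; [left|right]; exists j.
  rewrite (_ : (fun p => _) = fun e : Defs.total E => cmap c (projT1 e) 0 j); last first.
    by apply/funext => x; rewrite row_mxEl.
  apply: (smooth_pt_pull (f := fun m => cmap c m 0 j) (e := e)) => // c1 Ac1 ce1.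
  exact: (pm_compat pmA Ac j Ac1 ce ce1).
rewrite (_ : (fun p => _) = fun e : Defs.total E => tmap t (projT1 e) (projT2 e) 0 j); last first.
  by apply/funext => x; rewrite row_mxEr.
apply: (smooth_pt_fibrewise (L := fun m a => tmap t m a 0 j) (e := e)) => //.
  by move=> m a x y; rewrite linearP !mxE.
move=> t' Ft' te' l c1 Ac1 ce1.
exact: (vb_compat hE Ft' Ft (de l) j Ac1 (conj te' te) ce1).
Qed.

Lemma supported_pull W chi : supported (A := A) W chi ->
  supported (A := TA) [set e | W (projT1 e)] (fun e : Defs.total E => chi (projT1 e)).
Proof.
move=> [schi [U [oU U0 WU]]]; split; first exact: smooth_pull.
exists [set e | U (projT1 e)]; split=> [|e|e]; [exact: total_open|exact: U0|exact: WU].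
Qed.

(** One cutoff serves M and E together: its support lies in the chart and in the trivialisation, and
    its pullback makes the total chart a good one. *)
Record local_data (m : M) (c : chart R M n) (t : triv E k) (U : set M) (chi : M -> R) : Prop :=
  LocalData {
  ld_triv : F t;
  ld_mem : U m;
  ld_base : good_chart (A := A) c U chi;
  ld_sup : supported (A := A) (tdom t) chi;
  ld_tdom : forall q, U q -> tdom t q;
  ld_total : good_chart (A := TA) (total_chart c t) [set e | U (projT1 e)] (fun e => chi (projT1 e)) }.

End vector_bundle.

Section local_frames.
Context {R : realType} {M : Type} {n k : nat} {E : M -> lmodType R}.
Context {A : atlas R M n} {F : set (triv E k)}.
Hypothesis hM : is_manifold A.
Hypothesis hE : is_vector_bundle A F.
Let pmA := manifold_premanifold hM.
Let pmT := total_premanifold pmA hE.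
Local Notation TA := (total_atlas A F).
Local Notation pt m a := (existT (fun m0 => GRing.Lmodule.sort (E m0)) m a).
Local Notation de := (delta_mx 0).

Lemma local_data_exists m : exists c t U chi, local_data (A := A) (F := F) m c t U chi.
Proof.
have [t Ft tm] := vb_cover hE m.
have [c [chi [U [gc Um sup [Z [oZ Z0 Zc]]]]]] := bump_exists hM (vb_open hE Ft) tm.
exists c, t, U, chi.
have Ut q : U q -> tdom t q.
  move=> Uq; apply: contrapT => nt; have := gc_one gc Uq.
  by rewrite (supported0 sup) => [/esym/eqP|[]//]; rewrite oner_eq0.
split=> //; first by apply: supportedS sup => q [].
split.
- by exists c; [exact: gc_in gc|exists t].
- rewrite (_ : cdom _ = [set e : Defs.total E | (tdom t `&` cdom c) (projT1 e)]); last first.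
    by apply/seteqP; split=> e [].
  exact: (supported_pull pmA hE sup).
- exact: (total_open pmA hE (gc_open gc)).
- by move=> e Ue; split; [exact: gc_dom gc _ _|exact: Ut].
- by move=> e; exact: (gc_one gc).
- exists [set x | Z (lsubmx x)]; split.
  + apply: (@open_comp _ _ lsubmx Z) => // x _; exact: lsubmx_continuous.
  + by move=> e [ce te] /=; rewrite row_mxKl; exact: Z0.
  + move=> x; have [|[q [tq cq] qx]] := Zc (lsubmx x); [by left|right].
    exists (pt q (tinv t q (rsubmx x))) => //=.
    by rewrite (vb_tinvK hE Ft tq) qx hsubmxK.
- move=> e Ue; have [psi [spsi psi1 psi0]] := gc_bump gc Ue.
  exists (fun e => psi (projT1 e)); split=> //; first exact: smooth_pull.
  by move=> q; exact: psi0.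
Qed.

Section frame.
Variables (c : chart R M n) (t : triv E k) (U : set M) (chi : M -> R) (m0 : M).
Hypothesis ld : local_data (A := A) (F := F) m0 c t U chi.
Let Ft := ld_triv ld.

Lemma smooth_chi : smooth A chi.
Proof. by case: (gc_sup (ld_base ld)). Qed.

Fact coframe_smooth a : smooth_section (dual_bundle A F)
  (fun m => chi m *: dual_of (fun e : E m => tmap t m e 0 a)).
Proof.
move=> t' Ft' b c' Ac' m tm cm.
apply: (supported_ptM pmA (g := fun m => dual_of (fun e : E m => tmap t m e 0 a) (tinv t' m b)) (ld_sup ld) _ Ac' cm).
move=> tm' c1 Ac1 cm1.
rewrite (_ : (fun m => _) = fun m => tmap t m (tinv t' m b) 0 a).
  exact: (vb_compat hE Ft' Ft b a Ac1 (conj tm tm') cm1).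
by apply/funext => q; rewrite dual_ofE// => x u v; rewrite linearP !mxE.
Qed.

Definition coframe a : Gamma (dual_bundle A F) := MkGamma (coframe_smooth a).

Lemma coframeE a m (e : E m) : coframe a m e = chi m * tmap t m e 0 a.
Proof. by rewrite [LHS]dual_scaleE dual_ofE// => x u v; rewrite linearP !mxE. Qed.

Fact fframe_smooth a : smooth_section (vbundle A F) (fun m => chi m *: tinv t m (de a)).
Proof.
move=> t' Ft' i c' Ac' m tm cm.
rewrite (_ : (fun m => _) = fun m => chi m * tmap t' m (tinv t m (de a)) 0 i); last first.
  by apply/funext => q; rewrite linearZ mxE.
apply: (supported_ptM pmA (g := fun m => tmap t' m (tinv t m (de a)) 0 i) (ld_sup ld) _ Ac' cm).
move=> tm' c1 Ac1 cm1.
exact: (vb_compat hE Ft Ft' (de a) i Ac1 (conj tm' tm) cm1).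
Qed.

Definition fframe a : Gamma (vbundle A F) := MkGamma (fframe_smooth a).

Lemma fframe_expansion m (e : E m) : U m -> e = \sum_a coframe a m e *: fframe a m.
Proof.
move=> Um; rewrite [LHS](tinv_basis hE e Ft (ld_tdom ld Um)); apply: eq_bigr => a _.
by rewrite coframeE /= (gc_one (ld_base ld) Um) mul1r scale1r.
Qed.

Lemma coframe_expansion m (eta : dual (E m)) : U m ->
  eta = \sum_a eta (fframe a m) *: coframe a m.
Proof.
move=> Um; apply: dual_ext => e; rewrite {1}(fframe_expansion e Um) dual_sum dual_sumE.
by apply: eq_bigr => a _; rewrite dual_Z dual_scaleE mulrC.
Qed.

Definition vframe (i : 'I_n) : Gamma (tangent_bundle A) :=
  MkGamma (chart_vec_smooth pmA (ld_base ld) i).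

Definition xfun (i : 'I_n) : cinf A := Cinf (smooth_chart_fun pmA (ld_base ld) i).

Lemma vframe_expansion m (X : tangent A m) : U m -> X = \sum_i X (xfun i) *: vframe i m.
Proof. exact: (chart_vec_expansion pmA (ld_base ld)). Qed.

(** Here and in [total_chart_funr] the cut-off coordinates of E turn out to be pullbacks from M and
    linear functions of a coframe; so these two kinds of functions determine a derivation on E. *)
Lemma total_chart_funl i : chart_fun (total_chart c t) (fun e => chi (projT1 e)) (lshift k i) =
  (fun e : Defs.total E => xfun i (projT1 e)).
Proof. by apply/funext => e; rewrite /chart_fun /= row_mxEl. Qed.

Lemma total_chart_funr a : chart_fun (total_chart c t) (fun e => chi (projT1 e)) (rshift n a) =
  linear_function (coframe a).
Proof. by apply/funext => e; rewrite /chart_fun /linear_function coframeE /= row_mxEr. Qed.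

Lemma total_expansion f : smooth TA f -> exists g h,
  [/\ forall i : 'I_n, smooth TA (g i), forall a : 'I_k, smooth TA (h a) &
  forall e (u : tangent TA e), U (projT1 e) ->
    u f = \sum_i g i e * u (fun e => xfun i (projT1 e))
        + \sum_a h a e * u (linear_function (coframe a))].
Proof.
move=> sf; have [g [sg gE]] := chart_expansion pmT (ld_total ld) sf.
exists (fun i => g (lshift k i)), (fun a => g (rshift n a)).
split=> [i|a|e u Ue]; [exact: sg|exact: sg|].
rewrite (gE _ _ Ue) big_split_ord /=; congr (_ + _).
  by apply: eq_bigr => i _; rewrite total_chart_funl.
by apply: eq_bigr => a _; rewrite total_chart_funr.
Qed.

End frame.

Lemma total_tangent_ext (e : Defs.total E) (u v : tangent TA e) :
  (forall f : cinf A, u (fun e => f (projT1 e)) = v (fun e => f (projT1 e))) ->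
  (forall eta : Gamma (dual_bundle A F), u (linear_function eta) = v (linear_function eta)) ->
  u = v.
Proof.
move=> uvf uvl; apply: tangent_ext => f sf.
have [c [t [U [chi ld]]]] := local_data_exists (projT1 e).
have [g [h [_ _ H]]] := total_expansion ld sf.
rewrite !H; try exact: (ld_mem ld).
by congr (_ + _); apply: eq_bigr => i _; congr (_ * _); [exact: uvf|exact: uvl].
Qed.

Lemma total_vector_smooth (X : forall e, tangent TA e) :
  (forall f : cinf A, smooth TA (fun e => X e (fun e => f (projT1 e)))) ->
  (forall eta : Gamma (dual_bundle A F), smooth TA (fun e => X e (linear_function eta))) ->
  smooth_section (tangent_bundle TA) X.
Proof.
move=> Xf Xl f sf; apply/smoothP => e.
have [c [t [U [chi ld]]]] := local_data_exists (projT1 e).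
have [g [h [sg sh H]]] := total_expansion ld sf.
pose r e := \sum_i g i e * X e (fun e => xfun ld i (projT1 e))
        + \sum_a h a e * X e (linear_function (coframe ld a)).
apply: (smooth_pt_local pmT (f := r) (total_open pmA hE (gc_open (ld_base ld))) (ld_mem ld)).
  by move=> e' Ue'; rewrite (H e' (X e') Ue').
apply: smooth_ptD; apply: smooth_pt_sum => i; apply: smooth_ptM.
- exact: smoothW (sg i).
- exact: smoothW (Xf _).
- exact: smoothW (sh i).
- exact: smoothW (Xl _).
Qed.

Lemma section_through m (a : E m) : exists e : Gamma (vbundle A F), e m = a.
Proof.
have [c [t [U [chi ld]]]] := local_data_exists m.
exists (\sum_i coframe ld i m a *: fframe ld i).
rewrite [RHS](fframe_expansion ld a (ld_mem ld)).
elim: (index_enum _) => [|i r IH]; first by rewrite !big_nil.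
by rewrite !big_cons -IH.
Qed.

Lemma cosection_through m (eta : dual (E m)) : exists s : Gamma (dual_bundle A F), s m = eta.
Proof.
have [c [t [U [chi ld]]]] := local_data_exists m.
exists (\sum_i eta (fframe ld i m) *: coframe ld i).
rewrite [RHS](coframe_expansion ld eta (ld_mem ld)).
elim: (index_enum _) => [|i r IH]; first by rewrite !big_nil.
by rewrite !big_cons -IH.
Qed.

Lemma vector_field_through m (X : tangent A m) : exists s : Gamma (tangent_bundle A), s m = X.
Proof.
have [c [t [U [chi ld]]]] := local_data_exists m.
exists (\sum_i X (xfun ld i) *: vframe ld i).
rewrite [RHS](vframe_expansion ld X (ld_mem ld)).
elim: (index_enum _) => [|i r IH]; first by rewrite !big_nil.
by rewrite !big_cons -IH.
Qed.

End local_frames.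

(** * Tensorial maps and pointwise dependence *)

Section tensorial.
Context {R : realType} {T : Type} {n : nat} {A : atlas R T n}.
Implicit Types (B C : bundle A) (p : T).

Lemma cinf_eq (f g : cinf A) : (forall p, f p = g p) -> f = g.
Proof.
case: f g => [f sf] [g sg] /= fg; have E : f = g by apply/funext.
by subst g; congr Cinf; exact: Prop_irrelevance.
Qed.

Definition cinf_cst (a : R) : cinf A := Cinf (@smooth_on_cst R T n A setT a).
Definition cinf_mul (f g : cinf A) : cinf A := Cinf (smooth_onM (cinfP f) (cinfP g)).
Definition cinf_add (f g : cinf A) : cinf A := Cinf (smooth_onD (cinfP f) (cinfP g)).

Definition tensorial B p (V : lmodType R) (W : Gamma B -> V) :=
  (forall s t, W (s + t) = W s + W t) /\ forall f s, W (fscale f s) = f p *: W s.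

(** The principle that a C^oo-linear map depends only on the value of the section at p, quantified
    over all targets so that it is proved once per bundle. *)
Definition determined B p := forall (V : lmodType R) (W : Gamma B -> V),
  tensorial p W -> forall s t : Gamma B, s p = t p -> W s = W t.

Lemma tensorial_0 B p (V : lmodType R) (W : Gamma B -> V) : tensorial p W -> W 0 = 0.
Proof. by move=> [WD _]; have /eqP := WD 0 0; rewrite addr0 -subr_eq subrr => /eqP/esym. Qed.

Lemma tensorial_sum B p (V : lmodType R) (W : Gamma B -> V) I (r : seq I) (s : I -> Gamma B) :
  tensorial p W -> W (\sum_(i <- r) s i) = \sum_(i <- r) W (s i).
Proof.
move=> tW; elim/big_rec2: _ => [|i y1 y2 _ <-]; first exact: tensorial_0 tW.
by case: tW => ->.
Qed.

Lemma gamma_sumE B I (r : seq I) (s : I -> Gamma B) p :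
  (\sum_(i <- r) s i : Gamma B) p = \sum_(i <- r) s i p.
Proof. by elim/big_rec2: _ => // i y1 y2 _ <-. Qed.

(** Multiplication by a bump turns the local frame expansion into an identity of global sections, to
    which the tensorial map can be applied. *)
Lemma frame_determined B p (I : finType) (s : I -> Gamma B) (psi : cinf A)
    (coef : I -> Gamma B -> cinf A) :
  psi p = 1 ->
  (forall (t : Gamma B) q, psi q *: t q = \sum_i (psi q * coef i t q) *: s i q) ->
  (forall i (t t' : Gamma B), t p = t' p -> coef i t p = coef i t' p) ->
  determined B p.
Proof.
move=> psi1 psiE coefE V W tW.
have WE t : W t = \sum_i coef i t p *: W (s i).
  have [_ WZ] := tW.
  rewrite -[LHS]scale1r -{1}psi1 -WZ.
  have -> : fscale psi t = \sum_i fscale (cinf_mul psi (coef i t)) (s i).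
    by apply: gamma_eq => q; rewrite gamma_sumE [LHS]psiE.
  rewrite (tensorial_sum _ _ tW); apply: eq_bigr => i _.
  by rewrite WZ /= psi1 mul1r.
by move=> t t' tt'; rewrite !WE; apply: eq_bigr => i _; rewrite (coefE i t t').
Qed.

Section sum.
Variables B C : bundle A.

Fact binl_smooth (s : Gamma B) : smooth_section (bsum B C) (fun p => (s p, 0)).
Proof. by split; [exact: gammaP|exact: smooth_section0]. Qed.
Definition binl (s : Gamma B) : Gamma (bsum B C) := MkGamma (binl_smooth s).

Fact binr_smooth (s : Gamma C) : smooth_section (bsum B C) (fun p => (0, s p)).
Proof. by split; [exact: smooth_section0|exact: gammaP]. Qed.
Definition binr (s : Gamma C) : Gamma (bsum B C) := MkGamma (binr_smooth s).

Fact bfst_smooth (s : Gamma (bsum B C)) : smooth_section B (fun p => (s p).1).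
Proof. by case: s => s []. Qed.
Definition bfst (s : Gamma (bsum B C)) : Gamma B := MkGamma (bfst_smooth s).

Fact bsnd_smooth (s : Gamma (bsum B C)) : smooth_section C (fun p => (s p).2).
Proof. by case: s => s []. Qed.
Definition bsnd (s : Gamma (bsum B C)) : Gamma C := MkGamma (bsnd_smooth s).

Lemma bsum_split s : s = binl (bfst s) + binr (bsnd s).
Proof.
apply: gamma_eq => p /=; case: (s p) => x y.
by congr pair; rewrite /= ?addr0 ?add0r.
Qed.

Lemma bsum_determined p : determined B p -> determined C p -> determined (bsum B C) p.
Proof.
move=> dB dC V W [WD WZ] s t st; rewrite (bsum_split s) (bsum_split t) !WD.
congr (_ + _).
  apply: (dB V (fun s => W (binl s))) => [|/=]; last by rewrite st.
  split=> [s1 s2|f s1]; rewrite -?WD -?WZ; congr W; apply: gamma_eq => q /=.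
    by congr pair; rewrite /= addr0.
  by congr pair; rewrite /= scaler0.
apply: (dC V (fun s => W (binr s))) => [|/=]; last by rewrite st.
split=> [s1 s2|f s1]; rewrite -?WD -?WZ; congr W; apply: gamma_eq => q /=.
  by congr pair; rewrite /= addr0.
by congr pair; rewrite /= scaler0.
Qed.

End sum.

Lemma tensorial_dual B p (W : Gamma B -> R^o) : determined B p ->
  (forall x : B p, exists s : Gamma B, s p = x) -> tensorial p W ->
  exists a : dual (B p), forall s : Gamma B, a (s p) = W s.
Proof.
move=> dB /choice [s sE] tW.
have WE x (t : Gamma B) : t p = x -> W (s x) = W t by move=> tx; apply: (dB _ _ tW); rewrite sE.
have aL c x y : W (s (c *: x + y)) = c * W (s x) + W (s y).
  have [WD WZ] := tW.
  rewrite (WE _ (fscale (cinf_cst c) (s x) + s y)); first by rewrite WD WZ.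
  by rewrite /= !sE.
exists (dual_of (fun x => W (s x))) => t.
by rewrite dual_ofE//; exact: WE.
Qed.

Lemma differential_smooth (f : cinf A) :
  smooth_section (cotangent_bundle A) (differential A f).
Proof.
move=> X sX; rewrite (_ : (fun p => _) = fun p => X p f); first exact: (sX f (cinfP f)).
by apply/funext => p; rewrite /differential dual_ofE.
Qed.

Lemma differentialE p (f : T -> R) (X : tangent A p) : differential A f p X = X f.
Proof. by rewrite /differential dual_ofE. Qed.

Definition dsec (f : cinf A) : Gamma (cotangent_bundle A) := MkGamma (differential_smooth f).

Definition vf_app (X : Gamma (tangent_bundle A)) (f : cinf A) : cinf A :=
  Cinf (gammaP X _ (cinfP f)).

Definition cv_app (w : Gamma (cotangent_bundle A)) (X : Gamma (tangent_bundle A)) : cinf A :=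
  Cinf (gammaP w _ (gammaP X)).

Lemma tangent_mapE {T'} {n'} {A' : atlas R T' n'} (G : T -> T') p (u : tangent A p) f :
  (forall g, smooth A' g -> smooth A (g \o G)) -> smooth A' f ->
  tangent_map A' G u f = u (f \o G).
Proof.
move=> sG sf; apply: (tangent_ofE (p := G p)) sf => [a f1 f2 s1 s2|f1 f2 s1 s2].
  exact: (tangent_D u a (sG _ s1) (sG _ s2)).
exact: (tangent_M u (sG _ s1) (sG _ s2)).
Qed.

End tensorial.

Section bundle_theory.
Context {R : realType} {M : Type} {n k : nat} {E : M -> lmodType R}.
Context {A : atlas R M n} {F : set (triv E k)}.
Hypothesis hM : is_manifold A.
Hypothesis hE : is_vector_bundle A F.
Let pmA := manifold_premanifold hM.
Let pmT := total_premanifold pmA hE.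
Local Notation TA := (total_atlas A F).
Local Notation pt m a := (existT (fun m0 => GRing.Lmodule.sort (E m0)) m a).
Local Notation de := (delta_mx 0).
Local Notation TM := (tangent_bundle A).
Local Notation Ed := (dual_bundle A F).
Local Notation Es := (vbundle A F).

Lemma pairing_smooth (eta : Gamma Ed) (e : Gamma Es) : smooth A (fun m => eta m (e m)).
Proof.
apply/smoothP => m; have [t Ft tm] := vb_cover hE m.
apply: (smooth_pt_local pmA (f := fun m => \sum_i tmap t m (e m) 0 i * eta m (tinv t m (de i))) (vb_open hE Ft) tm).
  move=> q tq; rewrite [in RHS](tinv_basis hE (e q) Ft tq) dual_sum.
  by apply: eq_bigr => i _; rewrite dual_Z.
apply: smooth_pt_sum => i; apply: smooth_ptM => c Ac cm.
  exact: (gammaP e t Ft i c Ac m tm cm).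
exact: (gammaP eta t Ft (de i) c Ac m tm cm).
Qed.

Definition pairing (eta : Gamma Ed) (e : Gamma Es) : cinf A := Cinf (pairing_smooth eta e).

Lemma bump_psi m c t U chi : local_data (A := A) (F := F) m c t U chi ->
  exists psi : cinf A, psi m = 1 /\ forall q, ~ U q -> psi q = 0.
Proof.
move=> ld; have [psi [spsi psi1 psi0]] := gc_bump (ld_base ld) (ld_mem ld).
by exists (Cinf spsi).
Qed.

Lemma determined_TM m : determined TM m.
Proof.
have [c [t [U [chi ld]]]] := local_data_exists hM hE m.
have [psi [psi1 psi0]] := bump_psi ld.
apply: (frame_determined (s := vframe hM ld) (psi := psi)
  (coef := fun i X => vf_app X (xfun hM ld i))) => //.
  move=> X q; have [Uq|/psi0 ->] := pselect (U q).
    rewrite {1}(vframe_expansion hM ld (X q) Uq) scaler_sumr.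
    by apply: eq_bigr => i _; rewrite scalerA.
  by rewrite scale0r big1// => i _; rewrite mul0r scale0r.
by move=> i X X' /= ->.
Qed.

Lemma determined_Ed m : determined Ed m.
Proof.
have [c [t [U [chi ld]]]] := local_data_exists hM hE m.
have [psi [psi1 psi0]] := bump_psi ld.
apply: (frame_determined (s := coframe hM hE ld) (psi := psi)
  (coef := fun i eta => pairing eta (fframe hM hE ld i))) => //.
  move=> eta q; have [Uq|/psi0 ->] := pselect (U q).
    rewrite {1}(coframe_expansion hM hE ld (eta q) Uq) scaler_sumr.
    by apply: eq_bigr => i _; rewrite scalerA.
  by rewrite scale0r big1// => i _; rewrite mul0r scale0r.
by move=> i X X' /= ->.
Qed.

Lemma covector_expansion m c t U chi (ld : local_data (A := A) (F := F) m c t U chi) q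
    (w : dual (tangent A q)) : U q ->
  w = \sum_i w (vframe hM ld i q) *: dsec (xfun hM ld i) q.
Proof.
move=> Uq; apply: dual_ext => X; rewrite {1}(vframe_expansion hM ld X Uq) dual_sum dual_sumE.
by apply: eq_bigr => i _; rewrite dual_Z dual_scaleE differentialE mulrC.
Qed.

Lemma covector_through m (w : dual (tangent A m)) :
  exists s : Gamma (cotangent_bundle A), s m = w.
Proof.
have [c [t [U [chi ld]]]] := local_data_exists hM hE m.
exists (\sum_i w (vframe hM ld i m) *: dsec (xfun hM ld i)).
by rewrite gamma_sumE [RHS](covector_expansion ld w (ld_mem ld)).
Qed.

Lemma fibre_ext m (a b : E m) : (forall eta : dual (E m), eta a = eta b) -> a = b.
Proof.
move=> ab; have [c [t [U [chi ld]]]] := local_data_exists hM hE m.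
rewrite (fframe_expansion hM hE ld a (ld_mem ld)) [RHS](fframe_expansion hM hE ld b (ld_mem ld)).
by apply: eq_bigr => i _; rewrite ab.
Qed.

(** Finite rank, in the form in which it is used; the preimage is read off on a local coframe. *)
Lemma fibre_reflexive m (phi : dual (E m) -> R) :
  (forall c u v, phi (c *: u + v) = c * phi u + phi v) -> exists a : E m, forall eta, phi eta = eta a.
Proof.
move=> phiL; have [c [t [U [chi ld]]]] := local_data_exists hM hE m.
exists (\sum_i phi (coframe hM hE ld i m) *: fframe hM hE ld i m) => eta.
rewrite dual_sum {1}(coframe_expansion hM hE ld eta (ld_mem ld)).
have phi0 : phi 0 = 0.
  by have /eqP := phiL 1 0 0; rewrite scaler0 addr0 mul1r -subr_eq subrr => /eqP.
have phiS (r : seq 'I_k) : phi (\sum_(i <- r) eta (fframe hM hE ld i m) *: coframe hM hE ld i m) =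
    \sum_(i <- r) eta (fframe hM hE ld i m) * phi (coframe hM hE ld i m).
  elim: r => [|i r IH]; first by rewrite !big_nil.
  by rewrite !big_cons phiL IH.
rewrite phiS; apply: eq_bigr => i _; rewrite [RHS]dual_Z; exact: mulrC.
Qed.

Definition pull (f : cinf A) : cinf TA := Cinf (smooth_pull (F := F) (cinfP f)).

Definition lin (eta : Gamma Ed) : cinf TA := Cinf (smooth_linear_function pmA hE (gammaP eta)).

Lemma linE eta m (a : E m) : lin eta (pt m a) = eta m a. Proof. by []. Qed.

Lemma lin_fscale f eta : lin (fscale f eta) = cinf_mul (pull f) (lin eta).
Proof. by apply: cinf_eq. Qed.

Lemma lin_add eta eta' : lin (eta + eta') = cinf_add (lin eta) (lin eta').
Proof. by apply: cinf_eq. Qed.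

Lemma total_ext m (a : E m) (u v : tangent TA (pt m a)) :
  (forall f, u (pull f) = v (pull f)) -> (forall eta, u (lin eta) = v (lin eta)) -> u = v.
Proof. exact: total_tangent_ext. Qed.

Lemma smooth_along (f : cinf TA) (e : Gamma Es) : smooth A (fun m => f (pt m (e m))).
Proof.
apply/smoothP => m; have [t Ft tm] := vb_cover hE m; have [c Ac cm] := pm_cover pmA m.
apply: (smooth_pt_chart pmA Ac cm).
pose ct := total_chart c t.
have TAct : TA ct by exists c => //; exists t.
pose g (i : 'I_(n + k)) (x : 'rV[R]_n) := cmap ct (pt (cinv c x) (e (cinv c x))) 0 i.
have gE x : row_fun g x = cmap ct (pt (cinv c x) (e (cinv c x))) by apply/rowP => i; rewrite mxE.
apply: (@smooth_at_near _ _ (fun x => (f \o cinv ct) (row_fun g x))).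
  apply: filterS (nbhs_chart pmA Ac (vb_open hE Ft) tm cm) => y [q [tq cq _ yq]].
  by rewrite /comp gE yq (pm_chart pmT TAct).
apply: smooth_at_comp.
  rewrite gE (pm_chart pmA Ac cm).
  by apply: (smoothW (cinfP f) TAct); split.
move=> i.
have [[j ->]|[j ->]] : (exists j, i = lshift k j) \/ (exists j, i = rshift n j).
  by case: (split_ordP i) => j ->; [left|right]; exists j.
  apply: (@smooth_at_ext _ _ ((fun m => cmap c m 0 j) \o cinv c)).
    by move=> x; rewrite /g /= row_mxEl.
  exact: (pm_compat pmA Ac j Ac cm cm).
apply: (@smooth_at_ext _ _ ((fun m => tmap t m (e m) 0 j) \o cinv c)).
  by move=> x; rewrite /g /= row_mxEr.
exact: (gammaP e t Ft j c Ac m tm cm).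
Qed.

Definition along (f : cinf TA) (e : Gamma Es) : cinf A := Cinf (smooth_along f e).

Lemma tangent_alongE (e : Gamma Es) m (X : tangent A m) (f : cinf TA) :
  tangent_map TA (fun x => pt x (e x)) X f = X (along f e).
Proof.
rewrite tangent_mapE//; last exact: cinfP.
by move=> g sg; exact: (smooth_along (Cinf sg) e).
Qed.

Lemma tangent_bprojE e (u : tangent TA e) (f : cinf A) :
  tangent_map A (@bproj _ _ E) u f = u (pull f).
Proof.
rewrite tangent_mapE//; last exact: cinfP.
by move=> g sg; exact: (smooth_pull (F := F) sg).
Qed.

Lemma verticalE m (a b : E m) (f : cinf TA) :
  vertical A F a b f = derive1 (fun t : R => f (pt m (a + t *: b))) 0.
Proof.
have [t Ft tm] := vb_cover hE m; have [c Ac cm] := pm_cover pmA m.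
pose ct := total_chart c t.
have TAct : TA ct by exists c => //; exists t.
pose v : 'rV[R]_(n + k) := row_mx 0 (tmap t m b).
pose x0 := cmap ct (pt m a).
have lineE (g : Defs.total E -> R) :
    (fun s : R => g (pt m (a + s *: b))) = fun s => (g \o cinv ct) (x0 + s *: v).
  apply/funext => s /=; rewrite /x0 /= scale_row_mx add_row_mx scaler0 addr0.
  by rewrite row_mxKl row_mxKr (pm_chart pmA Ac cm) -linearZ -linearD (vb_tmapK hE Ft tm).
have dg (g : Defs.total E -> R) : smooth TA g ->
    derivable (g \o cinv ct) x0 v /\
    derive1 (fun s : R => g (pt m (a + s *: b))) 0 = 'D_v (g \o cinv ct) x0.
  move=> sg; split; first by apply: smooth_at_derivable; apply: (smoothW sg TAct); split.
  by rewrite derive1E lineE -derive_line scale0r addr0.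
have aE : pt m (a + (0 : R) *: b) = pt m a by rewrite scale0r addr0.
have x0E g : (g \o cinv ct) x0 = g (pt m a).
  by rewrite /x0 /= row_mxKl row_mxKr (pm_chart pmA Ac cm) (vb_tmapK hE Ft tm).
apply: (tangent_ofE (p := pt m a)) (cinfP f) => [c0 f1 f2 s1 s2|f1 f2 s1 s2].
  have sD : smooth TA (fun x => c0 * f1 x + f2 x).
    by apply: smooth_onD s2; apply: smooth_onM s1; exact: smooth_on_cst.
  have [_ E0] := dg _ sD; have [d1 E1] := dg _ s1; have [d2 E2] := dg _ s2.
  rewrite [LHS]E0 E1 E2.
  have d0 : derivable (fun y => c0 * (f1 \o cinv ct) y) x0 v.
    by apply: derivableM; [exact: derivable_cst|exact: d1].
  rewrite [LHS](deriveD d0 d2); congr (_ + _).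
  rewrite deriveM; [|exact: derivable_cst|exact: d1].
  by rewrite derive_cst scaler0 addr0.
have [_ E0] := dg _ (smooth_onM s1 s2); have [d1 E1] := dg _ s1; have [d2 E2] := dg _ s2.
by rewrite [LHS]E0 E1 E2 [LHS](deriveM d1 d2) !x0E.
Qed.

Lemma vertical_pull m (a b : E m) f : vertical A F a b (pull f) = 0.
Proof. by rewrite verticalE derive1E /= derive_cst. Qed.

Lemma vertical_lin m (a b : E m) eta : vertical A F a b (lin eta) = eta m b.
Proof.
rewrite verticalE derive1E.
rewrite (_ : (fun t : R => _) = fun t : R => eta m a + eta m b * t); last first.
  by apply/funext => t; rewrite linE dual_D dual_Z mulrC.
rewrite deriveD; [|exact: derivable_cst|by apply: derivableM; [exact: derivable_cst|exact: derivable_id]].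
rewrite derive_cst add0r deriveM; [|exact: derivable_cst|exact: derivable_id].
by rewrite derive_cst derive_id scaler0 addr0 [_%:A]mulr1.
Qed.

Lemma vertical_lin_b m (a : E m) c b b' :
  vertical A F a (c *: b + b') = c *: vertical A F a b + vertical A F a b'.
Proof.
apply: total_ext => [f|eta].
  by rewrite tangent_addE tangent_scaleE !vertical_pull mulr0 addr0.
by rewrite tangent_addE tangent_scaleE !vertical_lin dual_lin.
Qed.

Lemma vertical_proj m (a b : E m) : tangent_map A (@bproj _ _ E) (vertical A F a b) = 0.
Proof.
by apply: tangent_ext => f sf; rewrite (tangent_bprojE (vertical A F a b) (Cinf sf)) vertical_pull.
Qed.

(** Take a section [e] through [a]. The difference between [phi] and the derivative along X of the
    pairing with [e] is tensorial, hence given by a vector [b] of the fibre; the image of X under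
    [e] plus the vertical vector [b] has the prescribed values. *)
Lemma tangent_exists m (a : E m) (X : tangent A m) (phi : Gamma Ed -> R) :
  (forall eta eta', phi (eta + eta') = phi eta + phi eta') ->
  (forall f eta, phi (fscale f eta) = f m * phi eta + eta m a * X f) ->
  exists u : tangent TA (pt m a), (forall f, u (pull f) = X f) /\ forall eta, u (lin eta) = phi eta.
Proof.
have [e <-] := section_through hM hE a => phiD phiM.
pose psi eta : R^o := phi eta - X (pairing eta e).
have tpsi : tensorial m psi.
  split=> [eta eta'|f eta]; rewrite /psi.
    rewrite phiD (_ : pairing (eta + eta') e = cinf_add (cinf_mul (cinf_cst 1) (pairing eta e)) (pairing eta' e)); last first.
      by apply: cinf_eq => q /=; rewrite mul1r.
    by rewrite (tangent_D X 1 (cinfP _) (cinfP _)) mul1r; ring.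
  rewrite phiM (_ : pairing (fscale f eta) e = cinf_mul f (pairing eta e)); last exact: cinf_eq.
  by rewrite (tangent_M X (cinfP _) (cinfP _)) /= /GRing.scale /=; ring.
have [bb bE] := tensorial_dual (@determined_Ed m) (cosection_through hM hE (m := m)) tpsi.
have [b bb_b] := fibre_reflexive (dual_lin bb).
exists (tangent_map TA (fun x => pt x (e x)) X + vertical A F (e m) b); split=> [f|eta].
  rewrite tangent_addE vertical_pull addr0 tangent_alongE.
  by congr (tangent_val X _).
rewrite tangent_addE vertical_lin -bb_b bE tangent_alongE /psi.
have E0 : along (lin eta) e = pairing eta e by apply: cinf_eq.
by rewrite E0 addrC subrK.
Qed.

End bundle_theory.

(** * Lie brackets and dull brackets *)

Section lie_bracket.
Context {R : realType} {T : Type} {n : nat} {A : atlas R T n}.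
Local Notation TM := (tangent_bundle A).
Implicit Types (X Y Z : Gamma TM) (f g : cinf A) (p : T).

Lemma vf_appE X f p : vf_app X f p = X p f. Proof. by []. Qed.

Lemma tangent_cinfD p (u : tangent A p) f g : u (cinf_add f g) = u f + u g.
Proof.
have := tangent_D u 1 (cinfP f) (cinfP g); rewrite mul1r => <-.
by congr (tangent_val u _); apply/funext => q /=; rewrite mul1r.
Qed.

Lemma tangent_cinfM p (u : tangent A p) f g : u (cinf_mul f g) = f p * u g + g p * u f.
Proof. exact: (tangent_M u (cinfP f) (cinfP g)). Qed.

Lemma tangent_cinfc p (u : tangent A p) a : u (cinf_cst (A := A) a) = 0.
Proof. exact: tangent_cst. Qed.

Lemma tangent_cinfZ p (u : tangent A p) a f : u (cinf_mul (cinf_cst a) f) = a * u f.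
Proof. by rewrite tangent_cinfM tangent_cinfc mulr0 addr0. Qed.

Lemma lieE X Y p f : lie X Y p f = X p (vf_app Y f) - Y p (vf_app X f).
Proof.
apply: (tangent_ofE (p := p)) (cinfP f) => [a f1 f2 s1 s2|f1 f2 s1 s2].
  have E Z q : Z q (fun x => a * f1 x + f2 x) = a * Z q f1 + Z q f2 by exact: tangent_D.
  have E2 Z Z' : Z p (fun q => Z' q (fun x => a * f1 x + f2 x)) =
      a * Z p (fun q => Z' q f1) + Z p (fun q => Z' q f2).
    rewrite (_ : (fun q => _) = fun q => a * Z' q f1 + Z' q f2); last by apply/funext => q; exact: E.
    exact: (tangent_D (Z p) a (gammaP Z' _ s1) (gammaP Z' _ s2)).
  by rewrite !E2; ring.
have E2 Z Z' : Z p (fun q => Z' q (fun x => f1 x * f2 x)) =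
    f1 p * Z p (fun q => Z' q f2) + Z' p f2 * Z p f1 + (f2 p * Z p (fun q => Z' q f1) + Z' p f1 * Z p f2).
  rewrite (_ : (fun q => _) = fun q => 1 * (f1 q * Z' q f2) + f2 q * Z' q f1); last first.
    by apply/funext => q; rewrite mul1r; exact: tangent_M.
  rewrite (tangent_D (Z p) 1 (smooth_onM s1 (gammaP Z' _ s2)) (smooth_onM s2 (gammaP Z' _ s1))) mul1r.
  by rewrite (tangent_M (Z p) s1 (gammaP Z' _ s2)) (tangent_M (Z p) s2 (gammaP Z' _ s1)).
by rewrite !E2; ring.
Qed.

Lemma lie_smooth X Y : smooth_section TM (lie X Y).
Proof.
move=> f sf; rewrite (_ : (fun p => _) = cinf_add (vf_app X (vf_app Y (Cinf sf)))
  (cinf_mul (cinf_cst (-1)) (vf_app Y (vf_app X (Cinf sf))))); first exact: cinfP.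
by apply/funext => p; rewrite [LHS](lieE X Y p (Cinf sf)) /= mulN1r.
Qed.

Definition lieG X Y : Gamma TM := MkGamma (lie_smooth X Y).

Lemma lieGE X Y p f : lieG X Y p f = X p (vf_app Y f) - Y p (vf_app X f).
Proof. exact: lieE. Qed.

Lemma gamma_TM_ext X Y : (forall p f, X p f = Y p f) -> X = Y.
Proof.
by move=> XY; apply: gamma_eq => p; apply: tangent_ext => f sf; exact: (XY p (Cinf sf)).
Qed.

Lemma vf_app_add X Y f : vf_app (X + Y) f = cinf_add (vf_app X f) (vf_app Y f).
Proof. exact: cinf_eq. Qed.

Lemma vf_app_scale a X f : vf_app (a *: X) f = cinf_mul (cinf_cst a) (vf_app X f).
Proof. exact: cinf_eq. Qed.

Lemma vf_app_fscale g X f : vf_app (fscale g X) f = cinf_mul g (vf_app X f).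
Proof. exact: cinf_eq. Qed.

Lemma vf_app_lie X Y f : vf_app (lieG X Y) f =
  cinf_add (vf_app X (vf_app Y f)) (cinf_mul (cinf_cst (-1)) (vf_app Y (vf_app X f))).
Proof. by apply: cinf_eq => p; rewrite vf_appE lieGE /= mulN1r. Qed.

Lemma lieDl X Y Z : lieG (X + Y) Z = lieG X Z + lieG Y Z.
Proof.
apply: gamma_TM_ext => p f; rewrite lieGE [RHS]tangent_addE !lieGE vf_app_add tangent_cinfD.
by rewrite [(X + Y) p _]tangent_addE; ring.
Qed.

Lemma lieZl a X Z : lieG (a *: X) Z = a *: lieG X Z.
Proof.
apply: gamma_TM_ext => p f; rewrite lieGE [RHS]tangent_scaleE !lieGE vf_app_scale tangent_cinfZ.
by rewrite [(a *: X) p _](tangent_scaleE (X p) a) mulrBr.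
Qed.

Lemma lie_anti X Y : lieG X Y = - lieG Y X.
Proof.
by apply: gamma_TM_ext => p f; rewrite -scaleN1r lieGE [RHS]tangent_scaleE lieGE mulN1r opprB.
Qed.

Lemma lieDr X Y Z : lieG X (Y + Z) = lieG X Y + lieG X Z.
Proof. by rewrite lie_anti lieDl opprD -!lie_anti. Qed.

Lemma lieZr a X Y : lieG X (a *: Y) = a *: lieG X Y.
Proof. by rewrite lie_anti lieZl -scalerN -lie_anti. Qed.

Lemma lie_leibniz f X Y p :
  lieG X (fscale f Y) p = f p *: lieG X Y p + X p f *: Y p.
Proof.
apply: tangent_ext => g sg; rewrite tangent_addE !tangent_scaleE.
rewrite (lieGE X (fscale f Y) p (Cinf sg)) (lieGE X Y p (Cinf sg)) vf_app_fscale tangent_cinfM.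
by rewrite [fscale f Y p _]tangent_scaleE /=; ring.
Qed.

Lemma lie_leibnizl f X Y p :
  lieG (fscale f X) Y p = f p *: lieG X Y p - Y p f *: X p.
Proof.
apply: tangent_ext => g sg; rewrite -scaleNr tangent_addE !tangent_scaleE.
rewrite (lieGE (fscale f X) Y p (Cinf sg)) (lieGE X Y p (Cinf sg)) vf_app_fscale tangent_cinfM.
by rewrite [fscale f X p _](tangent_scaleE (X p) (f p)) /=; ring.
Qed.

Lemma lie_jacobi X Y Z :
  lieG X (lieG Y Z) - lieG Y (lieG X Z) + lieG Z (lieG X Y) = 0.
Proof.
apply: gamma_TM_ext => p f.
have E X1 X2 X3 : lieG X1 (lieG X2 X3) p f = X1 p (vf_app X2 (vf_app X3 f)) - X1 p (vf_app X3 (vf_app X2 f))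
    - X2 p (vf_app X3 (vf_app X1 f)) + X3 p (vf_app X2 (vf_app X1 f)).
  by rewrite lieGE vf_app_lie tangent_cinfD tangent_cinfZ lieGE; ring.
rewrite [LHS](tangent_addE ((lieG X (lieG Y Z) - lieG Y (lieG X Z)) p)).
rewrite [X in X + _](tangent_addE (lieG X (lieG Y Z) p)).
rewrite [X in _ + X + _](tangent_scaleE (lieG Y (lieG X Z) p) (-1)).
by rewrite [RHS](tangent_zeroE p) !E; ring.
Qed.

End lie_bracket.

Section dull_algebra.
Context {R : realType} {T : Type} {n : nat} {A : atlas R T n}.
Variables (Q : bundle A) (rho : bmor Q (tangent_bundle A)).
Variable D : Gamma Q -> Gamma Q -> Gamma Q.
Hypothesis dD : is_dull rho D.
Implicit Types (q : Gamma Q) (f : cinf A).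

Lemma fscale1 (B : bundle A) (s : Gamma B) : fscale (cinf_cst 1) s = s.
Proof. by apply: gamma_eq => p /=; rewrite scale1r. Qed.

Lemma bmor_0 (B C : bundle A) (G : bmor B C) p : G p 0 = 0.
Proof.
have /eqP := bmor_linear G (p := p) 1 0 0; rewrite scaler0 addr0 scale1r.
by rewrite -subr_eq subrr => /eqP.
Qed.

Lemma bmor_D (B C : bundle A) (G : bmor B C) p x y : G p (x + y) = G p x + G p y.
Proof. by have := bmor_linear G (p := p) 1 x y; rewrite !scale1r. Qed.

Lemma bmor_Z (B C : bundle A) (G : bmor B C) p a x : G p (a *: x) = a *: G p x.
Proof. by have := bmor_linear G (p := p) a x 0; rewrite !addr0 bmor_0 addr0. Qed.

Lemma bmor_N (B C : bundle A) (G : bmor B C) p x : G p (- x) = - G p x.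
Proof. by rewrite -scaleN1r bmor_Z scaleN1r. Qed.

Lemma bmap_D (B C : bundle A) (G : bmor B C) s t : bmap G (s + t) = bmap G s + bmap G t.
Proof. by apply: gamma_eq => p; exact: bmor_D. Qed.

Lemma bmap_Z (B C : bundle A) (G : bmor B C) a s : bmap G (a *: s) = a *: bmap G s.
Proof. by apply: gamma_eq => p; exact: bmor_Z. Qed.

Lemma bmap_N (B C : bundle A) (G : bmor B C) s : bmap G (- s) = - bmap G s.
Proof. by rewrite -scaleN1r bmap_Z scaleN1r. Qed.

Lemma bmap_fscale (B C : bundle A) (G : bmor B C) f s : bmap G (fscale f s) = fscale f (bmap G s).
Proof. by apply: gamma_eq => p; exact: bmor_Z. Qed.

Lemma dullDl q1 q2 q : D (q1 + q2) q = D q1 q + D q2 q.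
Proof. by have := dull_linearl dD 1 q1 q2 q; rewrite !scale1r. Qed.

Lemma dullDr q q1 q2 : D q (q1 + q2) = D q q1 + D q q2.
Proof. by have := dull_linearr dD 1 q q1 q2; rewrite !scale1r. Qed.

Lemma dull0l q : D 0 q = 0.
Proof. by have /eqP := dullDl 0 0 q; rewrite addr0 -subr_eq subrr => /eqP/esym. Qed.

Lemma dull0r q : D q 0 = 0.
Proof. by have /eqP := dullDr q 0 0; rewrite addr0 -subr_eq subrr => /eqP/esym. Qed.

Lemma dullZl a q1 q : D (a *: q1) q = a *: D q1 q.
Proof. by have := dull_linearl dD a q1 0 q; rewrite !addr0 dull0l addr0. Qed.

Lemma dullZr a q1 q : D q (a *: q1) = a *: D q q1.
Proof. by have := dull_linearr dD a q q1 0; rewrite !addr0 dull0r addr0. Qed.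

Lemma dullNl q1 q : D (- q1) q = - D q1 q.
Proof. by rewrite -scaleN1r dullZl scaleN1r. Qed.

Lemma dullNr q1 q : D q (- q1) = - D q q1.
Proof. by rewrite -scaleN1r dullZr scaleN1r. Qed.

Lemma dull_fr f q1 q2 p : D q1 (fscale f q2) p = f p *: D q1 q2 p + rho p (q1 p) f *: q2 p.
Proof.
have := dull_leibniz dD (cinf_cst 1) f q1 q2 p; rewrite fscale1 => ->.
by rewrite /= !mul1r (tangent_cst (rho p (q2 p))) mulr0 scale0r subr0.
Qed.

Lemma dull_fl f q1 q2 p : D (fscale f q1) q2 p = f p *: D q1 q2 p - rho p (q2 p) f *: q1 p.
Proof.
have := dull_leibniz dD f (cinf_cst 1) q1 q2 p; rewrite fscale1 => ->.
by rewrite /= mulr1 mul1r (tangent_cst (rho p (q1 p))) mulr0 scale0r addr0.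
Qed.

End dull_algebra.

(** * Existence of a dull bracket *)

Section dull_exists.
Context {R : realType} {M : Type} {n k : nat} {E : M -> lmodType R}.
Context {A : atlas R M n} {F : set (triv E k)}.
Hypothesis hM : is_manifold A.
Hypothesis hE : is_vector_bundle A F.
Let pmA := manifold_premanifold hM.
Local Notation de := (delta_mx 0).
Local Notation TM := (tangent_bundle A).
Local Notation Ed := (dual_bundle A F).
Local Notation Q := (side_bundle A F).

Record patch := Patch {
  p_triv : triv E k;
  p_fun : cinf A;
  p_nbhs : set M;
  p_in : F p_triv;
  p_sup : supported (A := A) (tdom p_triv) p_fun;
  p_open : atlas_open A p_nbhs;
  p_one : forall m, p_nbhs m -> p_fun m = 1 }.

Lemma patches : exists s : nat -> option patch,
  forall m, exists i x, s i = Some x /\ p_nbhs x m.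
Proof.
apply: (lindelof hM) => [x|m]; first exact: p_open.
have [c [t [U [chi ld]]]] := local_data_exists hM hE m.
pose x := @Patch t (Cinf (smooth_chi ld)) U (ld_triv ld) (ld_sup ld)
  (gc_open (ld_base ld)) (gc_one (ld_base ld)).
by exists x; exact: (ld_mem ld).
Qed.

Section partition.
Variable s : nat -> option patch.
Hypothesis sE : forall m, exists i x, s i = Some x /\ p_nbhs x m.

Definition bumpi i : cinf A := if s i is Some x then p_fun x else cinf_cst 0.

Fixpoint avoid i : cinf A := if i is i'.+1 then
  cinf_mul (avoid i') (cinf_add (cinf_cst 1) (cinf_mul (cinf_cst (-1)) (bumpi i'))) else cinf_cst 1.

(* Telescoping makes [\sum_(i < N) parti i = 1 - avoid N], and [avoid N] vanishes on the
   [i]-th patch as soon as [i < N]: local finiteness is automatic. *)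
Definition parti i : cinf A := cinf_mul (avoid i) (bumpi i).

Lemma sum_parti N m : \sum_(i < N) parti i m = 1 - avoid N m.
Proof.
elim: N => [|N IH]; first by rewrite big_ord0 /= subrr.
by rewrite big_ord_recr IH /=; ring.
Qed.

Lemma avoid_0 i x m : s i = Some x -> p_nbhs x m -> forall N, (i < N)%N -> avoid N m = 0.
Proof.
move=> si xm; elim=> [//|N IH]; rewrite ltnS leq_eqVlt => /orP[/eqP iN|iN] /=.
  by rewrite -iN /bumpi si (p_one xm); ring.
by rewrite IH// mul0r.
Qed.

Fact coef_smooth i (eta : Gamma Ed) b : smooth A (fun q =>
  if s i is Some x then parti i q * eta q (tinv (p_triv x) q (de b)) else 0).
Proof.
rewrite /parti /bumpi; case: (s i) => [x|]; last exact: smooth_on_cst.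
rewrite (_ : (fun q => _) = fun q => avoid i q * (p_fun x q * eta q (tinv (p_triv x) q (de b)))); last first.
  by apply/funext => q /=; rewrite mulrA.
apply: smooth_onM; first exact: cinfP.
apply: (supportedM pmA (p_sup x)) => m tm c Ac cm.
exact: (gammaP eta _ (p_in x) (de b) c Ac m tm cm).
Qed.

Definition coefi i eta b : cinf A := Cinf (coef_smooth i eta b).

(** The flat derivative, in the i-th trivialisation, of [parti i] times [eta]. Applying the cutoff
    before differentiating makes the components global smooth functions; the sum over i obeys the
    Leibniz rule because the [parti i] add up to 1. *)
Definition conn_term i m (X : tangent A m) (eta : Gamma Ed) : dual (E m) :=
  if s i is Some x then
    \sum_b X (coefi i eta b) *: dual_of (fun e : E m => tmap (p_triv x) m e 0 b) else 0.

Definition conn_sum N m (X : tangent A m) (eta : Gamma Ed) : dual (E m) :=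
  \sum_(i < N) conn_term i X eta.

Lemma tangent_vanish W m (X : tangent A m) (f : cinf A) :
  atlas_open A W -> W m -> (forall q, W q -> f q = 0) -> X f = 0.
Proof.
move=> oW Wm f0; have [c [psi [U [gc Um sup _]]]] := bump_exists hM oW Wm.
rewrite -(tangent_cst X 0).
apply: (tangent_local (U := W) X (psi := psi)); last exact: f0.
- by case: sup.
- exact: (gc_one gc).
- by move=> q nW; apply: (supported0 sup) => -[].
- exact: cinfP.
- exact: smooth_on_cst.
Qed.

(** Beyond i every coefficient contains [avoid N], which vanishes on the whole patch, so a
    derivation at a point of the patch kills it. *)
Lemma conn_sum_stable i x m (X : tangent A m) eta N : s i = Some x -> p_nbhs x m ->
  (i < N)%N -> conn_sum N X eta = conn_sum i.+1 X eta.
Proof.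
move=> si xm; elim: N => [//|N IH]; rewrite ltnS leq_eqVlt => /orP[/eqP <-//|iN].
rewrite /conn_sum big_ord_recr /= -/(conn_sum N X eta) IH// [X in _ + X](_ : _ = 0) ?addr0//.
rewrite /conn_term; case sN: (s N) => [y|//]; rewrite big1// => b _.
rewrite (@tangent_vanish _ m X _ (@p_open x) xm) ?scale0r// => q xq.
by rewrite /= sN /= (avoid_0 si xq iN) !mul0r.
Qed.

Definition index_at m : nat := xget 0%N [set i | exists x, s i = Some x /\ p_nbhs x m].

Lemma index_atP m : exists x, s (index_at m) = Some x /\ p_nbhs x m.
Proof.
by apply: (@xgetPex _ 0%N [set i | exists x, s i = Some x /\ p_nbhs x m]); exact: sE.
Qed.

(** The truncation depends on the point; by [conn_near] a single one serves on a whole patch, which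
    gives smoothness. *)
Definition conn m (X : tangent A m) (eta : Gamma Ed) : dual (E m) :=
  conn_sum (index_at m).+1 X eta.

Lemma conn_near i x m (X : tangent A m) eta : s i = Some x -> p_nbhs x m ->
  conn X eta = conn_sum i.+1 X eta.
Proof.
move=> si xm; have [y [sy ym]] := index_atP m.
rewrite /conn -(@conn_sum_stable _ _ _ X eta (maxn (index_at m) i).+1 sy ym) ?ltnS ?leq_maxl//.
by rewrite (@conn_sum_stable _ _ _ X eta (maxn (index_at m) i).+1 si xm)// ltnS leq_maxr.
Qed.

Lemma conn_leibniz m (X : tangent A m) f eta :
  conn X (fscale f eta) = f m *: conn X eta + X f *: eta m.
Proof.
have [x [sx xm]] := index_atP m.
rewrite /conn /conn_sum scaler_sumr.
have -> : eta m = \sum_(i < (index_at m).+1) parti i m *: eta m.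
  by rewrite -scaler_suml sum_parti (avoid_0 sx xm) ?ltnS// subr0 scale1r.
rewrite scaler_sumr -big_split /=; apply: eq_bigr => i _.
rewrite /conn_term /parti /bumpi; case si: (s i) => [y|]; last first.
  by rewrite /= mulr0 scale0r !scaler0 addr0.
apply: dual_ext => e; rewrite dual_addE !dual_scaleE !dual_sumE.
have Xc b : X (coefi i (fscale f eta) b) = f m * X (coefi i eta b) + coefi i eta b m * X f.
  rewrite -tangent_cinfM; congr (tangent_val X _); apply/funext => q.
  by rewrite /= si [X in _ * X](dual_scaleE (f q) (eta q)) /parti /bumpi /= si; ring.
have tE b : dual_of (fun e : E m => tmap (p_triv y) m e 0 b) e = tmap (p_triv y) m e 0 b.
  by rewrite dual_ofE// => u v w; rewrite linearP !mxE.
rewrite (eq_bigr (fun b => f m * (X (coefi i eta b) * tmap (p_triv y) m e 0 b) +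
   X f * (avoid i m * p_fun y m * (tmap (p_triv y) m e 0 b * eta m (tinv (p_triv y) m (de b)))))); last first.
  by move=> b _; rewrite dual_scaleE Xc tE /= si /parti /bumpi /= si; ring.
rewrite big_split -!mulr_sumr /=; congr (_ + _ * _).
  by congr (_ * _); apply: eq_bigr => b _; rewrite -tE.
have [tm|ntm] := pselect (tdom (p_triv y) m); last first.
  by rewrite (supported0 (p_sup y) ntm) !mulr0 !mul0r.
congr (_ * _); rewrite {2}(tinv_basis hE e (p_in y) tm) dual_sum.
by apply: eq_bigr => b _; rewrite dual_Z.
Qed.

Lemma conn_D m (X : tangent A m) eta eta' : conn X (eta + eta') = conn X eta + conn X eta'.
Proof.
rewrite /conn /conn_sum -[RHS]big_split; apply: eq_bigr => i _ /=.
rewrite /conn_term; case si: (s i) => [y|]; last by rewrite addr0.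
rewrite -[RHS]big_split; apply: eq_bigr => b _; rewrite -[RHS]scalerDl -tangent_cinfD.
by congr (tangent_val X _ *: _); apply/funext => q; rewrite /= si [X in _ * X](dual_addE (eta q)) mulrDr.
Qed.

Lemma conn_Xl m a (X Y : tangent A m) eta : conn (a *: X + Y) eta = a *: conn X eta + conn Y eta.
Proof.
rewrite /conn /conn_sum scaler_sumr -[RHS]big_split; apply: eq_bigr => i _ /=.
rewrite /conn_term; case si: (s i) => [y|]; last by rewrite scaler0 addr0.
rewrite scaler_sumr -[RHS]big_split; apply: eq_bigr => b _ /=.
by rewrite [Z in Z *: _](tangent_addE (a *: X) Y) [Z in (Z + _) *: _](tangent_scaleE X a) scalerDl scalerA.
Qed.

Lemma conn_smooth (X : Gamma TM) eta : smooth_section Ed (fun m => conn (X m) eta).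
Proof.
move=> t Ft a c Ac m tm cm.
have [x [sx xm]] := index_atP m.
set N := (index_at m).+1.
have sm : smooth_pt (A := A) (fun q => \sum_(i < N) conn_term i (X q) eta (tinv t q a)) m; last first.
  apply: (smooth_pt_local pmA (@p_open x) xm _ sm Ac cm) => q xq.
  by rewrite (conn_near (X q) eta sx xq) /conn_sum dual_sumE.
apply: smooth_pt_sum => i; rewrite /conn_term.
case si: (s i) => [y|]; last by apply: smooth_pt_cst.
rewrite (_ : (fun q => _) = fun q => \sum_b X q (coefi i eta b) * tmap (p_triv y) q (tinv t q a) 0 b); last first.
  apply/funext => q; rewrite dual_sumE; apply: eq_bigr => b _; rewrite dual_scaleE dual_ofE//.
  by move=> u v w; rewrite linearP !mxE.
apply: smooth_pt_sum => b.
have [_ [V [oV V0 tV]]] := p_sup y.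
have [ty|Vm] := tV m.
  apply: smooth_ptM; first exact: smoothW (cinfP (vf_app X (coefi i eta b))).
  move=> c' Ac' cm'; exact: (vb_compat hE Ft (p_in y) a b Ac' (conj tm ty) cm').
apply: (smooth_pt_local pmA (f := fun=> 0) oV Vm); last exact: smooth_pt_cst.
move=> q Vq; rewrite (tangent_vanish (X q) oV Vq) ?mul0r// => q' Vq'.
by rewrite /= si /parti /bumpi /= si V0// mulr0 mul0r.
Qed.

Definition connG (X : Gamma TM) eta : Gamma Ed := MkGamma (conn_smooth X eta).

Fact dull0_smooth (q1 q2 : Gamma Q) : smooth_section Q (fun m =>
  (lieG (bfst q1) (bfst q2) m, (connG (bfst q1) (bsnd q2) - connG (bfst q2) (bsnd q1)) m)).
Proof.
split; first exact: (gammaP (lieG (bfst q1) (bfst q2))).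
exact: (gammaP (connG (bfst q1) (bsnd q2) - connG (bfst q2) (bsnd q1))).
Qed.

(** The bracket with components [X, Y] and nabla_X eta - nabla_Y epsilon, where nabla is the
    connection on the dual of E. *)
Definition dull0 (q1 q2 : Gamma Q) : Gamma Q := MkGamma (dull0_smooth q1 q2).

Lemma conn_Z m (X : tangent A m) a eta : conn X (a *: eta) = a *: conn X eta.
Proof.
have := conn_leibniz X (cinf_cst a) eta.
by rewrite (tangent_cst X) scale0r addr0.
Qed.

Lemma dull0_is_dull : is_dull (side_anchor A F) dull0.
Proof.
split=> [a q1 q2 q|a q q1 q2|q1 q2 m|f1 f2 q1 q2 m].
- apply: gamma_eq => m; congr pair.
    have -> : bfst (a *: q1 + q2) = a *: bfst q1 + bfst q2 by exact: gamma_eq.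
    by rewrite lieDl lieZl.
  rewrite /= conn_Xl.
  have -> : bsnd (a *: q1 + q2) = a *: bsnd q1 + bsnd q2 by exact: gamma_eq.
  rewrite conn_D conn_Z !scaleN1r scalerBr opprD addrACA; congr (_ + _).
- apply: gamma_eq => m; congr pair.
    have -> : bfst (a *: q1 + q2) = a *: bfst q1 + bfst q2 by exact: gamma_eq.
    by rewrite lieDr lieZr.
  rewrite /= conn_Xl.
  have -> : bsnd (a *: q1 + q2) = a *: bsnd q1 + bsnd q2 by exact: gamma_eq.
  rewrite conn_D conn_Z !scaleN1r scalerBr opprD addrACA; congr (_ + _).
- by [].
have fl f (q : Gamma Q) : bfst (fscale f q) = fscale f (bfst q) by exact: gamma_eq.
have fr f (q : Gamma Q) : bsnd (fscale f q) = fscale f (bsnd q) by exact: gamma_eq.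
have cX (f : cinf A) (X : Gamma TM) eta : conn (fscale f X m) eta = f m *: conn (X m) eta.
  by have := conn_Xl (f m) (X m) 0 eta; rewrite addr0 => ->;
     have /eqP := conn_Xl 1 (0 : tangent A m) 0 eta; rewrite scaler0 addr0 scale1r -subr_eq subrr => /eqP <-; rewrite addr0.
congr pair.
  rewrite [LHS](_ : _ = lieG (fscale f1 (bfst q1)) (fscale f2 (bfst q2)) m); last by rewrite -!fl.
  rewrite lie_leibniz lie_leibnizl scalerBr !scalerA [f2 m * f1 m]mulrC addrAC.
  by [].
rewrite [LHS](_ : _ = conn (fscale f1 (bfst q1) m) (fscale f2 (bsnd q2)) - conn (fscale f2 (bfst q2) m) (fscale f1 (bsnd q1))); last first.
  by rewrite -!fl -!fr /= scaleN1r.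
rewrite [RHS]/= !scaleN1r !cX !conn_leibniz !scalerDr !scalerA opprD [f2 m * f1 m]mulrC.
by rewrite scalerN addrA; congr (_ - _); rewrite [LHS]addrAC.
Qed.

End partition.

Lemma dull_exists : exists D : Gamma Q -> Gamma Q -> Gamma Q, is_dull (side_anchor A F) D.
Proof. by have [s sE] := patches; exists (dull0 sE); exact: dull0_is_dull. Qed.

End dull_exists.

(** * Horizontal lifts and core sections *)

Section courant_pairing.
Context {R : realType} {T : Type} {n : nat} {A : atlas R T n}.
Local Notation P := (pontryagin_bundle A).
Variable p : T.
Implicit Types (x y z : P p) (u : tangent A p).

Lemma P1D x y f : (x + y).1 f = x.1 f + y.1 f. Proof. exact: tangent_addE. Qed.
Lemma P1Z a x f : (a *: x).1 f = a * x.1 f. Proof. exact: tangent_scaleE. Qed.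
Lemma P1N x f : (- x).1 f = - x.1 f. Proof. exact: tangent_oppE. Qed.
Lemma P2D x y u : (x + y).2 u = x.2 u + y.2 u. Proof. exact: dual_addE. Qed.
Lemma P2Z a x u : (a *: x).2 u = a * x.2 u. Proof. exact: dual_scaleE. Qed.
Lemma P2N x u : (- x).2 u = - x.2 u. Proof. exact: dual_oppE. Qed.
Lemma cpC x y : courant_pairing x y = courant_pairing y x.
Proof. exact: addrC. Qed.

Lemma cpDl x y z : courant_pairing (x + y) z = courant_pairing x z + courant_pairing y z.
Proof. by rewrite /courant_pairing P2D dual_D addrACA. Qed.

Lemma cpDr x y z : courant_pairing z (x + y) = courant_pairing z x + courant_pairing z y.
Proof. by rewrite !(cpC z) cpDl. Qed.

Lemma cpZl a x z : courant_pairing (a *: x) z = a * courant_pairing x z.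
Proof. by rewrite /courant_pairing P2Z dual_Z mulrDr. Qed.

Lemma cpZr a x z : courant_pairing z (a *: x) = a * courant_pairing z x.
Proof. by rewrite !(cpC z) cpZl. Qed.

Lemma cpNl x z : courant_pairing (- x) z = - courant_pairing x z.
Proof. by rewrite -scaleN1r cpZl mulN1r. Qed.

Lemma cp0l z : courant_pairing 0 z = 0.
Proof. by rewrite -(scale0r (0 : P p)) cpZl mul0r. Qed.

Lemma cp_inl x u : courant_pairing x (u, 0) = x.2 u. Proof. exact: addr0. Qed.

Lemma cp_inr x (w : dual (tangent A p)) : courant_pairing x (0, w) = w x.1.
Proof. by rewrite /courant_pairing [x.2 _]dual_0 add0r. Qed.

Lemma cp_nondegenerate x y :
  (forall z, courant_pairing x z = courant_pairing y z) -> x = y.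
Proof.
move=> xy; have H1 : x.1 = y.1.
  apply: tangent_ext => f _; have := xy (0, differential A f p).
  by rewrite !cp_inr !differentialE.
have H2 : x.2 = y.2.
  apply: dual_ext => u; have := xy (u, 0).
  by rewrite !cp_inl.
by case: x y H1 H2 {xy} => [x1 x2] [y1 y2] /= -> ->.
Qed.

End courant_pairing.

Section pairing_smooth.
Context {R : realType} {T : Type} {n : nat} {A : atlas R T n}.
Local Notation P := (pontryagin_bundle A).

Fact courant_pairing_smooth (x y : Gamma P) :
  smooth A (fun p => courant_pairing (x p) (y p)).
Proof.
apply: smooth_onD; first exact: (gammaP (bsnd x) _ (gammaP (bfst y))).
exact: (gammaP (bsnd y) _ (gammaP (bfst x))).
Qed.

Definition cpf (x y : Gamma P) : cinf A := Cinf (courant_pairing_smooth x y).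

End pairing_smooth.

Section lifts.
Context {R : realType} {M : Type} {n k : nat} {E : M -> lmodType R}.
Context {A : atlas R M n} {F : set (triv E k)}.
Hypothesis hM : is_manifold A.
Hypothesis hE : is_vector_bundle A F.
Let pmA := manifold_premanifold hM.
Let pmT := total_premanifold pmA hE.
Local Notation TA := (total_atlas A F).
Local Notation P := (pontryagin_bundle TA).
Local Notation pt m a := (existT (fun m0 => GRing.Lmodule.sort (E m0)) m a).
Local Notation TM := (tangent_bundle A).
Local Notation Ed := (dual_bundle A F).
Local Notation Es := (vbundle A F).
Local Notation Q := (side_bundle A F).
Local Notation Cr := (core_bundle A F).
Local Notation ell := (lin hM hE).
Local Notation pull := (@pull R M n k E A F).
Local Notation bp u := (tangent_map A (@bproj _ _ E) u).
Local Notation sc := (@side_core_pairing _ _ _ _ _ A F _).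
Local Notation cp := courant_pairing.

Lemma bsnd_fscale (B C : bundle A) f (s : Gamma (bsum B C)) : bsnd (fscale f s) = fscale f (bsnd s).
Proof. by apply: gamma_eq. Qed.

Lemma pairing_fscale f (eta : Gamma Ed) (e : Gamma Es) :
  pairing hM hE (fscale f eta) e = cinf_mul f (pairing hM hE eta e).
Proof. by apply: cinf_eq => m; exact: (dual_scaleE (f m) (eta m)). Qed.

Lemma scDl m (x y : Q m) (b : Cr m) : sc (x + y) b = sc x b + sc y b.
Proof. by rewrite /side_core_pairing dual_D [(x + y).2 _]dual_addE addrACA. Qed.

Lemma scZl m c (x : Q m) (b : Cr m) : sc (c *: x) b = c * sc x b.
Proof. by rewrite /side_core_pairing dual_Z [(c *: x).2 _]dual_scaleE mulrDr. Qed.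

Lemma scDr m (x : Q m) (b b' : Cr m) : sc x (b + b') = sc x b + sc x b'.
Proof. by rewrite /side_core_pairing dual_D [(b + b').2 _]dual_addE addrACA. Qed.

Lemma scZr m c (x : Q m) (b : Cr m) : sc x (c *: b) = c * sc x b.
Proof. by rewrite /side_core_pairing dual_Z [(c *: b).2 _]dual_scaleE mulrDr. Qed.

Lemma scNl m (x : Q m) (b : Cr m) : sc (- x) b = - sc x b.
Proof. by rewrite -scaleN1r scZl mulN1r. Qed.

Lemma scNr m (x : Q m) (b : Cr m) : sc x (- b) = - sc x b.
Proof. by rewrite -scaleN1r scZr mulN1r. Qed.

Lemma sc_fst m (X : tangent A m) (b : Cr m) : sc (X, 0) b = b.2 X.
Proof. exact: add0r. Qed.

Lemma sc_snd m (eta : dual (E m)) (b : Cr m) : sc (0, eta) b = eta b.1.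
Proof. by rewrite /side_core_pairing [b.2 _]dual_0 addr0. Qed.

Lemma sc_inl m (x : Q m) (e : E m) : sc x (e, 0) = x.2 e.
Proof. exact: addr0. Qed.

Lemma sc_inr m (x : Q m) (w : dual (tangent A m)) : sc x (0, w) = w x.1.
Proof. by rewrite /side_core_pairing [x.2 _]dual_0 add0r. Qed.

Lemma sc_nondegenerate m (b b' : Cr m) : (forall x : Q m, sc x b = sc x b') -> b = b'.
Proof.
move=> bb; have H1 : b.1 = b'.1.
  apply: (fibre_ext hM hE) => eta; have := bb (0, eta).
  by rewrite !sc_snd.
have H2 : b.2 = b'.2.
  apply: dual_ext => u; have := bb (u, 0).
  by rewrite !sc_fst.
by case: b b' H1 H2 {bb} => [x1 x2] [y1 y2] /= -> ->.
Qed.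

(** By finite rank the core is the whole dual of the side bundle. Unknown core elements are produced
    from here on by prescribing their pairings. *)
Lemma core_represents m (phi : dual (Q m)) : exists b : Cr m, forall x : Q m, sc x b = phi x.
Proof.
have phiL : forall c u v, phi (0, c *: u + v) = c * phi (0, u) + phi (0, v).
  move=> c u v; rewrite -dual_lin; congr (phi _).
  by congr pair; rewrite /= scaler0 addr0.
have [b1 b1E] := fibre_reflexive hM hE phiL.
have phiL2 : forall c u v, phi (c *: u + v, 0) = c * phi (u, 0) + phi (v, 0).
  move=> c u v; rewrite -dual_lin; congr (phi _).
  by congr pair; rewrite /= scaler0 addr0.
exists (b1, dual_of (fun X => phi (X, 0))) => -[X eta].
rewrite /side_core_pairing /= -b1E dual_ofE// -dual_D; congr (phi _).
by congr pair; rewrite /= ?addr0 ?add0r.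
Qed.

Lemma side_section_through m (x : Q m) : exists s : Gamma Q, s m = x.
Proof.
case: x => X eta; have [s <-] := vector_field_through hM hE X.
have [t <-] := cosection_through hM hE eta.
exists (binl _ s + binr _ t); congr pair; [exact: addr0|exact: add0r].
Qed.

Lemma core_section_exists m (b : Cr m) : exists s : Gamma Cr, s m = b.
Proof.
case: b => e w; have [s <-] := section_through hM hE e.
have [t <-] := covector_through hM hE w.
exists (binl _ s + binr _ t); congr pair; [exact: addr0|exact: add0r].
Qed.

Lemma determined_side m : determined Q m.
Proof.
exact: (bsum_determined (@determined_TM _ _ _ _ _ _ _ hM hE m)
  (@determined_Ed _ _ _ _ _ _ _ hM hE m)).
Qed.

Lemma P_ext m (a : E m) (x y : P (pt m a)) :
  (forall f, x.1 (pull f) = y.1 (pull f)) -> (forall eta, x.1 (ell eta) = y.1 (ell eta)) ->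
  (forall u, x.2 u = y.2 u) -> x = y.
Proof.
move=> h1 h2 h3; have H1 : x.1 = y.1 by exact: total_ext h1 h2.
have H2 : x.2 = y.2 by exact: dual_ext.
by case: x y H1 H2 {h1 h2 h3} => [x1 x2] [y1 y2] /= -> ->.
Qed.

Definition up m (a : E m) (b : Cr m) : P (pt m a) :=
  (vertical A F a b.1, dual_of (fun v : tangent TA (pt m a) => b.2 (bp v))).

Lemma bp_lin e c (u v : tangent TA e) : bp (c *: u + v) = c *: bp u + bp v.
Proof.
apply: tangent_ext => f sf; have E1 w := tangent_bprojE w (Cinf sf).
by rewrite [LHS]E1 !tangent_addE !tangent_scaleE; congr (_ * _ + _); symmetry; exact: E1.
Qed.

Lemma up_pull m (a : E m) b f : (up a b).1 (pull f) = 0.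
Proof. exact: (vertical_pull hM hE). Qed.

Lemma up_lin m (a : E m) (b : Cr m) eta : (up a b).1 (ell eta) = eta m b.1.
Proof. exact: vertical_lin. Qed.

Lemma up2E m (a : E m) (b : Cr m) u : (up a b).2 u = b.2 (bp u).
Proof. by rewrite /up /= dual_ofE// => c v w; rewrite bp_lin dual_lin. Qed.

Lemma up_linear m (a : E m) c b b' : up a (c *: b + b') = c *: up a b + up a b'.
Proof.
apply: P_ext => [f|eta|u].
- by rewrite P1D P1Z !up_pull mulr0 addr0.
- by rewrite P1D P1Z !up_lin dual_lin.
- rewrite (P2D (c *: up a b)) (P2Z c (up a b)) (up2E (c *: b + b')) (up2E b) (up2E b').
  exact: (dual_addE (c *: b.2)).
Qed.

Lemma up0 m (a : E m) : up a 0 = 0.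
Proof.
have /eqP := up_linear a 1 0 0; rewrite scaler0 addr0 scale1r.
by rewrite -subr_eq subrr => /eqP.
Qed.

Lemma upD m (a : E m) b b' : up a (b + b') = up a b + up a b'.
Proof. by have := up_linear a 1 b b'; rewrite !scale1r. Qed.

Lemma upZ m (a : E m) c b : up a (c *: b) = c *: up a b.
Proof. by have := up_linear a c b 0; rewrite up0 !addr0. Qed.

Lemma upN m (a : E m) b : up a (- b) = - up a b.
Proof. by rewrite -scaleN1r upZ scaleN1r. Qed.

Lemma cp_up_up m (a : E m) b b' : cp (up a b) (up a b') = 0.
Proof.
by rewrite /courant_pairing !up2E !(vertical_proj hM hE) !dual_0 addr0.
Qed.

Section dull.
Variable D : Gamma Q -> Gamma Q -> Gamma Q.
Hypothesis dD : is_dull (side_anchor A F) D.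
Implicit Types nu : Gamma Q.

(* The horizontal lift of [nu] at [a], characterised without choosing a section
   of E through [a]. *)
Definition is_lift nu m (a : E m) (x : P (pt m a)) : Prop := [/\
  forall f : cinf A, x.1 (pull f) = (nu m).1 f,
  forall eta : Gamma Ed, x.1 (ell eta) = (D nu (binr _ eta) m).2 a &
  forall (u : tangent TA (pt m a)) (Y : Gamma TM), Y m = bp u ->
    x.2 u = u (ell (bsnd nu)) + (D nu (binl _ Y) m).2 a].

Lemma is_lift_unique nu m (a : E m) (x y : P (pt m a)) : is_lift nu x -> is_lift nu y -> x = y.
Proof.
move=> [x1 x2 x3] [y1 y2 y3]; apply: P_ext => [f|eta|u]; rewrite ?x1 ?y1 ?x2 ?y2//.
have [Y Ym] := vector_field_through hM hE (bp u).
by rewrite (x3 u Y Ym) (y3 u Y Ym).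
Qed.

(** The choice in [dorfman] has a witness: the derivative of the pairing minus the bracket term is
    tensorial in the second argument, so it is the pairing with some core element. *)
Lemma dorfmanE nu (e : Gamma Es) m (nu2 : Gamma Q) :
  (nu m).1 (pairing hM hE (bsnd nu2) e) =
  (D nu nu2 m).2 (e m) + sc (nu2 m) (dorfman D nu (fun x => (e x, 0)) m).
Proof.
have pE nu' : (fun x => sc (nu' x) ((e x, 0) : Cr x)) = pairing hM hE (bsnd nu') e.
  by apply/funext => x; exact: sc_inl.
have sE nu' : sc (D nu nu' m) ((e m, 0) : Cr m) = (D nu nu' m).2 (e m).
  exact: sc_inl.
suff [b bE] : exists b : Cr m, forall nu', (nu m).1 (pairing hM hE (bsnd nu') e) =
    (D nu nu' m).2 (e m) + sc (nu' m) b.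
  pose S : set (Cr m) := [set b | forall nu', (nu m).1 (fun x => sc (nu' x) ((e x, 0) : Cr x)) =
    sc (D nu nu' m) ((e m, 0) : Cr m) + sc (nu' m) b].
  have : S (dorfman D nu (fun x => (e x, 0)) m).
    by apply: (@xgetPex _ 0 S); exists b => nu'; rewrite pE sE.
  by move=> /(_ nu2); rewrite pE sE.
pose W nu' : R^o := (nu m).1 (pairing hM hE (bsnd nu') e) - (D nu nu' m).2 (e m).
have tW : tensorial m W.
  split=> [s t|f s]; rewrite /W.
    have -> : pairing hM hE (bsnd (s + t)) e = cinf_add (pairing hM hE (bsnd s) e) (pairing hM hE (bsnd t) e).
      exact: cinf_eq.
    by rewrite tangent_cinfD (dullDr dD) [X in _ - X](dual_addE (D nu s m).2 (D nu t m).2); ring.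
  rewrite bsnd_fscale pairing_fscale.
  rewrite tangent_cinfM (dull_fr dD) [X in _ - X](dual_addE (f m *: (D nu s m).2) (side_anchor A F m (nu m) f *: (s m).2)).
  by rewrite !dual_scaleE /GRing.scale /= /side_anchor_fun; ring.
have [phi phiE] := tensorial_dual (@determined_side m) (@side_section_through m) tW.
have [b bE] := core_represents phi.
by exists b => nu'; rewrite bE phiE /W addrC subrK.
Qed.

Lemma horizontal_lift_is_lift nu (e : Gamma Es) m : is_lift nu (horizontal_lift D nu e m).
Proof.
have dE := dorfmanE nu e; set b := dorfman D nu (fun x => (e x, 0)) m.
have hE1 : horizontal_lift D nu e m = (tangent_map TA (fun x => pt x (e x)) (nu m).1,
  differential TA (ell (bsnd nu)) (pt m (e m))) - up (e m) b by [].
rewrite hE1; split=> [f|eta|u Y Ym].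
- rewrite P1D P1N up_pull subr0 [LHS](tangent_alongE hM hE).
  by congr (tangent_val _ _).
- rewrite P1D P1N up_lin [X in X - _](tangent_alongE hM hE).
  have := dE m (binr _ eta).
  rewrite [sc _ _]sc_snd -/b => H; apply/eqP; rewrite subr_eq -H; apply/eqP.
  by congr (tangent_val _ _).
rewrite P2D P2N up2E [X in X - _]differentialE; congr (_ + _).
have := dE m (binl _ Y); rewrite [sc _ _]sc_fst -/b Ym.
have -> : pairing hM hE (bsnd (binl _ Y)) e = cinf_cst 0 by exact: cinf_eq.
by rewrite tangent_cinfc => /eqP; rewrite eq_sym addr_eq0 => /eqP ->.
Qed.

(** The lift at an arbitrary point of E; [horizontal_liftE] identifies it with the lift along a
    section. *)
Definition hl nu m (a : E m) : P (pt m a) := xget 0 [set x | is_lift nu x].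

Lemma hlP nu m (a : E m) : is_lift nu (hl nu a).
Proof.
apply: (@xgetPex _ 0 [set x | is_lift nu x]); have [e <-] := section_through hM hE a.
by exists (horizontal_lift D nu e m); exact: horizontal_lift_is_lift.
Qed.

Lemma horizontal_liftE nu (e : Gamma Es) m : horizontal_lift D nu e m = hl nu (e m).
Proof. by apply: is_lift_unique (hlP _ _); exact: horizontal_lift_is_lift. Qed.

Lemma hl_pull nu m (a : E m) f : (hl nu a).1 (pull f) = (nu m).1 f.
Proof. by case: (hlP nu a). Qed.

Lemma hl_lin nu m (a : E m) eta : (hl nu a).1 (ell eta) = (D nu (binr _ eta) m).2 a.
Proof. by case: (hlP nu a). Qed.

Lemma hl2E nu m (a : E m) (u : tangent TA (pt m a)) (Y : Gamma TM) : Y m = bp u ->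
  (hl nu a).2 u = u (ell (bsnd nu)) + (D nu (binl _ Y) m).2 a.
Proof. by case: (hlP nu a) => _ _; exact. Qed.

Lemma hl_proj nu m (a : E m) : bp (hl nu a).1 = (nu m).1.
Proof.
apply: tangent_ext => f sf.
by rewrite (tangent_bprojE (hl nu a).1 (Cinf sf)) hl_pull.
Qed.

Lemma d2_Dl nu nu' s m a : (D (nu + nu') s m).2 a = (D nu s m).2 a + (D nu' s m).2 a.
Proof. by rewrite (dullDl dD); exact: (dual_addE (D nu s m).2). Qed.

Lemma d2_Dr nu s t m a : (D nu (s + t) m).2 a = (D nu s m).2 a + (D nu t m).2 a.
Proof. by rewrite (dullDr dD); exact: (dual_addE (D nu s m).2). Qed.

Lemma d2_fl f nu s m a :
  (D (fscale f nu) s m).2 a = f m * (D nu s m).2 a - (s m).1 f * (nu m).2 a.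
Proof.
rewrite (dull_fl dD) -scaleNr -mulNr.
exact: (dual_lin (f m *: (D nu s m).2) 1 0 a) || exact: erefl.
Qed.

Lemma d2_fr f nu s m a :
  (D nu (fscale f s) m).2 a = f m * (D nu s m).2 a + (nu m).1 f * (s m).2 a.
Proof. by rewrite (dull_fr dD); exact: erefl. Qed.

Lemma hlD nu nu' m (a : E m) : hl (nu + nu') a = hl nu a + hl nu' a.
Proof.
apply: P_ext => [f|eta|u].
- by rewrite [RHS]P1D !hl_pull; exact: tangent_addE.
- by rewrite [RHS]P1D !hl_lin d2_Dl.
have [Y Ym] := vector_field_through hM hE (bp u).
rewrite [RHS]P2D !(hl2E _ Ym) d2_Dl.
have -> : ell (bsnd (nu + nu')) = cinf_add (ell (bsnd nu)) (ell (bsnd nu')) by exact: cinf_eq.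
by rewrite tangent_cinfD; ring.
Qed.

(** On a tangent vector u, the Leibniz rule in the first slot of D contributes minus u(f) times the
    value at [a] of the linear function of [nu]; differentiating the linear function of f nu
    contributes the opposite term. *)
Lemma hl_fscale f nu m (a : E m) : hl (fscale f nu) a = f m *: hl nu a.
Proof.
apply: P_ext => [g|eta|u].
- by rewrite [RHS]P1Z !hl_pull; exact: tangent_scaleE.
- rewrite [RHS]P1Z !hl_lin d2_fl.
  by rewrite [X in X * (nu m).2 a](tangent_zeroE m) mul0r subr0.
have [Y Ym] := vector_field_through hM hE (bp u).
rewrite [RHS]P2Z !(hl2E _ Ym) d2_fl.
rewrite bsnd_fscale lin_fscale.
have YE : (binl Ed Y m).1 f = u (pull f) by rewrite -tangent_bprojE -Ym.
by rewrite tangent_cinfM YE linE; have -> : pull f (pt m a) = f m by []; have -> : bsnd nu m = (nu m).2 by []; ring.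
Qed.

Lemma hl_eq nu nu' m (a : E m) : nu m = nu' m -> hl nu a = hl nu' a.
Proof.
apply: (@determined_side m (P (pt m a)) (fun nu => hl nu a)).
by split=> [s t|f s]; [exact: hlD|exact: hl_fscale].
Qed.

Lemma cp_hl_up nu m (a : E m) b : cp (hl nu a) (up a b) = sc (nu m) b.
Proof.
rewrite /courant_pairing up2E hl_proj /side_core_pairing; congr (_ + _).
rewrite (@hl2E nu m a _ 0); last by rewrite (vertical_proj hM hE).
have -> : binl _ (0 : Gamma TM) = 0 :> Gamma Q by exact: gamma_eq.
by rewrite (dull0r dD) dual_zeroE addr0 up_lin.
Qed.

(** A dull bracket need not be skew, and lifts pair to its symmetric part; orthogonality of J
    thereby becomes skewness of S. *)
Lemma cp_hl_hl nu nu' m (a : E m) : cp (hl nu a) (hl nu' a) = (D nu nu' m + D nu' nu m).2 a.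
Proof.
rewrite /courant_pairing (@hl2E nu m a _ (bfst nu')) ?hl_proj// (@hl2E nu' m a _ (bfst nu)) ?hl_proj//.
rewrite !hl_lin [RHS](dual_addE (D nu nu' m).2).
have E1 s t : (D s t m).2 a = (D s (binl _ (bfst t)) m).2 a + (D s (binr _ (bsnd t)) m).2 a.
  by rewrite {1}(bsum_split t) d2_Dr.
by rewrite (E1 nu nu') (E1 nu' nu); ring.
Qed.

Definition side m (a : E m) (x : P (pt m a)) : Q m := side_proj x.

Lemma side_linear m (a : E m) c (x y : P (pt m a)) : side (c *: x + y) = c *: side x + side y.
Proof.
rewrite /side /side_proj; congr pair; first exact: (bp_lin c x.1 y.1).
apply: dual_ext => b; rewrite [RHS](dual_addE (c *: (side x).2) (side y).2) dual_scaleE.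
have rE (z : P (pt m a)) : rproj z.2 b = z.2 (vertical A F a b).
  by rewrite dual_ofE// => d u v; rewrite (vertical_lin_b hM hE) dual_lin.
by rewrite !rE P2D P2Z.
Qed.

Lemma side2E m (a : E m) (x : P (pt m a)) b : (side x).2 b = x.2 (vertical A F a b).
Proof.
by rewrite [LHS]dual_ofE// => d u v; rewrite (vertical_lin_b hM hE) dual_lin.
Qed.

(** With [sc_nondegeneratel] this reads the side of an element off its pairings with the core,
    without unfolding tangent maps. *)
Lemma cp_side m (a : E m) (x : P (pt m a)) b : cp x (up a b) = sc (side x) b.
Proof. by rewrite /courant_pairing up2E /side_core_pairing side2E. Qed.

Lemma sc_nondegeneratel m (x y : Q m) : (forall b : Cr m, sc x b = sc y b) -> x = y.
Proof.
move=> xy; have H1 : x.1 = y.1.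
  apply: tangent_ext => f _; have := xy (0, differential A f m).
  by rewrite !sc_inr !differentialE.
have H2 : x.2 = y.2.
  by apply: dual_ext => e; have := xy (e, 0); rewrite !sc_inl.
by case: x y H1 H2 {xy} => [x1 x2] [y1 y2] /= -> ->.
Qed.

Lemma side_hl nu m (a : E m) : side (hl nu a) = nu m.
Proof. by apply: sc_nondegeneratel => b; rewrite -cp_side cp_hl_up. Qed.

Lemma side_up m (a : E m) b : side (up a b) = 0.
Proof.
apply: sc_nondegeneratel => b'; rewrite -cp_side cp_up_up.
by rewrite -(scale0r (0 : Q m)) scZl mul0r.
Qed.

Lemma vertical_kernel m (a : E m) (u : tangent TA (pt m a)) : bp u = 0 ->
  exists b, u = vertical A F a b.
Proof.
move=> u0; have u0f f : u (pull f) = 0 by rewrite -tangent_bprojE u0; exact: tangent_zeroE.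
have tW : @tensorial _ _ _ _ Ed m R^o (fun eta => u (ell eta)).
  split=> [s t|f s]; first by rewrite lin_add tangent_cinfD.
  by rewrite lin_fscale tangent_cinfM u0f mulr0 addr0.
have [phi phiE] := tensorial_dual (@determined_Ed _ _ _ _ _ _ _ hM hE m) (@cosection_through _ _ _ _ _ _ _ hM hE m) tW.
have [b bE] := fibre_reflexive hM hE (dual_lin phi).
exists b; apply: (@total_ext _ _ _ _ _ _ _ hM hE) => [f|eta].
  by rewrite u0f (vertical_pull hM hE).
by rewrite (vertical_lin hM hE) -bE phiE.
Qed.

(** Pairing with the core gives z side 0. Then lifts of sections of the dual of E show that its
    tangent part, already vertical, is 0, and lifts of vector fields do the same for its covector
    part. *)
Lemma P_zero m (a : E m) (z : P (pt m a)) :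
  (forall b, cp z (up a b) = 0) -> (forall nu, cp z (hl nu a) = 0) -> z = 0.
Proof.
move=> zu zh.
have s0 : side z = 0.
  by apply: sc_nondegeneratel => b; rewrite -cp_side zu -(scale0r (0 : Q m)) scZl mul0r.
have zv b : z.2 (vertical A F a b) = 0 by rewrite -side2E s0.
have [b bE] := vertical_kernel (congr1 fst s0 : bp z.1 = 0).
have b0 : b = 0.
  apply: (fibre_ext hM hE) => eta; have [s <-] := cosection_through hM hE eta.
  have [b' b'E] : exists b', (hl (binr _ s) a).1 = vertical A F a b'.
    by apply: vertical_kernel; rewrite hl_proj.
  have := zh (binr _ s); rewrite /courant_pairing b'E zv add0r bE.
  rewrite (@hl2E _ m a _ 0); last by rewrite (vertical_proj hM hE).
  have -> : binl _ (0 : Gamma TM) = 0 :> Gamma Q by exact: gamma_eq.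
  rewrite (dull0r dD) [X in _ + X]dual_zeroE addr0 dual_0 => <-.
  by rewrite (_ : bsnd (binr TM s) = s) ?(vertical_lin hM hE)//; exact: gamma_eq.
have z1 : z.1 = 0.
  by rewrite bE b0; exact: (congr1 fst (up0 a)).
have z2 : z.2 = 0.
  apply: dual_ext => u; have [Y Ym] := vector_field_through hM hE (bp u).
  have [b' b'E] : exists b', u - (hl (binl _ Y) a).1 = vertical A F a b'.
    apply: vertical_kernel; have := bp_lin (-1) (hl (binl _ Y) a).1 u.
    rewrite scaleN1r addrC => ->; rewrite hl_proj scaleN1r -Ym; exact: addNr.
  have := zv b'; rewrite -b'E dual_B => /eqP; rewrite subr_eq0 => /eqP ->.
  have := zh (binl _ Y); rewrite /courant_pairing z1 [X in _ + X]dual_0 addr0 => ->.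
  by rewrite dual_zeroE.
by case: z z1 z2 {zu zh s0 zv bE} => [z1 z2] /= -> ->.
Qed.

(** After a lift with the same side is subtracted, pairing with lifts is a functional on the side
    bundle. The core element representing it accounts for the whole remainder, by [P_zero]. *)
Lemma P_decomposition m (a : E m) (x : P (pt m a)) nu : nu m = side x ->
  exists b, x = hl nu a + up a b.
Proof.
move=> nux; pose y := x - hl nu a.
have tW : @tensorial _ _ _ _ Q m R^o (fun nu => cp y (hl nu a)).
  by split=> [s t|f s]; rewrite ?hlD ?hl_fscale ?cpDr ?cpZr.
have [phi phiE] := tensorial_dual (@determined_side m) (@side_section_through m) tW.
have [b bE] := core_represents phi.
exists b; apply/eqP; rewrite addrC -subr_eq -/y -subr_eq0; apply/eqP.
apply: P_zero => [b'|nu'].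
  by rewrite cpDl cpNl cp_up_up subr0 /y cpDl cpNl cp_side cp_hl_up nux subrr.
by rewrite cpDl cpNl (cpC (up a b)) cp_hl_up bE phiE subrr.
Qed.

Lemma up_inj m (a : E m) b b' : up a b = up a b' -> b = b'.
Proof.
move=> bb'; apply: sc_nondegenerate => x; have [nu <-] := side_section_through x.
by rewrite -!(cp_hl_up _ a) bb'.
Qed.

Lemma proj_expansion m0 c t U chi (ld : local_data (A := A) (F := F) m0 c t U chi)
    m (a : E m) (u : tangent TA (pt m a)) : U m ->
  bp u = (\sum_i u (pull (xfun hM ld i)) *: vframe hM ld i : Gamma TM) m.
Proof.
move=> Um; rewrite gamma_sumE [LHS](vframe_expansion hM ld _ Um).
by apply: eq_bigr => i _; rewrite tangent_bprojE.
Qed.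

Definition hlS nu e : P e := let: existT m a := e in hl nu a.

Lemma hlS_smooth nu : smooth_section P (hlS nu).
Proof.
split.
  apply: (total_vector_smooth hM hE) => [f|eta].
    rewrite (_ : (fun e => _) = pull (vf_app (bfst nu) f)); first exact: cinfP.
    by apply/funext => -[m a]; exact: hl_pull.
  rewrite (_ : (fun e => _) = ell (bsnd (D nu (binr _ eta)))); first exact: cinfP.
  by apply/funext => -[m a]; exact: hl_lin.
move=> V sV; apply/smoothP => -[m a].
have [c [t [U [chi ld]]]] := local_data_exists hM hE m.
pose VV := MkGamma sV.
pose r e := vf_app VV (ell (bsnd nu)) e + \sum_i vf_app VV (pull (xfun hM ld i)) e *
  ell (bsnd (D nu (binl _ (vframe hM ld i)))) e.
apply: (smooth_pt_local pmT (f := r) (p := pt m a) (total_open pmA hE (gc_open (ld_base ld))) (ld_mem ld)); last first.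
  apply: smooth_ptD; first exact: smoothW (cinfP _).
  apply: smooth_pt_sum => i; apply: smooth_ptM; apply: smoothW; exact: cinfP.
move=> [q b] Uq; apply: esym; rewrite [LHS](hl2E nu (esym (proj_expansion ld (V (pt q b)) Uq))); congr (_ + _).
have tW : @tensorial _ _ _ _ TM q R^o (fun Y => (D nu (binl _ Y) q).2 b).
  split=> [s s'|f s].
    by rewrite -d2_Dr; congr ((D nu _ q).2 b); apply: gamma_eq => p; congr pair; rewrite /= addr0.
  rewrite (_ : binl _ (fscale f s) = fscale f (binl _ s)).
    rewrite d2_fr (_ : (binl Ed s q).2 b = 0); last exact: dual_zeroE.
    by rewrite mulr0 addr0.
  by apply: gamma_eq => p; congr pair; rewrite /= scaler0.
rewrite (tensorial_sum _ _ tW); apply: eq_bigr => i _.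
case: tW => _ tWZ.
exact: (tWZ (cinf_cst (V (pt q b) (pull (xfun hM ld i)))) (vframe hM ld i)).
Qed.

Definition hlG nu : Gamma P := MkGamma (hlS_smooth nu).

End dull.

Definition upS (tau : Gamma Cr) e : P e := let: existT m a := e in up a (tau m).

Lemma upS_smooth tau : smooth_section P (upS tau).
Proof.
split.
  apply: (total_vector_smooth hM hE) => [f|eta].
    rewrite (_ : (fun e => _) = cinf_cst (A := TA) 0); first exact: cinfP.
    by apply/funext => -[m a]; exact: up_pull.
  rewrite (_ : (fun e => _) = pull (pairing hM hE eta (bfst tau))); first exact: cinfP.
  by apply/funext => -[m a]; exact: up_lin.
move=> V sV; apply/smoothP => -[m a].
have [c [t [U [chi ld]]]] := local_data_exists hM hE m.
pose VV := MkGamma sV.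
pose r e := \sum_i vf_app VV (pull (xfun hM ld i)) e * pull (cv_app (bsnd tau) (vframe hM ld i)) e.
apply: (smooth_pt_local pmT (f := r) (p := pt m a) (total_open pmA hE (gc_open (ld_base ld))) (ld_mem ld)); last first.
  apply: smooth_pt_sum => i; apply: smooth_ptM; apply: smoothW; exact: cinfP.
move=> [q b] Uq; apply: esym; rewrite [LHS]up2E (proj_expansion ld (V (pt q b)) Uq) gamma_sumE dual_sum.
by apply: eq_bigr => i _; rewrite [LHS]dual_Z.
Qed.

Definition upG tau : Gamma P := MkGamma (upS_smooth tau).

Section frame.
Variable D : Gamma Q -> Gamma Q -> Gamma Q.
Hypothesis dD : is_dull (side_anchor A F) D.
Local Notation hl := (hl D).
Local Notation hlG := (hlG dD).

Section local.
Variables (m0 : M) (c : chart R M n) (t : triv E k) (U : set M) (chi : M -> R).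
Hypothesis ld : local_data (A := A) (F := F) m0 c t U chi.

Definition side_frame (i : 'I_n + 'I_k) : Gamma Q :=
  match i with inl i => binl _ (vframe hM ld i) | inr b => binr _ (coframe hM hE ld b) end.

Definition core_frame (i : 'I_n + 'I_k) : Gamma Cr :=
  match i with inl i => binr _ (dsec (xfun hM ld i)) | inr b => binl _ (fframe hM hE ld b) end.

Lemma sum_fst (V W : lmodType R) I (r : seq I) (f : I -> (V * W)%type) :
  (\sum_(i <- r) f i).1 = \sum_(i <- r) (f i).1.
Proof. by elim/big_rec2: _ => // i y x _ <-. Qed.

Lemma sum_snd (V W : lmodType R) I (r : seq I) (f : I -> (V * W)%type) :
  (\sum_(i <- r) f i).2 = \sum_(i <- r) (f i).2.
Proof. by elim/big_rec2: _ => // i y x _ <-. Qed.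

Lemma side_expansion m (x : Q m) : U m ->
  x = \sum_i sc x (core_frame i m) *: side_frame i m.
Proof.
move=> Um; have H1 : x.1 = (\sum_i sc x (core_frame i m) *: side_frame i m).1.
  rewrite sum_fst big_sumType /= [X in _ + X]big1 ?addr0; last by move=> i _; exact: scaler0.
  rewrite {1}(vframe_expansion hM ld x.1 Um); apply: eq_bigr => i _.
  by rewrite sc_inr differentialE.
have H2 : x.2 = (\sum_i sc x (core_frame i m) *: side_frame i m).2.
  rewrite sum_snd big_sumType /= [X in X + _]big1 ?add0r; last by move=> i _; exact: scaler0.
  rewrite {1}(coframe_expansion hM hE ld x.2 Um); apply: eq_bigr => i _.
  by rewrite sc_inl.
by case: x H1 H2 => x1 x2; case: (\sum_i _) => y1 y2 /= -> ->.
Qed.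

Lemma core_expansion m (b : Cr m) : U m ->
  b = \sum_i sc (side_frame i m) b *: core_frame i m.
Proof.
move=> Um; apply: sc_nondegenerate => x; rewrite {1}(side_expansion x Um).
have -> : sc (\sum_i sc x (core_frame i m) *: side_frame i m) b =
    \sum_i sc x (core_frame i m) * sc (side_frame i m) b.
  elim: (index_enum _) => [|i s IH]; rewrite ?big_nil ?big_cons.
    by rewrite -(scale0r (0 : Q m)) scZl mul0r.
  by rewrite scDl scZl IH.
elim: (index_enum _) => [|i s IH]; rewrite ?big_nil ?big_cons.
  by rewrite -(scale0r (0 : Cr m)) scZr mul0r.
by rewrite scDr scZr IH mulrC.
Qed.

Definition P_frame (i : ('I_n + 'I_k) + ('I_n + 'I_k)) : Gamma P :=
  match i with inl i => hlG (side_frame i) | inr i => upG (core_frame i) end.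

(** Core coefficients are pairings with lifts, but lifts also pair among themselves, so the lift
    part is subtracted first. Being pairings, all coefficients are smooth. *)
Definition P_coef (i : ('I_n + 'I_k) + ('I_n + 'I_k)) (x : Gamma P) : cinf TA :=
  match i with
  | inl i => cpf x (upG (core_frame i))
  | inr i => cpf (x - \sum_l fscale (cpf x (upG (core_frame l))) (hlG (side_frame l)))
               (hlG (side_frame i))
  end.

Lemma P_expansion (x : Gamma P) m (a : E m) : U m ->
  x (pt m a) = \sum_i P_coef i x (pt m a) *: P_frame i (pt m a).
Proof.
move=> Um; rewrite big_sumType /=.
pose S := \sum_l fscale (cpf x (upG (core_frame l))) (hlG (side_frame l)).
have SE : S (pt m a) = \sum_l cp (x (pt m a)) (up a (core_frame l m)) *: hl (side_frame l) a.
  by rewrite gamma_sumE.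
have xE : (x - S) (pt m a) = x (pt m a) - S (pt m a) by rewrite [LHS]/= scaleN1r.
rewrite -/S -[X in _ = X + _]SE -[LHS](subrK (S (pt m a))) addrC; congr (_ + _).
rewrite -xE; set y := (x - S) (pt m a).
have cpS (I : finType) (f : I -> R) (v : I -> P (pt m a)) w :
    cp (\sum_i f i *: v i) w = \sum_i f i * cp (v i) w.
  elim: (index_enum _) => [|i s IH]; rewrite ?big_nil ?big_cons; first exact: cp0l.
  by rewrite cpDl cpZl IH.
have yu b : cp y (up a b) = 0.
  rewrite /y xE SE cpDl cpNl cpS {1}(core_expansion b Um) cpC.
  have -> : up a (\sum_i sc (side_frame i m) b *: core_frame i m) =
      \sum_i sc (side_frame i m) b *: up a (core_frame i m).
    elim: (index_enum _) => [|i s IH]; rewrite ?big_nil ?big_cons; first exact: up0.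
    by rewrite up_linear IH.
  rewrite cpS; apply/eqP; rewrite subr_eq0; apply/eqP; apply: eq_bigr => i _.
  by rewrite cpC (cp_hl_up dD) mulrC.
apply/eqP; rewrite -subr_eq0; apply/eqP; apply: (P_zero dD) => [b|nu].
  rewrite cpDl cpNl yu cpS big1 ?subrr// => i _.
  by rewrite [cp (_ : P _) (up a b)]cp_up_up mulr0.
rewrite cpDl cpNl cpS.
have hle : hl nu a = \sum_i sc (nu m) (core_frame i m) *: hl (side_frame i) a.
  have -> : hl nu a = hl (\sum_i sc (nu m) (core_frame i m) *: side_frame i : Gamma Q) a.
    by apply: (hl_eq dD); rewrite gamma_sumE {1}(side_expansion (nu m) Um).
  elim: (index_enum _) => [|i s IH]; rewrite ?big_nil ?big_cons.
    by apply: (@addIr _ (hl 0 a)); rewrite -(hlD dD) addr0 add0r.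
  by rewrite (hlD dD) IH; congr (_ + _); exact: (hl_fscale dD (cinf_cst _)).
apply/eqP; rewrite subr_eq0 {1}hle cpC cpS; apply/eqP; apply: eq_bigr => i _.
rewrite [X in _ = _ * X]cpC [X in _ = _ * X](cp_hl_up dD) mulrC; congr (_ * _); exact: cpC.
Qed.

End local.
End frame.

End lifts.

Section composition.
Context {R : realType} {T T' : Type} {n n' : nat} {A : atlas R T n} {A' : atlas R T' n'}.
Hypotheses (pmA : premanifold A) (pmA' : premanifold A').

Lemma smooth_pt_compose (G : T -> T') (g : T' -> R) W p c' :
  A' c' -> atlas_open A W -> W p -> (forall q, W q -> cdom c' (G q)) ->
  (forall i, smooth_pt (A := A) (fun q => cmap c' (G q) 0 i) p) ->
  smooth_pt (A := A') g (G p) -> smooth_pt (A := A) (fun q => g (G q)) p.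
Proof.
move=> Ac' oW Wp WG sG sg; have [c Ac cp] := pm_cover pmA p.
apply: (smooth_pt_chart pmA Ac cp).
pose h (i : 'I_n') (x : 'rV[R]_n) := cmap c' (G (cinv c x)) 0 i.
have hE x : row_fun h x = cmap c' (G (cinv c x)) by apply/rowP => i; rewrite mxE.
apply: (@smooth_at_near _ _ (fun x => (g \o cinv c') (row_fun h x))).
  apply: filterS (nbhs_chart pmA Ac oW Wp cp) => y [q [Wq cq _ yq]] /=.
  by rewrite hE yq (pm_chart pmA' Ac' (WG q Wq)).
apply: smooth_at_comp; last by move=> i; exact: (sG i c Ac cp).
by rewrite hE (pm_chart pmA Ac cp); apply: sg Ac' _; exact: WG.
Qed.

End composition.

(** * The linear structure of TE + T^*E over TM + E^* *)

Section fibrewise_linear.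
Context {R : realType} {M : Type} {n k1 k2 : nat} {E1 E2 : M -> lmodType R}.
Context {A : atlas R M n} {F1 : set (triv E1 k1)} {F2 : set (triv E2 k2)}.
Hypothesis hM : is_manifold A.
Hypothesis hE1 : is_vector_bundle A F1.
Hypothesis hE2 : is_vector_bundle A F2.
Let pmA := manifold_premanifold hM.
Local Notation TA1 := (total_atlas A F1).
Local Notation TA2 := (total_atlas A F2).
Local Notation pt2 m a := (existT (fun m0 => GRing.Lmodule.sort (E2 m0)) m a).
Local Notation de := (delta_mx 0).

Record smooth_linear (L : forall m, E1 m -> E2 m) : Prop := SmoothLinear {
  sl_linear : forall m c u v, L m (c *: u + v) = c *: L m u + L m v;
  sl_smooth : forall t1 t2, F1 t1 -> F2 t2 -> forall a i,
    smooth_on A (tdom t1 `&` tdom t2) (fun m => tmap t2 m (L m (tinv t1 m a)) 0 i) }.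

Variable L : forall m, E1 m -> E2 m.
Hypothesis sL : smooth_linear L.

Definition total_map (e : Defs.total E1) : Defs.total E2 := pt2 (projT1 e) (L (projT2 e)).

Lemma smooth_total_map g : smooth TA2 g -> smooth TA1 (g \o total_map).
Proof.
move=> sg; apply/smoothP => -[m x].
have [t Ft tm] := vb_cover hE2 m; have [c Ac cm] := pm_cover pmA m.
have TAct : TA2 (total_chart c t) by exists c => //; exists t.
apply: (smooth_pt_compose (G := total_map) (total_premanifold pmA hE1) (total_premanifold pmA hE2)
  (W := [set e | (tdom t `&` cdom c) (projT1 e)]) TAct).
- apply: (total_open pmA hE1); apply: (atlas_openI pmA (vb_open hE2 Ft)).
  exact: (pm_open pmA Ac).
- by [].
- by move=> e [].
- move=> i; have [[l ->]|[l ->]] : (exists l, i = lshift k2 l) \/ (exists l, i = rshift n l).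
      by case: (split_ordP i) => l ->; [left|right]; exists l.
    rewrite (_ : (fun q => _) = fun e : Defs.total E1 => cmap c (projT1 e) 0 l); last first.
      by apply/funext => e; rewrite /= row_mxEl.
    by apply: (smooth_pt_pull (f := fun m => cmap c m 0 l)); exact: smooth_pt_cmap.
  rewrite (_ : (fun q => _) = fun e : Defs.total E1 => tmap t (projT1 e) (L (projT2 e)) 0 l); last first.
    by apply/funext => e; rewrite /= row_mxEr.
  apply: (smooth_pt_fibrewise pmA hE1 (L := fun m a => tmap t m (L a) 0 l)).
    by move=> q d u v; rewrite (sl_linear sL) linearP !mxE.
  by move=> t' Ft' t'm b c' Ac' c'm; exact: (sl_smooth sL Ft' Ft (de b) l Ac' (conj t'm tm) c'm).
- exact: smoothW.
Qed.

Lemma dual_pull_smooth (eta : Gamma (dual_bundle A F2)) :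
  smooth_section (dual_bundle A F1) (fun m => dual_of (fun x : E1 m => eta m (L x))).
Proof.
move=> t1 Ft1 a c Ac m tm cm; have [t Ft t2m] := vb_cover hE2 m.
apply: (smooth_pt_local pmA (f := fun m =>
  \sum_i tmap t m (L (tinv t1 m a)) 0 i * eta m (tinv t m (de i))) (vb_open hE2 Ft) t2m _ _ Ac cm).
  move=> q tq; rewrite dual_ofE; last by move=> d u v; rewrite (sl_linear sL) dual_lin.
  rewrite [in RHS](tinv_basis hE2 (L (tinv t1 q a)) Ft tq) dual_sum.
  by apply: eq_bigr => i _; rewrite dual_Z.
apply: smooth_pt_sum => i; apply: smooth_ptM => c' Ac' c'm.
  exact: (sl_smooth sL Ft1 Ft a i Ac' (conj tm t2m) c'm).
exact: (gammaP eta t Ft (de i) c' Ac' m t2m c'm).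
Qed.

Definition dual_pull eta : Gamma (dual_bundle A F1) := MkGamma (dual_pull_smooth eta).

Lemma dual_pullE eta m (x : E1 m) : dual_pull eta m x = eta m (L x).
Proof. by rewrite [LHS]dual_ofE// => d u v; rewrite (sl_linear sL) dual_lin. Qed.

Lemma total_map_pull e (u : tangent TA1 e) (f : cinf A) :
  tangent_map TA2 total_map u (pull (F := F2) f) = u (pull (F := F1) f).
Proof. by rewrite tangent_mapE//; [exact: smooth_total_map|exact: cinfP]. Qed.

Lemma total_map_lin e (u : tangent TA1 e) eta :
  tangent_map TA2 total_map u (lin hM hE2 eta) = u (lin hM hE1 (dual_pull eta)).
Proof.
rewrite tangent_mapE; [|exact: smooth_total_map|exact: cinfP].
by congr (tangent_val u _); apply/funext => -[m x]; rewrite [RHS]dual_pullE.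
Qed.

End fibrewise_linear.

Section linear_structures.
Context {R : realType} {M : Type} {n k : nat} {E : M -> lmodType R}.
Context {A : atlas R M n} {F : set (triv E k)}.
Hypothesis hM : is_manifold A.
Hypothesis hE : is_vector_bundle A F.
Let pmA := manifold_premanifold hM.
Local Notation TA := (total_atlas A F).
Local Notation F2 := (double_triv @` F).
Local Notation TA2 := (total_atlas A F2).
Local Notation E2 := (@Defs.double _ _ E).
Local Notation P := (pontryagin_bundle TA).
Local Notation pt m a := (existT (fun m0 => GRing.Lmodule.sort (E m0)) m a).
Local Notation pt2 m a b := (existT (fun m0 => GRing.Lmodule.sort (E2 m0)) m (a, b)).
Local Notation TM := (tangent_bundle A).
Local Notation Ed := (dual_bundle A F).
Local Notation Q := (side_bundle A F).
Local Notation Cr := (core_bundle A F).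
Local Notation ell := (lin hM hE).
Local Notation pull2 := (@pull R M n (k + k)%N E2 A F2).
Local Notation pull := (@pull R M n k E A F).
Local Notation bp u := (tangent_map A (@bproj _ _ E) u).

Lemma double_bundle : is_vector_bundle A F2.
Proof.
split.
- by move=> m; have [t Ft tm] := vb_cover hE m; exists (double_triv t) => //; exists t.
- by move=> _ [t Ft <-]; exact: (vb_open hE Ft).
- move=> _ [t Ft <-] m tm [a b]; rewrite /= /double_tmap row_mxKl row_mxKr.
  by rewrite !(vb_tmapK hE Ft tm).
- move=> _ [t Ft <-] m tm x; rewrite /= /double_tmap /=.
  by rewrite !(vb_tinvK hE Ft tm) hsubmxK.
move=> _ _ [t Ft <-] [t' Ft' <-] a i.
have [[l ->]|[l ->]] : (exists l, i = lshift k l) \/ (exists l, i = rshift k l).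
  by case: (split_ordP i) => l ->; [left|right]; exists l.
  rewrite (_ : (fun m => _) = fun m => tmap t' m (tinv t m (lsubmx a)) 0 l).
    exact: (vb_compat hE Ft Ft').
  by apply/funext => m; rewrite /= /double_tmap row_mxEl.
rewrite (_ : (fun m => _) = fun m => tmap t' m (tinv t m (rsubmx a)) 0 l).
  exact: (vb_compat hE Ft Ft').
by apply/funext => m; rewrite /= /double_tmap row_mxEr.
Qed.

Let hE2 := double_bundle.
Local Notation ell2 := (lin hM hE2).

Lemma fst_smooth_linear : smooth_linear (F1 := F2) (F2 := F) (A := A) (fun m (x : E2 m) => x.1).
Proof. by split=> // _ t2 [t Ft <-] Ft2 a i; exact: (vb_compat hE Ft Ft2). Qed.

Lemma snd_smooth_linear : smooth_linear (F1 := F2) (F2 := F) (A := A) (fun m (x : E2 m) => x.2).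
Proof. by split=> // _ t2 [t Ft <-] Ft2 a i; exact: (vb_compat hE Ft Ft2). Qed.

Lemma add_smooth_linear : smooth_linear (F1 := F2) (F2 := F) (A := A) (fun m (x : E2 m) => x.1 + x.2).
Proof.
split=> [m c u v|_ t2 [t Ft <-] Ft2 a i]; first by rewrite scalerDr addrACA.
rewrite (_ : (fun m => _) = fun m => tmap t2 m (tinv t m (lsubmx a)) 0 i + tmap t2 m (tinv t m (rsubmx a)) 0 i).
  by apply: smooth_onD; exact: (vb_compat hE Ft Ft2).
by apply/funext => m; rewrite /= linearD mxE.
Qed.

Lemma scale_smooth_linear (c : R) : smooth_linear (F1 := F) (F2 := F) (A := A) (fun m (x : E m) => c *: x).
Proof.
split=> [m d u v|t1 t2 Ft Ft2 a i]; first by rewrite scalerDr !scalerA mulrC.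
rewrite (_ : (fun m => _) = fun m => c * tmap t2 m (tinv t1 m a) 0 i).
  by apply: smooth_onM; [exact: smooth_on_cst|exact: (vb_compat hE Ft Ft2)].
by apply/funext => m; rewrite /= linearZ mxE.
Qed.

Lemma inl_smooth_linear : smooth_linear (F1 := F) (F2 := F2) (A := A) (fun m (x : E m) => (x, 0) : E2 m).
Proof.
split=> [m c u v|t1 _ Ft1 [t Ft <-] a i]; first by congr pair; rewrite /= scaler0 addr0.
have [[l ->]|[l ->]] : (exists l, i = lshift k l) \/ (exists l, i = rshift k l).
  by case: (split_ordP i) => l ->; [left|right]; exists l.
  rewrite (_ : (fun m => _) = fun m => tmap t m (tinv t1 m a) 0 l).
    exact: (vb_compat hE Ft1 Ft).
  by apply/funext => m; rewrite /= /double_tmap row_mxEl.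
rewrite (_ : (fun m => _) = fun=> 0); first exact: smooth_on_cst.
by apply/funext => m; rewrite /= /double_tmap row_mxEr /= linear0 mxE.
Qed.

Lemma inr_smooth_linear : smooth_linear (F1 := F) (F2 := F2) (A := A) (fun m (x : E m) => (0, x) : E2 m).
Proof.
split=> [m c u v|t1 _ Ft1 [t Ft <-] a i]; first by congr pair; rewrite /= scaler0 addr0.
have [[l ->]|[l ->]] : (exists l, i = lshift k l) \/ (exists l, i = rshift k l).
  by case: (split_ordP i) => l ->; [left|right]; exists l.
  rewrite (_ : (fun m => _) = fun=> 0); first exact: smooth_on_cst.
  by apply/funext => m; rewrite /= /double_tmap row_mxEl /= linear0 mxE.
rewrite (_ : (fun m => _) = fun m => tmap t m (tinv t1 m a) 0 l).
  exact: (vb_compat hE Ft1 Ft).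
by apply/funext => m; rewrite /= /double_tmap row_mxEr.
Qed.

Local Notation dfst := (dual_pull hM hE fst_smooth_linear).
Local Notation dsnd := (dual_pull hM hE snd_smooth_linear).
Local Notation dadd := (dual_pull hM hE add_smooth_linear).
Local Notation dinl := (dual_pull hM hE2 inl_smooth_linear).
Local Notation dinr := (dual_pull hM hE2 inr_smooth_linear).

(** Conversely, a tangent vector of the total space of E + E with the three required images is
    produced by [tangent_exists] on the double bundle; [phi] splits a linear function on E + E into
    its restrictions to the two summands. *)
Lemma tangent_sumP m (a b : E m) (u : tangent TA (pt m a)) (v : tangent TA (pt m b))
    (w : tangent TA (pt m (a + b))) : tangent_sum u v w <->
  [/\ forall f, u (pull f) = v (pull f), forall f, u (pull f) = w (pull f) &
      forall eta, w (ell eta) = u (ell eta) + v (ell eta)].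
Proof.
have fp := total_map_pull hM hE2 hE fst_smooth_linear.
have fl := total_map_lin hM hE2 hE fst_smooth_linear.
have sp := total_map_pull hM hE2 hE snd_smooth_linear.
have sl := total_map_lin hM hE2 hE snd_smooth_linear.
have ap := total_map_pull hM hE2 hE add_smooth_linear.
have al := total_map_lin hM hE2 hE add_smooth_linear.
have daddE eta : dadd eta = dfst eta + dsnd eta.
  apply: gamma_eq => q; apply: dual_ext => x.
  by rewrite [RHS](dual_addE (dfst eta q)) !dual_pullE dual_D.
split=> [[z [<- <- <-]]|[uv uw wE]].
  split=> [f|f|eta].
  - by rewrite [LHS](fp _ z) [RHS](sp _ z).
  - by rewrite [LHS](fp _ z) [RHS](ap _ z).
  by rewrite [LHS](al _ z) [X in _ = X + _](fl _ z) [X in _ = _ + X](sl _ z) daddE lin_add tangent_cinfD.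
have dl_add (eta eta' : Gamma (dual_bundle A F2)) : dinl (eta + eta') = dinl eta + dinl eta'.
  apply: gamma_eq => q; apply: dual_ext => x.
  by rewrite [RHS](dual_addE (dinl eta q)) !dual_pullE [LHS](dual_addE (eta q)).
have dr_add (eta eta' : Gamma (dual_bundle A F2)) : dinr (eta + eta') = dinr eta + dinr eta'.
  apply: gamma_eq => q; apply: dual_ext => x.
  by rewrite [RHS](dual_addE (dinr eta q)) !dual_pullE [LHS](dual_addE (eta q)).
have dl_scale f (eta : Gamma (dual_bundle A F2)) : dinl (fscale f eta) = fscale f (dinl eta).
  apply: gamma_eq => q; apply: dual_ext => x.
  by rewrite [RHS](dual_scaleE (f q) (dinl eta q)) !dual_pullE [LHS](dual_scaleE (f q) (eta q)).
have dr_scale f (eta : Gamma (dual_bundle A F2)) : dinr (fscale f eta) = fscale f (dinr eta).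
  apply: gamma_eq => q; apply: dual_ext => x.
  by rewrite [RHS](dual_scaleE (f q) (dinr eta q)) !dual_pullE [LHS](dual_scaleE (f q) (eta q)).
pose phi (eta : Gamma (dual_bundle A F2)) := u (ell (dinl eta)) + v (ell (dinr eta)).
have [z [zp zl]] : exists z : tangent TA2 (pt2 m a b), (forall f : cinf A, z (pull2 f) = (bp u) f) /\
    forall eta, z (ell2 eta) = phi eta.
  apply: (tangent_exists hM hE2) => [eta eta'|f eta]; rewrite /phi.
    by rewrite dl_add dr_add !lin_add !tangent_cinfD addrACA.
  rewrite dl_scale dr_scale !lin_fscale !tangent_cinfM tangent_bprojE -uv.
  have -> : eta m (a, b) = ell (dinl eta) (pt m a) + ell (dinr eta) (pt m b).
    rewrite [X in _ = X + _]dual_pullE [X in _ = _ + X]dual_pullE -dual_D; congr (eta m _).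
    by congr pair; rewrite /= ?addr0 ?add0r.
  have -> : pull f (pt m a) = f m by [].
  have -> : pull f (pt m b) = f m by [].
  by ring.
have dlf eta : dinl (dfst eta) = eta.
  by apply: gamma_eq => q; apply: dual_ext => x; rewrite !dual_pullE.
have drf eta : dinr (dfst eta) = 0.
  by apply: gamma_eq => q; apply: dual_ext => x; rewrite !dual_pullE dual_0.
have dls eta : dinl (dsnd eta) = 0.
  by apply: gamma_eq => q; apply: dual_ext => x; rewrite !dual_pullE dual_0.
have drs eta : dinr (dsnd eta) = eta.
  by apply: gamma_eq => q; apply: dual_ext => x; rewrite !dual_pullE.
have l0 : ell 0 = cinf_cst 0 by apply: cinf_eq => -[q x]; exact: dual_zeroE.
exists z; split; apply: (@total_ext _ _ _ _ _ _ _ hM hE).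
- by move=> f; rewrite [LHS](fp _ z) zp tangent_bprojE.
- by move=> eta; rewrite [LHS](fl _ z) zl /phi dlf drf l0 tangent_cinfc addr0.
- by move=> f; rewrite [LHS](sp _ z) zp tangent_bprojE uv.
- by move=> eta; rewrite [LHS](sl _ z) zl /phi dls drs l0 tangent_cinfc add0r.
- by move=> f; rewrite [LHS](ap _ z) zp tangent_bprojE uw.
by move=> eta; rewrite [LHS](al _ z) zl /phi daddE dl_add dr_add dlf drf dls drs addr0 add0r wE.
Qed.

Local Notation sc := (@side_core_pairing _ _ _ _ _ A F _).

Lemma tangent_sum_bp m (a b : E m) (u : tangent TA (pt m a)) (v : tangent TA (pt m b))
    (w : tangent TA (pt m (a + b))) : tangent_sum u v w -> bp v = bp u /\ bp w = bp u.
Proof.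
move=> /tangent_sumP[uv uw _]; split; apply: tangent_ext => f sf.
  by rewrite (tangent_bprojE v (Cinf sf)) (tangent_bprojE u (Cinf sf)) uv.
by rewrite (tangent_bprojE w (Cinf sf)) (tangent_bprojE u (Cinf sf)) uw.
Qed.

Lemma rproj_side m (a : E m) (x : P (pt m a)) : rproj x.2 = (side x).2.
Proof. by []. Qed.

Lemma side_sum_side m (a b : E m) (x : P (pt m a)) (y : P (pt m b)) (z : P (pt m (a + b))) :
  side_sum x y z -> side y = side x /\ side z = side x.
Proof.
move=> [ts [r12 r3]]; have [t1 t2] := tangent_sum_bp ts.
split; first by rewrite /side /side_proj t1 r12.
rewrite /side /side_proj t2; congr pair; apply: dual_ext => c.
rewrite [LHS](side2E hM hE z c) [RHS](side2E hM hE x c).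
(* The vertical vector [c] over [a], zero over [b] and [c] over [a + b] are in sum relation, which
   isolates the covector of [x]. *)
rewrite (r3 (vertical A F a c) (vertical A F b 0) (vertical A F (a + b) c)).
  by rewrite [vertical A F b 0](congr1 fst (up0 hM hE b)) [X in _ + X]dual_0 addr0.
apply/tangent_sumP; split=> [f|f|eta]; rewrite ?(vertical_pull hM hE)// !(vertical_lin hM hE).
by rewrite dual_0 addr0.
Qed.

Lemma side_scaled_side c m (a : E m) (x : P (pt m a)) (y : P (pt m (c *: a))) :
  side_scaled x y -> side y = side x.
Proof.
move=> [y1 [r _]]; rewrite /side /side_proj r; congr pair.
apply: tangent_ext => f sf; rewrite (tangent_bprojE y.1 (Cinf sf)) (tangent_bprojE x.1 (Cinf sf)) y1.
exact: (total_map_pull hM hE hE (scale_smooth_linear c)).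
Qed.

Section hl.
Variable D : Gamma Q -> Gamma Q -> Gamma Q.
Hypothesis dD : is_dull (side_anchor A F) D.
Local Notation hl := (hl hM hE D).

(** Lifts of one section over a, b and a + b are in sum relation because the values of D are linear
    on fibres. Addition over the side bundle is thus addition of core parts, and linearity of J
    becomes a statement on core components. *)
Lemma side_sum_hl nu m (a b : E m) t1 t2 t3 :
  side_sum (hl nu a + up a t1) (hl nu b + up b t2) (hl nu (a + b) + up (a + b) t3) <->
  t3 = t1 + t2.
Proof.
have f1 (q : E m) t f : (hl nu q + up q t).1 (pull f) = (nu m).1 f.
  by rewrite P1D (hl_pull hM hE dD) (up_pull hM hE) addr0.
have l1 (q : E m) t eta : (hl nu q + up q t).1 (ell eta) = (D nu (binr _ eta) m).2 q + eta m t.1.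
  by rewrite P1D (hl_lin hM hE dD) (up_lin hM hE).
have u2 (q : E m) (t : Cr m) (u : tangent TA (pt m q)) (Y : Gamma TM) : Y m = bp u ->
    (hl nu q + up q t).2 u = u (ell (bsnd nu)) + (D nu (binl _ Y) m).2 q + t.2 (Y m).
  by move=> Ym; rewrite P2D (hl2E hM hE dD nu Ym) up2E Ym.
split=> [[ts [_ cs]]|tE].
  have /tangent_sumP[_ _ tl] := ts.
  have H1 : t3.1 = (t1 + t2).1.
    apply: (fibre_ext hM hE) => eta; have [s <-] := cosection_through hM hE eta.
    have := tl s; rewrite !l1 [(t1 + t2).1]/= !dual_D; lra.
  have H2 : t3.2 = (t1 + t2).2.
    apply: dual_ext => X; have [Y YE] := vector_field_through hM hE X.
    (* Lifts of [Y] supply three tangent vectors in sum relation over [Y m], on which the covector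
       condition can be evaluated. *)
    pose w (q : E m) := (hl (binl _ Y) q).1.
    have wp q : Y m = bp (w q) by rewrite /w (hl_proj hM hE dD).
    have [ww _] : tangent_sum (w a) (w b) (w (a + b)) /\ True.
      split=> //; apply/tangent_sumP; split=> [f|f|eta]; rewrite /w ?(hl_pull hM hE dD)//.
      by rewrite !(hl_lin hM hE dD) dual_D.
    have := cs _ _ _ ww; rewrite !(u2 _ _ _ _ (wp _)) YE [(t1 + t2).2 X]dual_addE !dual_D.
    have /tangent_sumP[_ _ ->] := ww; lra.
  by case: t3 H1 H2 {ts cs tl} => ? ? /= -> ->.
have ts : tangent_sum (hl nu a + up a t1).1 (hl nu b + up b t2).1 (hl nu (a + b) + up (a + b) t3).1.
  apply/tangent_sumP; split=> [f|f|eta]; rewrite ?f1// !l1 tE [(t1 + t2).1]/= !dual_D; lra.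
split=> //; split.
  have rE q t : rproj (hl nu q + up q t).2 = (nu m).2.
    rewrite rproj_side; have -> : side (hl nu q + up q t) = nu m; last by [].
    have := side_linear hM hE 1 (hl nu q) (up q t); rewrite !scale1r => ->.
    by rewrite (side_hl hM hE dD) (side_up hM hE) addr0.
  by rewrite !rE.
move=> u v w tw; have [Y Ym] := vector_field_through hM hE (bp u).
have [vE wE] := tangent_sum_bp tw; have /tangent_sumP[_ _ wl] := tw.
rewrite (u2 _ _ _ Y Ym) (u2 _ _ _ Y (etrans Ym (esym vE))) (u2 _ _ _ Y (etrans Ym (esym wE))).
by rewrite wl dual_D tE [(t1 + t2).2 _]dual_addE; ring.
Qed.

Lemma side_scaled_hl c nu m (a : E m) t1 t2 :
  side_scaled (hl nu a + up a t1) (hl nu (c *: a) + up (c *: a) t2) <-> t2 = c *: t1.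
Proof.
have sp := total_map_pull hM hE hE (scale_smooth_linear c).
have sl := total_map_lin hM hE hE (scale_smooth_linear c).
have slE e (u : tangent TA e) eta : u (ell (dual_pull hM hE (scale_smooth_linear c) eta)) = c * u (ell eta).
  rewrite -tangent_cinfZ; congr (tangent_val u _); apply/funext => -[q x].
  by rewrite [LHS]dual_pullE dual_Z.
have f1 (q : E m) t f : (hl nu q + up q t).1 (pull f) = (nu m).1 f.
  by rewrite P1D (hl_pull hM hE dD) (up_pull hM hE) addr0.
have l1 (q : E m) t eta : (hl nu q + up q t).1 (ell eta) = (D nu (binr _ eta) m).2 q + eta m t.1.
  by rewrite P1D (hl_lin hM hE dD) (up_lin hM hE).
have u2 (q : E m) (t : Cr m) (u : tangent TA (pt m q)) (Y : Gamma TM) : Y m = bp u ->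
    (hl nu q + up q t).2 u = u (ell (bsnd nu)) + (D nu (binl _ Y) m).2 q + t.2 (Y m).
  by move=> Ym; rewrite P2D (hl2E hM hE dD nu Ym) up2E Ym.
have bpc (u : tangent TA (pt m a)) : bp (tangent_map TA (total_scale c) u) = bp u.
  apply: tangent_ext => f sf; rewrite (tangent_bprojE u (Cinf sf)).
  rewrite (tangent_bprojE (tangent_map TA (total_scale c) u) (Cinf sf)).
  exact: (sp _ u (Cinf sf)).
split=> [[t1E [_ cs]]|tE].
  have H1 : t2.1 = (c *: t1).1.
    apply: (fibre_ext hM hE) => eta; have [s <-] := cosection_through hM hE eta.
    have zE : s m (c *: t1).1 = c * s m t1.1 by exact: dual_Z.
    have DE : (D nu (binr _ s) m).2 (c *: a) = c * (D nu (binr _ s) m).2 a by exact: dual_Z.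
    have : (hl nu (c *: a) + up (c *: a) t2).1 (ell s) = c * (hl nu a + up a t1).1 (ell s).
      by rewrite t1E [LHS](sl _ (hl nu a + up a t1).1) slE.
    rewrite !l1 DE zE; lra.
  have H2 : t2.2 = (c *: t1).2.
    apply: dual_ext => X; have [Y YE] := vector_field_through hM hE X.
    pose w := (hl (binl _ Y) a).1.
    have wp : Y m = bp w by rewrite /w (hl_proj hM hE dD).
    have := cs w; rewrite (u2 _ _ _ Y (etrans wp (esym (bpc w)))) (u2 _ _ _ Y wp).
    rewrite [X in X + _ + _](sl _ w) slE dual_Z YE [(c *: t1).2 X]dual_scaleE; lra.
  by case: t2 H1 H2 {t1E cs} => ? ? /= -> ->.
split; last split.
- apply: (@total_ext _ _ _ _ _ _ _ hM hE) => [f|eta].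
    by rewrite [RHS](sp _ (hl nu a + up a t1).1) !f1.
  by rewrite [RHS](sl _ (hl nu a + up a t1).1) slE !l1 tE !dual_Z; ring.
- have rE q t : rproj (hl nu q + up q t).2 = (nu m).2.
    rewrite rproj_side; have -> : side (hl nu q + up q t) = nu m; last by [].
    have := side_linear hM hE 1 (hl nu q) (up q t); rewrite !scale1r => ->.
    by rewrite (side_hl hM hE dD) (side_up hM hE) addr0.
  by rewrite !rE.
move=> u; have [Y Ym] := vector_field_through hM hE (bp u).
rewrite (u2 _ _ _ Y Ym) (u2 _ _ _ Y (etrans Ym (esym (bpc u)))).
by rewrite [X in X + _ + _](sl _ u) slE dual_Z tE [(c *: t1).2 _]dual_scaleE; ring.
Qed.

End hl.

End linear_structures.

(** * The Courant bracket and the Nijenhuis tensor *)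

Section courant.
Context {R : realType} {T : Type} {n : nat} {A : atlas R T n}.
Local Notation TM := (tangent_bundle A).
Local Notation P := (pontryagin_bundle A).
Hypothesis det : forall p, determined TM p.
Hypothesis through : forall p (v : tangent A p), exists s : Gamma TM, s p = v.
Local Notation cp := courant_pairing.
Implicit Types (X Y Z V : Gamma TM) (w : Gamma (cotangent_bundle A)) (x y z : Gamma P).

Lemma cv_appD w X Y : cv_app w (X + Y) = cinf_add (cv_app w X) (cv_app w Y).
Proof. by apply: cinf_eq => p; exact: dual_D. Qed.

Lemma cv_app_fscale f w X : cv_app w (fscale f X) = cinf_mul f (cv_app w X).
Proof. by apply: cinf_eq => p; exact: dual_Z. Qed.

(** The covectors in the Courant bracket are chosen by their values on global vector fields.
    Pointwise dependence and extension of vectors make the choice computable; on the total space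
    both will come from the frame of lifts and core sections. *)
Lemma covector_ofE p (W : (forall q, tangent A q) -> R) V :
  @tensorial _ _ _ _ TM p R^o (fun V => W (gamma_val V)) -> covector_of p W (V p) = W V.
Proof.
move=> tW; have [a aE] := tensorial_dual (@det p) (@through p) tW.
rewrite /covector_of; case: xgetP => [b _ /= H|/= H]; first exact: (H V (gammaP V)).
by case: (H a) => V' sV'; exact: (aE (@MkGamma _ _ _ _ TM V' sV')).
Qed.

Lemma lie_derivativeE X w V p :
  lie_derivative X w p (V p) = X p (cv_app w V) - cv_app w (lieG X V) p.
Proof.
pose W (V : forall q, tangent A q) := X p (fun q => w q (V q)) - w p (lie X V p).
suff tW : @tensorial _ _ _ _ TM p R^o (fun V => W (gamma_val V)) by exact: (covector_ofE V tW).
have E (U : Gamma TM) : W U = X p (cv_app w U) - cv_app w (lieG X U) p by [].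
split=> [s t|f s]; rewrite !E.
  by rewrite lieDr !cv_appD tangent_cinfD /=; ring.
rewrite cv_app_fscale tangent_cinfM.
have -> : cv_app w (lieG X (fscale f s)) p = f p * cv_app w (lieG X s) p + X p f * cv_app w s p.
  by rewrite [LHS](congr1 (w p) (lie_leibniz f X s p)) dual_D !dual_Z.
by rewrite /GRing.scale /=; ring.
Qed.

Lemma contract_dE Y w V p : contract_d Y w p (V p) =
  Y p (cv_app w V) - V p (cv_app w Y) - cv_app w (lieG Y V) p.
Proof.
pose W (V : forall q, tangent A q) :=
  Y p (fun q => w q (V q)) - V p (fun q => w q (Y q)) - w p (lie Y V p).
suff tW : @tensorial _ _ _ _ TM p R^o (fun V => W (gamma_val V)) by exact: (covector_ofE V tW).
have E (U : Gamma TM) : W U = Y p (cv_app w U) - U p (cv_app w Y) - cv_app w (lieG Y U) p by [].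
split=> [s t|f s]; rewrite !E.
  by rewrite lieDr !cv_appD tangent_cinfD [(s + t) p _](tangent_addE (s p)) /=; ring.
rewrite cv_app_fscale tangent_cinfM [fscale f s p _](tangent_scaleE (s p)).
have -> : cv_app w (lieG Y (fscale f s)) p = f p * cv_app w (lieG Y s) p + Y p f * cv_app w s p.
  by rewrite [LHS](congr1 (w p) (lie_leibniz f Y s p)) dual_D !dual_Z.
by rewrite /GRing.scale /=; ring.
Qed.

Lemma courant_bracket_smooth x y : smooth_section P (courant_bracket x y).
Proof.
split; first exact: (lie_smooth (bfst x) (bfst y)).
move=> V sV; pose VV : Gamma TM := MkGamma sV.
rewrite (_ : (fun p => _) = cinf_add
  (cinf_add (vf_app (bfst x) (cv_app (bsnd y) VV)) (cinf_mul (cinf_cst (-1)) (cv_app (bsnd y) (lieG (bfst x) VV))))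
  (cinf_mul (cinf_cst (-1)) (cinf_add
    (cinf_add (vf_app (bfst y) (cv_app (bsnd x) VV)) (cinf_mul (cinf_cst (-1)) (vf_app VV (cv_app (bsnd x) (bfst y)))))
    (cinf_mul (cinf_cst (-1)) (cv_app (bsnd x) (lieG (bfst y) VV)))))); first exact: cinfP.
apply/funext => p; rewrite [LHS]dual_subE.
rewrite [X in X - _](lie_derivativeE (bfst x) (bsnd y) VV) [X in _ - X](contract_dE (bfst y) (bsnd x) VV).
by rewrite /= !mulN1r.
Qed.

Definition cbr x y : Gamma P := MkGamma (courant_bracket_smooth x y).

Definition courant3 x y z p : R := cp (cbr x y p) (z p).

Lemma courant3E x y z p : courant3 x y z p =
  bfst x p (cv_app (bsnd y) (bfst z)) - cv_app (bsnd y) (lieG (bfst x) (bfst z)) p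
  - bfst y p (cv_app (bsnd x) (bfst z)) + bfst z p (cv_app (bsnd x) (bfst y))
  + cv_app (bsnd x) (lieG (bfst y) (bfst z)) p + cv_app (bsnd z) (lieG (bfst x) (bfst y)) p.
Proof.
rewrite /courant3 /courant_pairing [X in X + _]dual_subE.
rewrite [X in X - _ + _](lie_derivativeE (bfst x) (bsnd y) (bfst z)).
rewrite [X in _ - X + _](contract_dE (bfst y) (bsnd x) (bfst z)).
rewrite [X in _ + X](_ : _ = cv_app (bsnd z) (lieG (bfst x) (bfst y)) p); last by [].
by ring.
Qed.

Lemma cv_app_anti w X Y p : cv_app w (lieG X Y) p = - cv_app w (lieG Y X) p.
Proof. by rewrite lie_anti -scaleN1r (cv_app_fscale (cinf_cst (-1))) /= mulN1r. Qed.

Lemma cpfE x y : cpf x y = cinf_add (cv_app (bsnd x) (bfst y)) (cv_app (bsnd y) (bfst x)).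
Proof. exact: cinf_eq. Qed.

Lemma courant3_skew12 x y z p : courant3 x y z p + courant3 y x z p = bfst z p (cpf x y).
Proof.
rewrite cpfE tangent_cinfD !courant3E (cv_app_anti (bsnd z) (bfst y)); ring.
Qed.

Lemma courant3_skew23 x y z p : courant3 x y z p + courant3 x z y p = bfst x p (cpf y z).
Proof.
rewrite cpfE tangent_cinfD !courant3E (cv_app_anti (bsnd x) (bfst z)); ring.
Qed.

Section nijenhuis.
Variable J : bmor P P.
Hypothesis JJ : forall p (u : P p), J p (J p u) = - u.
Hypothesis Jorth : forall p (u v : P p), cp (J p u) (J p v) = cp u v.
Local Notation JG := (bmap J).

Lemma cp_J p (u v : P p) : cp (J p u) v = - cp u (J p v).
Proof. by rewrite -Jorth JJ cpNl. Qed.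

(** The Nijenhuis tensor paired with a third section. Moving J across the pairing puts it into each
    pair of the three slots in turn. *)
Definition nij x y z p : R := courant3 x y z p - courant3 (JG x) (JG y) z p
  - courant3 (JG x) y (JG z) p - courant3 x (JG y) (JG z) p.

Lemma nijE x y z p : nij x y z p =
  cp (courant_bracket x y p - courant_bracket (JG x) (JG y) p
      + J p (courant_bracket (JG x) y p + courant_bracket x (JG y) p)) (z p).
Proof.
have E u v u' : courant3 u v u' p = cp (courant_bracket u v p) (u' p) by [].
by rewrite !cpDl cpNl cp_J cpDl /nij !E (_ : JG z p = J p (z p))//; ring.
Qed.

Lemma vf_cpf_J X x y p : X p (cpf (JG x) (JG y)) = X p (cpf x y).
Proof. by congr (tangent_val (X p) _); apply/funext => q; exact: Jorth. Qed.

Lemma vf_cpf_Jl X x y p : X p (cpf (JG x) y) = - X p (cpf x (JG y)).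
Proof.
rewrite -mulN1r -tangent_cinfZ; congr (tangent_val (X p) _); apply/funext => q.
by rewrite /= mulN1r; exact: cp_J.
Qed.

(* Since [J] is orthogonal and squares to -1, the defects of skewness and of
   tensoriality of the Courant bracket cancel: the Nijenhuis form is totally
   skew, so its obvious tensoriality in [z] gives the one in [x] and [y]. *)
Lemma nij_skew23 x y z p : nij x y z p = - nij x z y p.
Proof.
apply/eqP; rewrite -subr_eq0 opprK; apply/eqP.
have := courant3_skew23 x y z p; have := courant3_skew23 (JG x) (JG y) z p.
have := courant3_skew23 (JG x) y (JG z) p; have := courant3_skew23 x (JG y) (JG z) p.
rewrite vf_cpf_J (vf_cpf_Jl _ y z) /nij; lra.
Qed.

Lemma nij_skew12 x y z p : nij x y z p = - nij y x z p.
Proof.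
apply/eqP; rewrite -subr_eq0 opprK; apply/eqP.
have := courant3_skew12 x y z p; have := courant3_skew12 (JG x) (JG y) z p.
have := courant3_skew12 (JG x) y (JG z) p; have := courant3_skew12 x (JG y) (JG z) p.
rewrite vf_cpf_J (vf_cpf_Jl _ x y) /nij; lra.
Qed.

Lemma nij_tensorial3 x y p : @tensorial _ _ _ _ P p R^o (fun z => nij x y z p).
Proof.
split=> [s t|f s]; first by rewrite !nijE cpDr.
by rewrite !nijE cpZr.
Qed.

Lemma nij_tensorial2 x z p : @tensorial _ _ _ _ P p R^o (fun y => nij x y z p).
Proof.
have [tD tZ] := nij_tensorial3 x z p.
split=> [s t|f s]; rewrite !(nij_skew23 x _ z); first by rewrite tD opprD.
by rewrite tZ -mulrN.
Qed.

Lemma nij_tensorial1 y z p : @tensorial _ _ _ _ P p R^o (fun x => nij x y z p).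
Proof.
have [tD tZ] := nij_tensorial2 y z p.
split=> [s t|f s]; rewrite !(nij_skew12 _ y); first by rewrite tD opprD.
by rewrite tZ -mulrN.
Qed.

Lemma gcs_nij x y z p : is_gcs J -> nij x y z p = 0.
Proof.
by move=> gJ; rewrite nijE [X in cp X _](gcs_nijenhuis gJ (gammaP x) (gammaP y)) cp0l.
Qed.

Lemma nij_gcs : (forall p (v : P p), exists s : Gamma P, s p = v) ->
  (forall x y z p, nij x y z p = 0) -> is_gcs J.
Proof.
move=> thr n0; split=> // x y sx sy Jx Jy p; apply: cp_nondegenerate => v.
have [z <-] := thr p v; rewrite cp0l -(n0 (MkGamma sx) (MkGamma sy) z p).
by rewrite nijE.
Qed.

End nijenhuis.

End courant.

Section generators.
Context {R : realType} {M : Type} {n k : nat} {E : M -> lmodType R}.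
Context {A : atlas R M n} {F : set (triv E k)}.
Hypothesis hM : is_manifold A.
Hypothesis hE : is_vector_bundle A F.
Local Notation TA := (total_atlas A F).
Local Notation P := (pontryagin_bundle TA).
Local Notation pt m a := (existT (fun m0 => GRing.Lmodule.sort (E m0)) m a).
Local Notation TM := (tangent_bundle A).
Local Notation Ed := (dual_bundle A F).
Local Notation Q := (side_bundle A F).
Local Notation Cr := (core_bundle A F).
Local Notation ell := (lin hM hE).
Local Notation pull := (@pull R M n k E A F).
Local Notation bp u := (tangent_map A (@bproj _ _ E) u).
Local Notation sc := (@side_core_pairing _ _ _ _ _ A F _).
Local Notation cp := courant_pairing.
Variable D : Gamma Q -> Gamma Q -> Gamma Q.
Hypothesis dD : is_dull (side_anchor A F) D.
Local Notation hl := (hl hM hE D).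
Local Notation hlG := (hlG hM hE dD).
Local Notation upG := (upG hM hE).

(** A bump pulled back from M turns the expansion in lifts and core sections into an identity of
    global sections. *)
Lemma P_generated e (V : lmodType R) (W : Gamma P -> V) : tensorial e W ->
  (forall nu, W (hlG nu) = 0) -> (forall tau, W (upG tau) = 0) -> forall x, W x = 0.
Proof.
move=> tW Wh Wu x; have [c [t [U [chi ld]]]] := local_data_exists hM hE (projT1 e).
have [psi [psi1 psi0]] := bump_psi ld.
have xE : fscale (pull psi) x =
    \sum_i fscale (cinf_mul (pull psi) (P_coef hM hE dD ld i x)) (P_frame hM hE dD ld i).
  apply: gamma_eq => -[m a]; rewrite gamma_sumE [LHS]/=.
  have [Um|/psi0 p0] := pselect (U m).
    rewrite (P_expansion hM hE dD ld x a Um) scaler_sumr.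
    by apply: eq_bigr => i _; rewrite scalerA.
  rewrite p0 scale0r big1// => i _.
  have -> : fscale (cinf_mul (pull psi) (P_coef hM hE dD ld i x)) (P_frame hM hE dD ld i) (pt m a) =
    (psi m * P_coef hM hE dD ld i x (pt m a)) *: P_frame hM hE dD ld i (pt m a) by [].
  by rewrite p0 mul0r scale0r.
have [_ WZ] := tW.
have := congr1 W xE; rewrite WZ (_ : pull psi e = 1)// scale1r => ->.
rewrite (tensorial_sum _ _ tW) big1// => i _; rewrite WZ.
by case: i => i /=; rewrite ?Wh ?Wu scaler0.
Qed.

Lemma determined_P e : determined P e.
Proof.
move=> V W tW s t st; have [c [tr [U [chi ld]]]] := local_data_exists hM hE (projT1 e).
have [psi [psi1 psi0]] := bump_psi ld.
apply: (frame_determined (s := P_frame hM hE dD ld) (psi := pull psi)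
  (coef := fun i x => P_coef hM hE dD ld i x) _ _ _ tW st) => //.
  move=> x [m a]; have [Um|/psi0 p0] := pselect (U m).
    rewrite (P_expansion hM hE dD ld x a Um) scaler_sumr.
    by apply: eq_bigr => i _; rewrite scalerA.
  have p0' : pull psi (pt m a) = 0 by [].
  by rewrite p0' scale0r big1// => i _; rewrite mul0r scale0r.
move=> i x x' xx'; case: i => i; first by rewrite /P_coef /cpf /= xx'.
pose S x : Gamma P := \sum_l fscale (cpf x (upG (core_frame hM hE ld l))) (hlG (side_frame hM hE ld l)).
have SE : S x e = S x' e.
  rewrite !gamma_sumE; apply: eq_bigr => l _; congr (_ *: _).
  by rewrite /cpf /= xx'.
by apply: (congr1 (fun v => cp v _)); rewrite [LHS](_ : _ = x e + -1 *: S x e)// xx' SE.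
Qed.

Lemma P_through e (x : P e) : exists s : Gamma P, s e = x.
Proof.
case: e x => m a x; have [nu nux] := side_section_through hM hE (side x).
have [b ->] := P_decomposition hM hE dD nux; have [tau <-] := core_section_exists hM hE b.
by exists (hlG nu + upG tau).
Qed.

(** Composition with the first projection reduces this to TE + T^*E, where the frame is
    available. *)
Lemma determined_TE e : determined (tangent_bundle TA) e.
Proof.
move=> V W [WD WZ] s t st; pose W' (x : Gamma P) := W (bfst x).
have -> : W s = W' (binl _ s) by congr W; exact: gamma_eq.
have -> : W t = W' (binl _ t) by congr W; exact: gamma_eq.
apply: (@determined_P e V W'); last by rewrite /= st.
split=> [x y|f x]; rewrite /W' -?WD -?WZ; congr W; exact: gamma_eq.
Qed.

Lemma TE_through e (v : tangent TA e) : exists s : Gamma (tangent_bundle TA), s e = v.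
Proof. by have [s sE] := P_through ((v, 0) : P e); exists (bfst s); rewrite /= sE. Qed.

Local Notation cbr := (cbr determined_TE TE_through).
Local Notation courant3 := (courant3 determined_TE TE_through).

(** Vector fields of lifts and core sections, and their Lie brackets, project to M. The form of a
    lift evaluated on such a field involves D only through the projected field. *)
Definition projects (Z : Gamma (tangent_bundle TA)) (Y : Gamma TM) :=
  forall f, vf_app Z (pull f) = pull (vf_app Y f).

Lemma projects_bp Z Y m (a : E m) : projects Z Y -> Y m = bp (Z (pt m a)).
Proof.
move=> ZY; apply: tangent_ext => f sf; rewrite (tangent_bprojE (Z (pt m a)) (Cinf sf)).
by have := congr1 (fun g : cinf TA => g (pt m a)) (ZY (Cinf sf)).
Qed.

Lemma projects_lie Z Y Z' Y' : projects Z Y -> projects Z' Y' -> projects (lieG Z Z') (lieG Y Y').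
Proof.
by move=> ZY ZY' f; rewrite vf_app_lie ZY' !ZY ZY' vf_app_lie; apply: cinf_eq => e; rewrite /= !mulN1r.
Qed.

Lemma projects_hl nu : projects (bfst (hlG nu)) (bfst nu).
Proof. by move=> f; apply: cinf_eq => -[m a]; exact: (hl_pull hM hE dD). Qed.

Lemma projects_up tau : projects (bfst (upG tau)) 0.
Proof.
move=> f; apply: cinf_eq => -[m a]; rewrite [LHS](up_pull hM hE).
by rewrite [RHS](tangent_zeroE m).
Qed.

(** With [Df], the two components of the part of [D nu] in the dual of E; [Df] is the action of a
    lift on linear functions. *)
Definition Dv nu (Y : Gamma TM) : Gamma Ed := bsnd (D nu (binl _ Y)).
Definition Df nu (eta : Gamma Ed) : Gamma Ed := bsnd (D nu (binr _ eta)).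

Lemma bsnd_D nu mu : bsnd (D nu mu) = Dv nu (bfst mu) + Df nu (bsnd mu).
Proof. by rewrite {1}(bsum_split mu) (dullDr dD); exact: gamma_eq. Qed.

Lemma bfst_D nu mu : bfst (D nu mu) = lieG (bfst nu) (bfst mu).
Proof.
apply: gamma_eq => m; rewrite [LHS](dull_anchor dD nu mu m).
by congr (lie _ _ m).
Qed.

Lemma DfD nu eta eta' : Df nu (eta + eta') = Df nu eta + Df nu eta'.
Proof.
rewrite /Df (_ : binr _ (eta + eta') = binr _ eta + binr _ eta').
  by rewrite (dullDr dD); exact: gamma_eq.
by apply: gamma_eq => m; congr pair; rewrite /= addr0.
Qed.

Lemma Dv0 nu : Dv nu 0 = 0.
Proof.
rewrite /Dv (_ : binl _ 0 = 0); last exact: gamma_eq.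
by rewrite (dull0r dD); exact: gamma_eq.
Qed.

Lemma hl_ell nu eta : vf_app (bfst (hlG nu)) (ell eta) = ell (Df nu eta).
Proof. by apply: cinf_eq => -[m a]; exact: (hl_lin hM hE dD). Qed.

Lemma up_ell tau eta : vf_app (bfst (upG tau)) (ell eta) = pull (pairing hM hE eta (bfst tau)).
Proof. by apply: cinf_eq => -[m a]; exact: (up_lin hM hE). Qed.

Lemma hl_form nu Z Y : projects Z Y ->
  cv_app (bsnd (hlG nu)) Z = cinf_add (vf_app Z (ell (bsnd nu))) (ell (Dv nu Y)).
Proof.
by move=> ZY; apply: cinf_eq => -[m a]; exact: (hl2E hM hE dD nu (projects_bp a ZY)).
Qed.

Lemma up_form tau Z Y : projects Z Y -> cv_app (bsnd (upG tau)) Z = pull (cv_app (bsnd tau) Y).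
Proof.
move=> ZY; apply: cinf_eq => -[m a]; rewrite [LHS](up2E _ (Z (pt m a))).
by rewrite -(projects_bp a ZY).
Qed.

Lemma lieG0r (X : Gamma TM) : lieG X 0 = 0.
Proof. by have := lieZr 0 X 0; rewrite !scale0r. Qed.

Lemma cv_app0 (w : Gamma (cotangent_bundle A)) : cv_app w 0 = cinf_cst 0.
Proof. by apply: cinf_eq => m; exact: dual_0. Qed.

Lemma ell0 : ell 0 = cinf_cst 0.
Proof. by apply: cinf_eq => -[m a]; exact: dual_zeroE. Qed.

Lemma pull_cst c : pull (cinf_cst c) = cinf_cst c.
Proof. exact: cinf_eq. Qed.

Lemma cinf_add0 (B : atlas R (Defs.total E) (n + k)) (f : cinf B) : cinf_add f (cinf_cst 0) = f.
Proof. by apply: cinf_eq => e /=; rewrite addr0. Qed.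

Lemma vf_pullV tau f : vf_app (bfst (upG tau)) (pull f) = cinf_cst 0.
Proof. by apply: cinf_eq => -[m a]; exact: (up_pull hM hE). Qed.

Lemma D2E nu mu m b : (D nu mu m).2 b = Dv nu (bfst mu) m b + Df nu (bsnd mu) m b.
Proof. exact: (congr1 (fun s : Gamma Ed => s m b) (bsnd_D nu mu)). Qed.

Lemma cinf_addE (f g : cinf TA) e : cinf_add f g e = f e + g e. Proof. by []. Qed.

Lemma cinf_cstME c (f : cinf TA) e : cinf_mul (cinf_cst c) f e = c * f e. Proof. by []. Qed.

(** Lifts act on linear functions by [Df]. In [courant3E] the second derivatives of the linear
    function of n1 cancel, while those of n2 and n3 give the iterated brackets. *)
Lemma courant3_hhh n1 n2 n3 m (a : E m) :
  courant3 (hlG n1) (hlG n2) (hlG n3) (pt m a) =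
  (D n1 (D n2 n3) m).2 a - (D n2 (D n1 n3) m).2 a + (D n3 (D n1 n2) m).2 a.
Proof.
have p1 := projects_hl n1; have p2 := projects_hl n2; have p3 := projects_hl n3.
rewrite courant3E !(hl_form _ p1, hl_form _ p2, hl_form _ p3).
rewrite !(hl_form _ (projects_lie p1 p3), hl_form _ (projects_lie p2 p3), hl_form _ (projects_lie p1 p2)).
rewrite !hl_ell !vf_app_lie !tangent_cinfD.
have h1 nu eta : bfst (hlG nu) (pt m a) (ell eta) = Df nu eta m a by exact: (hl_lin hM hE dD).
have DD nu mu la : (D nu (D mu la) m).2 a = Dv nu (lieG (bfst mu) (bfst la)) m a
    + (Df nu (Dv mu (bfst la)) m a + Df nu (Df mu (bsnd la)) m a).
  by rewrite D2E bfst_D bsnd_D DfD; congr (_ + _); exact: (dual_addE (Df nu _ m)).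
rewrite !DD !h1 !hl_ell !cinf_addE !cinf_cstME !linE; ring.
Qed.

Lemma courant3_hhu n1 n2 tau m (a : E m) :
  courant3 (hlG n1) (hlG n2) (upG tau) (pt m a) = sc (D n1 n2 m) (tau m).
Proof.
have p1 := projects_hl n1; have p2 := projects_hl n2; have p3 := projects_up tau.
rewrite courant3E !(hl_form _ p1, hl_form _ p2, hl_form _ p3).
rewrite !(hl_form _ (projects_lie p1 p3), hl_form _ (projects_lie p2 p3)) (up_form _ (projects_lie p1 p2)).
rewrite !lieG0r !Dv0 !ell0 !cinf_add0 !hl_ell !up_ell !vf_app_lie !hl_ell !up_ell !tangent_cinfD.
have hp nu f : bfst (hlG nu) (pt m a) (pull f) = (nu m).1 f by exact: (hl_pull hM hE dD).
have ul eta : bfst (upG tau) (pt m a) (ell eta) = eta m (tau m).1 by exact: (up_lin hM hE).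
rewrite /side_core_pairing D2E.
have -> : (tau m).2 (D n1 n2 m).1 = (tau m).2 (lieG (bfst n1) (bfst n2) m).
  by rewrite -(bfst_D n1 n2).
rewrite !cinf_addE !cinf_cstME !vf_appE !hp !ul.
have pE (f : cinf A) : pull f (pt m a) = f m by [].
by rewrite !pE /=; ring.
Qed.

Lemma courant3_huu nu t t' e : courant3 (hlG nu) (upG t) (upG t') e = 0.
Proof.
have p1 := projects_hl nu; have p2 := projects_up t; have p3 := projects_up t'.
rewrite courant3E !(hl_form _ p1, hl_form _ p2, hl_form _ p3, up_form _ p1, up_form _ p2, up_form _ p3).
rewrite !(hl_form _ (projects_lie p2 p3), up_form _ (projects_lie p1 p3), up_form _ (projects_lie p1 p2)).
rewrite !lieG0r !cv_app0 !pull_cst !Dv0 !ell0 !cinf_add0 !up_ell !vf_app_lie !up_ell !vf_pullV !tangent_cinfc.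
have E0 s f : bfst (upG s) e (pull f) = 0.
  by have := congr1 (fun g : cinf TA => g e) (vf_pullV s f).
by rewrite !E0 /=; ring.
Qed.

Lemma courant3_uuu t1 t2 t3 e : courant3 (upG t1) (upG t2) (upG t3) e = 0.
Proof.
have p1 := projects_up t1; have p2 := projects_up t2; have p3 := projects_up t3.
rewrite courant3E !(up_form _ p1, up_form _ p2, up_form _ p3).
rewrite !(up_form _ (projects_lie p2 p3), up_form _ (projects_lie p1 p3), up_form _ (projects_lie p1 p2)).
by rewrite !lieG0r !cv_app0 !pull_cst !tangent_cinfc /=; ring.
Qed.

End generators.

(** * From complex Lie algebroids to generalised complex structures *)

Section algebroid.
Context {R : realType} {M : Type} {n k : nat} {E : M -> lmodType R}.
Context {A : atlas R M n} {F : set (triv E k)}.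
Hypothesis hM : is_manifold A.
Hypothesis hE : is_vector_bundle A F.
Local Notation TM := (tangent_bundle A).
Local Notation Q := (side_bundle A F).
Local Notation Cr := (core_bundle A F).
Local Notation sc := (@side_core_pairing _ _ _ _ _ A F _).
Variable j : bmor Q Q.
Hypothesis hj : forall m (x : Q m), j m (j m x) = - x.
Local Notation jG := (bmap j).

Lemma side_ext (s t : Gamma Q) : (forall m b, sc (s m) b = sc (t m) b) -> s = t.
Proof. by move=> st; apply: gamma_eq => m; exact: sc_nondegeneratel. Qed.

Lemma sc_gD m (s t : Gamma Q) b : sc ((s + t) m) b = sc (s m) b + sc (t m) b.
Proof. exact: (scDl (s m)). Qed.

Lemma sc_gZ m c (s : Gamma Q) b : sc ((c *: s) m) b = c * sc (s m) b.
Proof. exact: (scZl c (s m)). Qed.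

Lemma sc_gN m (s : Gamma Q) b : sc ((- s) m) b = - sc (s m) b.
Proof. by rewrite -scaleN1r sc_gZ mulN1r. Qed.

Lemma jGK s : jG (jG s) = - s.
Proof. by apply: gamma_eq => m; rewrite [LHS]hj [RHS]/= scaleN1r. Qed.

Section dull.
Variable D : Gamma Q -> Gamma Q -> Gamma Q.
Hypothesis dD : is_dull (side_anchor A F) D.

Definition dskew q1 q2 := D q1 q2 - D (jG q1) (jG q2).

Definition djac q1 q2 q3 := D q1 (D q2 q3) - D q2 (D q1 q3) + D q3 (D q1 q2).

Definition jcompatible := forall q1 q2, D (jG q1) q2 + D q1 (jG q2) = jG (dskew q1 q2).

(** Expanding the outer S produces j of an inner S, which compatibility rewrites as plain brackets.
    What remains is the combination of [djac] terms that the Nijenhuis form takes on three lifts. *)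
Lemma dskew_jacobi q1 q2 q3 : jcompatible ->
  dskew q1 (dskew q2 q3) - dskew q2 (dskew q1 q3) + dskew q3 (dskew q1 q2) =
  djac q1 q2 q3 - djac (jG q1) (jG q2) q3 - djac (jG q1) q2 (jG q3) - djac q1 (jG q2) (jG q3).
Proof.
move=> cD; have SE x y z : dskew x (dskew y z) =
    D x (D y z) - D x (D (jG y) (jG z)) - (D (jG x) (D (jG y) z) + D (jG x) (D y (jG z))).
  by rewrite [in LHS]/dskew -cD (dullDr dD) /dskew (dullDr dD) (dullNr dD).
apply: side_ext => m b; rewrite !SE /djac.
by rewrite !(sc_gD, sc_gN); ring.
Qed.

Lemma dskew_jl q1 q2 : jcompatible -> dskew (jG q1) q2 = jG (dskew q1 q2).
Proof. by move=> cD; rewrite -cD /dskew jGK (dullNl dD) opprK. Qed.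

Lemma dskew_jr q1 q2 : jcompatible -> dskew q1 (jG q2) = jG (dskew q1 q2).
Proof. by move=> cD; rewrite -cD /dskew jGK (dullNr dD) opprK addrC. Qed.

Lemma dskewDl q1 q2 q : dskew (q1 + q2) q = dskew q1 q + dskew q2 q.
Proof. by rewrite /dskew bmap_D !(dullDl dD) opprD addrACA. Qed.

Lemma dskewDr q q1 q2 : dskew q (q1 + q2) = dskew q q1 + dskew q q2.
Proof. by rewrite /dskew bmap_D !(dullDr dD) opprD addrACA. Qed.

Lemma dskewZl c q1 q : dskew (c *: q1) q = c *: dskew q1 q.
Proof. by rewrite /dskew bmap_Z !(dullZl dD) scalerBr. Qed.

Lemma dskewZr c q q1 : dskew q (c *: q1) = c *: dskew q q1.
Proof. by rewrite /dskew bmap_Z !(dullZr dD) scalerBr. Qed.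

Lemma dskew_fr f q1 q2 m : dskew q1 (fscale f q2) m =
  f m *: dskew q1 q2 m + (q1 m).1 f *: q2 m - (jG q1 m).1 f *: jG q2 m.
Proof.
apply: (sc_nondegeneratel (F := F)) => b.
rewrite /dskew sc_gD sc_gN bmap_fscale !(dull_fr dD) -scaleNr !scDl !scZl sc_gD sc_gN.
by rewrite [side_anchor _ _ _ _]/= /side_anchor_fun /=; ring.
Qed.

Definition half_dskew q1 q2 := 2^-1 *: dskew q1 q2.

(** The real part of the bracket identity on the i-eigenbundle gives the formula for [br], the
    imaginary part gives compatibility. The factor 1/2 of [section_to_Q10] occurs twice on the left
    and once on the right, whence the half of S. *)
Lemma realises_dskew lambda br : realises j (side_anchor A F) D lambda br ->
  jcompatible /\ forall q1 q2, br q1 q2 = half_dskew q1 q2.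
Proof.
case=> _ _ rb.
have H q1 q2 : D (2^-1 *: q1) (2^-1 *: q2) - D (2^-1 *: - jG q1) (2^-1 *: - jG q2) = 2^-1 *: br q1 q2.
  exact: (congr1 fst (rb q1 q2)).
have H2 q1 q2 : D (2^-1 *: q1) (2^-1 *: - jG q2) + D (2^-1 *: - jG q1) (2^-1 *: q2) = 2^-1 *: - jG (br q1 q2).
  exact: (congr1 snd (rb q1 q2)).
have brE q1 q2 : br q1 q2 = half_dskew q1 q2.
  apply: (scalerI (a := 2^-1)); first by rewrite invr_eq0 pnatr_eq0.
  rewrite -H !(dullZl dD, dullZr dD, dullNl dD, dullNr dD) /half_dskew /dskew.
  by apply: side_ext => m b; rewrite !(sc_gD, sc_gN, sc_gZ); ring.
split=> // q1 q2; have := H2 q1 q2; rewrite brE /half_dskew bmap_Z.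
rewrite !(dullZl dD, dullZr dD, dullNl dD, dullNr dD) => E0.
apply: side_ext => m b; have := congr1 (fun s : Gamma Q => sc (s m) b) E0.
by rewrite !(sc_gD, sc_gN, sc_gZ); lra.
Qed.

Lemma lambda_anchor m (x : Q m) : cplx_anchor (side_anchor A F) (to_Q10 j x) = side_lambda j m x.
Proof. by congr pair. Qed.

Lemma dskew_realises : jcompatible -> realises j (side_anchor A F) D (side_lambda j) half_dskew.
Proof.
move=> cD; split; last first.
- move=> q1 q2; congr pair.
    rewrite [LHS](_ : _ = D (2^-1 *: q1) (2^-1 *: q2) - D (2^-1 *: - jG q1) (2^-1 *: - jG q2))//.
    rewrite [RHS](_ : _ = 2^-1 *: half_dskew q1 q2)// /half_dskew /dskew.
    rewrite !(dullZl dD, dullZr dD, dullNl dD, dullNr dD).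
    by apply: side_ext => m b; rewrite !(sc_gD, sc_gN, sc_gZ); ring.
  rewrite [LHS](_ : _ = D (2^-1 *: q1) (2^-1 *: - jG q2) + D (2^-1 *: - jG q1) (2^-1 *: q2))//.
  rewrite !(dullZl dD, dullZr dD, dullNl dD, dullNr dD).
  rewrite [RHS](_ : _ = 2^-1 *: - jG (half_dskew q1 q2))//.
  rewrite /half_dskew bmap_Z -cD; apply: side_ext => m b.
  by rewrite !(sc_gD, sc_gN, sc_gZ); lra.
- by move=> m x; exact: lambda_anchor.
move=> [s1 s2] [t1 t2].
have H (u1 u2 : Gamma Q) : in_Q10 j (u1, u2) -> u2 = - jG u1.
  move=> /(congr1 fst) /= ->; rewrite scale0r scale1r sub0r opprK//.
move=> /H -> /H ->.
have -> : cplx_bracket D (s1, - jG s1) (t1, - jG t1) = (dskew s1 t1, - jG (dskew s1 t1)).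
  congr pair; rewrite /= !(dullNl dD, dullNr dD) ?opprK//.
  by rewrite -cD opprD addrC.
rewrite /in_Q10 /= bmap_N jGK opprK; congr pair; rewrite /= scale0r scale1r.
  by rewrite sub0r opprK.
by rewrite add0r.
Qed.

Hypothesis cD : jcompatible.

Lemma half_dskew_cla : (forall q1 q2, dskew q1 q2 = - dskew q2 q1) ->
  (forall q1 q2 q3, dskew q1 (dskew q2 q3) - dskew q2 (dskew q1 q3) + dskew q3 (dskew q1 q2) = 0) ->
  is_complex_lie_algebroid j (side_lambda j) half_dskew.
Proof.
move=> sk jac.
split.
- move=> z m x; rewrite /side_lambda /rho_j /= /rho_j_fun /jscale /=.
  have E1 : j m (complex.Re z *: x + complex.Im z *: j m x) = complex.Re z *: j m x - complex.Im z *: x.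
    by rewrite bmor_D !bmor_Z hj scalerN.
  congr pair; rewrite /= ?E1 /side_anchor_fun.
    by rewrite scalerDr !scalerN opprK !scalerA ![2^-1 * _]mulrC.
  rewrite [LHS](_ : _ = 2^-1 *: - (complex.Re z *: (j m x).1 - complex.Im z *: x.1))//.
  by rewrite opprB scalerBr !scalerN [RHS]addrC !scalerA ![2^-1 * _]mulrC.
- move=> z q1 q2 q; rewrite /jscale_const /half_dskew !dskewDl !dskewZl (dskew_jl _ _ cD).
  by rewrite bmap_Z; apply: side_ext => m b; rewrite !(sc_gD, sc_gZ); ring.
- move=> z q q1 q2; rewrite /jscale_const /half_dskew !dskewDr !dskewZr (dskew_jr _ _ cD).
  by rewrite bmap_Z; apply: side_ext => m b; rewrite !(sc_gD, sc_gZ); ring.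
- move=> q; apply: side_ext => m b; have := congr1 (fun s : Gamma Q => sc (s m) b) (sk q q).
  rewrite (sc_gN (dskew q q)) => H; rewrite /half_dskew (sc_gZ 2^-1).
  have -> : sc ((0 : Gamma Q) m) b = 0 by rewrite -(scale0r (0 : Gamma Q)) sc_gZ mul0r.
  lra.
- move=> q1 q2 q3; rewrite /half_dskew !dskewZr (sk q3 q1) -scaleN1r dskewZr.
  apply: side_ext => m b; have := congr1 (fun s : Gamma Q => sc (s m) b) (jac q1 q2 q3).
  have -> : sc ((0 : Gamma Q) m) b = 0 by rewrite -(scale0r (0 : Gamma Q)) sc_gZ mul0r.
  by rewrite !(sc_gD, sc_gN, sc_gZ); lra.
move=> q1 f q2 m; rewrite /jscale_fun /half_dskew dskewDr.
apply: (sc_nondegeneratel (F := F)) => b.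
rewrite sc_gZ sc_gD !dskew_fr (dskew_jr _ _ cD).
have -> : (2^-1 *: dskew q1 q2) m = 2^-1 *: dskew q1 q2 m by [].
move: (dskew q1 q2) => s; rewrite -!scaleNr /jscale !scDl !scZl.
have -> : sc (jG (jG q2) m) b = - sc (q2 m) b by rewrite jGK sc_gN.
rewrite bmor_Z !scZl.
have -> : sc (j m (s m)) b = sc (jG s m) b by [].
have -> : sc (j m (q2 m)) b = sc (jG q2 m) b by [].
have l1 g : (side_lambda j m (q1 m)).1 g = 2^-1 * (q1 m).1 g by exact: (tangent_scaleE (q1 m).1 2^-1).
have l2 g : (side_lambda j m (q1 m)).2 g = - (2^-1 * (jG q1 m).1 g).
  by rewrite [LHS](tangent_scaleE (- (jG q1 m).1) 2^-1) tangent_oppE mulrN.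
have reE : complex.Re (cplx_act (side_lambda j m (q1 m)) f) =
    2^-1 * (q1 m).1 (cinf_re f) - - (2^-1 * (jG q1 m).1 (cinf_im f)).
  exact: (congr2 (fun x y => x - y) (l1 _) (l2 _)).
have imE : complex.Im (cplx_act (side_lambda j m (q1 m)) f) =
    2^-1 * (q1 m).1 (cinf_im f) + - (2^-1 * (jG q1 m).1 (cinf_re f)).
  exact: (congr2 (fun x y => x + y) (l1 _) (l2 _)).
rewrite reE imE.
have fre : complex.Re (f m) = cinf_re f m := erefl.
have fim : complex.Im (f m) = cinf_im f m := erefl.
rewrite fre fim.
(* [dskew_fr] differentiates along q1 and along j q1; the halves of these derivatives are, up to
   sign, the real and imaginary parts of the anchor, and the identity collects them into complex
   multiplication. *)
have rid (f1 f2 x1 x2 x3 x4 y1 y2 y3 y4 : R) :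
    2^-1 * (f1 * x1 + y1 * x2 + - y3 * x3 + (f2 * x4 + y2 * x3 + - y4 * - x2)) =
    (2^-1 * y1 - - (2^-1 * y4)) * x2 + (2^-1 * y2 - 2^-1 * y3) * x3 + (f1 * (2^-1 * x1) + f2 * (2^-1 * x4)).
  ring.
exact: rid.
Qed.

Lemma half_dskew_quasi_real : is_quasi_real j (side_lambda j) half_dskew.
Proof.
exists (side_anchor A F); split=> //; exists D; split=> //; exact: dskew_realises.
Qed.

End dull.

Section core_dual.

Fact core_dual_linear m (t : Cr m) c (x y : Q m) :
  - sc (j m (c *: x + y)) t = c * - sc (j m x) t + - sc (j m y) t.
Proof. by rewrite bmor_linear scDl scZl opprD mulrN. Qed.

(* Minus the transpose of [j]: the action on the core of any [J] as in the theorem. *)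
Definition core_dual m (t : Cr m) : Cr m := xget 0 [set b | forall x, sc x b = - sc (j m x) t].

Lemma core_dualE m (t : Cr m) x : sc x (core_dual t) = - sc (j m x) t.
Proof.
rewrite /core_dual; case: xgetP => [b _ /= ->//|/= H].
have [b bE] := core_represents hM hE (dual_of (fun x : Q m => - sc (j m x) t)).
by case: (H b) => y; rewrite bE dual_ofE// => c u v; exact: core_dual_linear.
Qed.

Lemma core_dual_lin m c (t t' : Cr m) : core_dual (c *: t + t') = c *: core_dual t + core_dual t'.
Proof.
apply: (sc_nondegenerate hM hE) => x.
by rewrite scDr scZr !core_dualE scDr scZr opprD mulrN.
Qed.

Lemma core_dualK m (t : Cr m) : core_dual (core_dual t) = - t.
Proof.
by apply: (sc_nondegenerate hM hE) => x; rewrite !core_dualE hj scNl scNr !opprK.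
Qed.

(** Pairings with side sections are smooth by the defining property. Smoothness of the E-part is
    tested in trivialisations, so that part is first rebuilt from its pairings with a local
    coframe. *)
Lemma core_dual_smooth (t : Gamma Cr) : smooth_section Cr (fun m => core_dual (t m)).
Proof.
have pE (s : Gamma Q) : smooth A (fun m => sc (s m) (core_dual (t m))).
  have -> : (fun m => sc (s m) (core_dual (t m))) =
      cinf_mul (cinf_cst (-1)) (cinf_add (pairing hM hE (bsnd (jG s)) (bfst t)) (cv_app (bsnd t) (bfst (jG s)))).
    by apply/funext => m; rewrite core_dualE /= mulN1r.
  exact: cinfP.
split; last first.
  move=> X sX; have := pE (binl _ (@MkGamma _ _ _ _ TM X sX)).
  rewrite (_ : (fun m => sc _ _) = fun m => (core_dual (t m)).2 (X m))//.
  by apply/funext => m; exact: sc_fst.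
move=> tr Ftr i c Ac m tm cm; have pmA := manifold_premanifold hM.
have [c0 [t0 [U [chi ld]]]] := local_data_exists hM hE m.
apply: (smooth_pt_local pmA (f := fun q => \sum_b sc (binr TM (coframe hM hE ld b) q) (core_dual (t q)) *
  tmap tr q (fframe hM hE ld b q) 0 i) (gc_open (ld_base ld)) (ld_mem ld) _ _ Ac cm).
  move=> q Uq; rewrite [in RHS](fframe_expansion hM hE ld (core_dual (t q)).1 Uq).
  rewrite linear_sum summxE; apply: eq_bigr => b _.
  rewrite [sc _ _]sc_snd; move: (coframe hM hE ld b q) (fframe hM hE ld b q) => v y.
  by rewrite linearZ mxE.
apply: smooth_pt_sum => b; apply: smooth_ptM; first exact: smoothW (pE _).
by move=> c' Ac' cm'; exact: (gammaP (fframe hM hE ld b) tr Ftr i c' Ac' m tm cm').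
Qed.

Definition core_dualG t : Gamma Cr := MkGamma (core_dual_smooth t).

End core_dual.

End algebroid.

(** * Morphisms adapted to a dull bracket *)

Section adapted_morphisms.
Context {R : realType} {M : Type} {n k : nat} {E : M -> lmodType R}.
Context {A : atlas R M n} {F : set (triv E k)}.
Hypothesis hM : is_manifold A.
Hypothesis hE : is_vector_bundle A F.
Let pmA := manifold_premanifold hM.
Let pmT := total_premanifold pmA hE.
Local Notation TA := (total_atlas A F).
Local Notation P := (pontryagin_bundle TA).
Local Notation pt m a := (existT (fun m0 => GRing.Lmodule.sort (E m0)) m a).
Local Notation TM := (tangent_bundle A).
Local Notation Q := (side_bundle A F).
Local Notation Cr := (core_bundle A F).
Local Notation sc := (@side_core_pairing _ _ _ _ _ A F _).
Local Notation cp := courant_pairing.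
Variable j : bmor Q Q.
Hypothesis hj : forall m (x : Q m), j m (j m x) = - x.
Local Notation jG := (bmap j).
Variable D : Gamma Q -> Gamma Q -> Gamma Q.
Hypothesis dD : is_dull (side_anchor A F) D.
Local Notation hl := (hl hM hE D).
Local Notation hlG := (hlG hM hE dD).
Local Notation upG := (upG hM hE).
Local Notation cdG := (core_dualG hM hE j).

Lemma hl_N nu m (a : E m) : hl (- nu) a = - hl nu a.
Proof. by rewrite -scaleN1r [LHS](hl_fscale hM hE dD (cinf_cst (-1))) /= scaleN1r. Qed.

Section morphism.
Variable J : bmor P P.
Hypothesis JJ : forall p (u : P p), J p (J p u) = - u.
Hypothesis Jorth : forall p (u v : P p), cp (J p u) (J p v) = cp u v.
Hypothesis Jh : forall nu m (a : E m), J (pt m a) (hl nu a) = hl (jG nu) a.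
Hypothesis Ju : forall m (a : E m) b, J (pt m a) (up a b) = up a (core_dual j b).
Local Notation nij := (nij (determined_TE hM hE dD) (TE_through hM hE dD) J).

Lemma JhG nu : bmap J (hlG nu) = hlG (jG nu).
Proof. by apply: gamma_eq => -[m a]; exact: Jh. Qed.

Lemma JuG tau : bmap J (upG tau) = upG (cdG tau).
Proof. by apply: gamma_eq => -[m a]; exact: Ju. Qed.

Definition djac_nij q1 q2 q3 := djac D q1 q2 q3 - djac D (jG q1) (jG q2) q3
  - djac D (jG q1) q2 (jG q3) - djac D q1 (jG q2) (jG q3).

Lemma nij_hhh q1 q2 q3 m (a : E m) :
  nij (hlG q1) (hlG q2) (hlG q3) (pt m a) = (djac_nij q1 q2 q3 m).2 a.
Proof.
rewrite /nij !JhG !courant3_hhh.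
have DD (s t : Gamma Q) : ((s + t) m).2 a = (s m).2 a + (t m).2 a by exact: (dual_addE (s m).2).
have DN (s : Gamma Q) : ((- s) m).2 a = - (s m).2 a.
  by rewrite -scaleN1r [LHS](dual_scaleE (-1) (s m).2) mulN1r.
by rewrite /djac_nij /djac !(DD, DN).
Qed.

(** J acts on the core by minus the transpose of j, so the two terms with J on [tau] return as j
    applied to brackets. Vanishing of this form is compatibility, up to applying j. *)
Lemma nij_hhu q1 q2 tau m (a : E m) : nij (hlG q1) (hlG q2) (upG tau) (pt m a) =
  sc ((dskew j D q1 q2 + jG (D (jG q1) q2 + D q1 (jG q2))) m) (tau m).
Proof.
rewrite /nij !JhG !JuG !courant3_hhu.
have cE (q : Gamma Q) : sc (q m) (cdG tau m) = - sc (jG q m) (tau m) by exact: (core_dualE hM hE).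
by rewrite !cE bmap_D !(sc_gD, sc_gN); ring.
Qed.

Lemma nij_huu q t t' e : nij (hlG q) (upG t) (upG t') e = 0.
Proof. by rewrite /nij !JhG !JuG !courant3_huu; ring. Qed.

Lemma nij_uuu t1 t2 t3 e : nij (upG t1) (upG t2) (upG t3) e = 0.
Proof. by rewrite /nij !JuG !courant3_uuu; ring. Qed.

Lemma nij_eq0 : jcompatible j D -> (forall q1 q2 q3, djac_nij q1 q2 q3 = 0) ->
  forall x y z e, nij x y z e = 0.
Proof.
move=> cD dj0 x y z e.
have hhh q1 q2 q3 e' : nij (hlG q1) (hlG q2) (hlG q3) e' = 0.
  by case: e' => m a; rewrite nij_hhh dj0; exact: dual_zeroE.
have hhu q1 q2 tau e' : nij (hlG q1) (hlG q2) (upG tau) e' = 0.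
  case: e' => m a; rewrite nij_hhu cD (jGK hj) subrr.
  by rewrite -(scale0r (0 : Gamma Q)) sc_gZ mul0r.
have s12 := nij_skew12 (determined_TE hM hE dD) (TE_through hM hE dD) JJ Jorth.
have s23 := nij_skew23 (determined_TE hM hE dD) (TE_through hM hE dD) JJ Jorth.
have t1 y' z' := nij_tensorial1 (determined_TE hM hE dD) (TE_through hM hE dD) JJ Jorth y' z' e.
have t2 y' z' := nij_tensorial2 (determined_TE hM hE dD) (TE_through hM hE dD) JJ Jorth y' z' e.
have t3 y' z' := nij_tensorial3 (determined_TE hM hE dD) (TE_through hM hE dD) JJ Jorth y' z' e.
have hhz q1 q2 z' : nij (hlG q1) (hlG q2) z' e = 0.
  apply: (P_generated (hM := hM) (hE := hE) (dD := dD) (t3 (hlG q1) (hlG q2))) => [q3|tau].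
    exact: hhh.
  exact: hhu.
have hyz q y' z' : nij (hlG q) y' z' e = 0.
  apply: (P_generated (hM := hM) (hE := hE) (dD := dD) (t2 (hlG q) z')) => [q2|tau]; first exact: hhz.
  apply: (P_generated (hM := hM) (hE := hE) (dD := dD) (t3 (hlG q) (upG tau))) => [q3|tau']; last exact: nij_huu.
  by rewrite s23 hhz oppr0.
apply: (P_generated (hM := hM) (hE := hE) (dD := dD) (t1 y z)) => [q|tau]; first exact: hyz.
apply: (P_generated (hM := hM) (hE := hE) (dD := dD) (t2 (upG tau) z)) => [q|tau']; first by rewrite s12 hyz oppr0.
apply: (P_generated (hM := hM) (hE := hE) (dD := dD) (t3 (upG tau) (upG tau'))) => [q|tau'']; last exact: nij_uuu.
by rewrite s23 s12 hyz opprK.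
Qed.

Lemma nij_jcompatible : (forall x y z e, nij x y z e = 0) -> jcompatible j D.
Proof.
move=> n0 q1 q2; have : dskew j D q1 q2 + jG (D (jG q1) q2 + D q1 (jG q2)) = 0.
  apply: (side_ext (F := F)) => m b; have [tau <-] := core_section_exists hM hE b.
  (* The value is the same at all points of the fibre, so the zero vector is as good as any. *)
  by rewrite -(nij_hhu q1 q2 tau (0 : E m)) n0 -(scale0r (0 : Gamma Q)) sc_gZ mul0r.
move=> /eqP; rewrite addr_eq0 => /eqP ->.
by rewrite bmap_N (jGK hj) opprK.
Qed.

Lemma bfst_djac q1 q2 q3 : bfst (djac D q1 q2 q3) = 0.
Proof.
have -> : bfst (djac D q1 q2 q3) = bfst (D q1 (D q2 q3)) - bfst (D q2 (D q1 q3)) + bfst (D q3 (D q1 q2)).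
  exact: gamma_eq.
by rewrite !(bfst_D dD) lie_jacobi.
Qed.

(** On three lifts the Nijenhuis form sees only the part in the dual of E; the TM-part of each
    [djac] vanishes by the Jacobi identity for vector fields. *)
Lemma nij_djac : (forall x y z e, nij x y z e = 0) -> forall q1 q2 q3, djac_nij q1 q2 q3 = 0.
Proof.
move=> n0 q1 q2 q3; apply: gamma_eq => m.
have h1 : (djac_nij q1 q2 q3 m).1 = 0.
  have : bfst (djac_nij q1 q2 q3) = bfst (djac D q1 q2 q3) - bfst (djac D (jG q1) (jG q2) q3)
    - bfst (djac D (jG q1) q2 (jG q3)) - bfst (djac D q1 (jG q2) (jG q3)) by exact: gamma_eq.
  by rewrite !bfst_djac !subr0 => /(congr1 (fun s : Gamma TM => s m)).
have h2 : (djac_nij q1 q2 q3 m).2 = 0.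
  by apply: dual_ext => a; rewrite -nij_hhh n0.
by rewrite [LHS]surjective_pairing h1 h2.
Qed.

End morphism.

Section construction.

(** The section in a decomposition is not unique, but its value at m and the core part are, by
    [lift_decomposition_unique]; so all decompositions prescribe the same y. *)
Definition lift_J m (a : E m) (x : P (pt m a)) : P (pt m a) :=
  xget 0 [set y | forall nu b, x = hl nu a + up a b -> y = hl (jG nu) a + up a (core_dual j b)].

Lemma lift_decomposition_unique nu nu' m (a : E m) b b' :
  hl nu a + up a b = hl nu' a + up a b' -> nu m = nu' m /\ b = b'.
Proof.
move=> H; have numE : nu m = nu' m.
  have := congr1 (@side _ _ _ _ _ A F m a) H.
  have sE q c : side (hl q a + up a c) = q m.
    have := side_linear hM hE 1 (hl q a) (up a c).
    by rewrite !scale1r (side_hl hM hE dD) (side_up hM hE) addr0.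
  by rewrite !sE.
split=> //; move: H; rewrite (hl_eq hM hE dD a numE) => /addrI.
exact: (up_inj hM hE dD).
Qed.

Lemma lift_JE m (a : E m) nu b : lift_J (hl nu a + up a b) = hl (jG nu) a + up a (core_dual j b).
Proof.
rewrite /lift_J; case: xgetP => [y _ /= H|/= H]; first exact: H.
case: (H (hl (jG nu) a + up a (core_dual j b))) => nu' b'.
move=> /lift_decomposition_unique[nuE ->]; congr (_ + _).
by apply: (hl_eq hM hE dD); rewrite /= nuE.
Qed.

Definition J_fun e : P e -> P e := match e with existT m a => @lift_J m a end.

Lemma P_lift m (a : E m) (x : P (pt m a)) : exists nu b, x = hl nu a + up a b.
Proof.
have [nu nux] := side_section_through hM hE (side x).
by have [b ->] := P_decomposition hM hE dD nux; exists nu, b.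
Qed.

Lemma J_fun_linear e c (x y : P e) : J_fun (c *: x + y) = c *: J_fun x + J_fun y.
Proof.
case: e x y => m a x y /=; have [nu [b ->]] := P_lift x; have [nu' [b' ->]] := P_lift y.
have hc q : hl (c *: q) a = c *: hl q a by exact: (hl_fscale hM hE dD (cinf_cst c)).
have -> : c *: (hl nu a + up a b) + (hl nu' a + up a b') =
    hl (c *: nu + nu') a + up a (c *: b + b').
  by rewrite (hlD hM hE dD) hc up_linear// scalerDr addrACA.
rewrite !lift_JE (core_dual_lin hM hE) up_linear// bmap_D bmap_Z (hlD hM hE dD) hc.
by rewrite scalerDr addrACA.
Qed.

Lemma section_local (B : Type) d (G : atlas R B d) (pmG : premanifold G)
    (s : forall e, pontryagin_bundle G e) :
  (forall e, exists W (t : Gamma (pontryagin_bundle G)),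
    [/\ atlas_open G W, W e & forall q, W q -> t q = s q]) ->
  smooth_section (pontryagin_bundle G) s.
Proof.
move=> loc; split.
  move=> f sf; apply/smoothP => e; have [W [t [oW We tE]]] := loc e.
  apply: (smooth_pt_local pmG (f := fun q => (t q).1 f) oW We).
    by move=> q /tE ->.
  exact: smoothW (gammaP (bfst t) f sf).
move=> X sX; apply/smoothP => e; have [W [t [oW We tE]]] := loc e.
apply: (smooth_pt_local pmG (f := fun q => (t q).2 (X q)) oW We).
  by move=> q /tE ->.
exact: smoothW (gammaP (bsnd t) X sX).
Qed.

(** Locally the image has the same coefficients on the images of the frame, which are again lifts
    and core sections. *)
Lemma J_fun_smooth s : smooth_section P s -> smooth_section P (fun e => J_fun (s e)).
Proof.
move=> ss; pose S : Gamma P := MkGamma ss.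
apply: (section_local pmT) => e0.
have [c [tr [U [chi ld]]]] := local_data_exists hM hE (projT1 e0).
pose JF i : Gamma P := match i with
  | inl i => hlG (jG (side_frame hM hE ld i)) | inr i => upG (cdG (core_frame hM hE ld i)) end.
exists [set e | U (projT1 e)], (\sum_i fscale (P_coef hM hE dD ld i S) (JF i)).
split; [exact: (total_open pmA hE (gc_open (ld_base ld)))|exact: (ld_mem ld)|].
move=> [m a] Um; rewrite gamma_sumE.
have -> : s (pt m a) = \sum_i P_coef hM hE dD ld i S (pt m a) *: P_frame hM hE dD ld i (pt m a).
  exact: (P_expansion hM hE dD ld S a Um).
have J0 : J_fun (0 : P (pt m a)) = 0.
  have /eqP := J_fun_linear 1 (0 : P (pt m a)) 0; rewrite scale1r addr0 scale1r.
  by rewrite -subr_eq subrr => /eqP <-.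
have JS (I : Type) (r : seq I) (f : I -> R) (v : I -> P (pt m a)) :
    J_fun (\sum_(i <- r) f i *: v i) = \sum_(i <- r) f i *: J_fun (v i).
  by elim: r => [|i r IH]; rewrite ?big_nil// !big_cons J_fun_linear IH.
rewrite JS; apply: eq_bigr => i _; congr (_ *: _).
have hl0 : hl 0 a = 0.
  by apply: (@addIr _ (hl 0 a)); rewrite -(hlD hM hE dD) addr0 add0r.
have cd0 m' : core_dual j (0 : Cr m') = 0.
  have /eqP := core_dual_lin hM hE j 1 (0 : Cr m') 0; rewrite scaler0 addr0 scale1r.
  by rewrite -subr_eq subrr => /eqP <-.
case: i => i /=.
  have := lift_JE a (side_frame hM hE ld i) 0.
  by rewrite up0// cd0 up0// !addr0 => ->.
have := lift_JE a 0 (core_frame hM hE ld i m).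
have -> : jG 0 = 0 by have := bmap_Z j 0 0; rewrite !scale0r.
by rewrite hl0 !add0r => ->.
Qed.

Definition J_of : bmor P P := Bmor J_fun_linear J_fun_smooth.

Lemma J_ofE m (a : E m) nu b :
  J_of (pt m a) (hl nu a + up a b) = hl (jG nu) a + up a (core_dual j b).
Proof. exact: lift_JE. Qed.

Lemma core_dual0 m : core_dual j (0 : Cr m) = 0.
Proof.
have /eqP := core_dual_lin hM hE j 1 (0 : Cr m) 0; rewrite scaler0 addr0 scale1r.
by rewrite -subr_eq subrr => /eqP <-.
Qed.

Lemma J_of_hl nu m (a : E m) : J_of (pt m a) (hl nu a) = hl (jG nu) a.
Proof. by have := J_ofE a nu 0; rewrite core_dual0 up0// !addr0. Qed.

Lemma J_of_up m (a : E m) b : J_of (pt m a) (up a b) = up a (core_dual j b).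
Proof.
have hl0 : hl 0 a = 0.
  by apply: (@addIr _ (hl 0 a)); rewrite -(hlD hM hE dD) addr0 add0r.
have := J_ofE a 0 b; have -> : jG 0 = 0 by have := bmap_Z j 0 0; rewrite !scale0r.
by rewrite hl0 !add0r.
Qed.

Lemma J_of_square p (u : P p) : J_of p (J_of p u) = - u.
Proof.
case: p u => m a u; have [nu [b ->]] := P_lift u.
by rewrite !J_ofE (jGK hj) hl_N (core_dualK hM hE hj) upN// opprD.
Qed.

(** The pairing of a lift with a core section is preserved by the choice of [core_dual], two core
    sections pair to 0, and for two lifts the defect is the symmetric part of S. *)
Lemma J_of_orthogonal : (forall q1 q2, dskew j D q1 q2 = - dskew j D q2 q1) ->
  forall p (u v : P p), cp (J_of p u) (J_of p v) = cp u v.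
Proof.
move=> sk [m a] u v; have [nu [b ->]] := P_lift u; have [nu' [b' ->]] := P_lift v.
rewrite !J_ofE !(cpDl, cpDr) !(cp_hl_hl hM hE dD) !(cpC (up a _) (hl _ a)) !(cp_hl_up hM hE dD).
have cE (q : Gamma Q) t : sc (jG q m) (core_dual j t) = sc (q m) t.
  by rewrite (core_dualE hM hE) [j m _]hj scNl opprK.
apply: (congr2 (fun x y => x + y)); last first.
  by apply: (congr2 (fun x y => x + y)); [exact: cE|rewrite !(cp_up_up hM hE)].
apply: (congr2 (fun x y => x + y)); last exact: cE.
have := congr1 (fun s : Gamma Q => (s m).2 a) (sk nu nu').
have DD (s t : Gamma Q) : ((s + t) m).2 a = (s m).2 a + (t m).2 a by exact: (dual_addE (s m).2).
have DN (s : Gamma Q) : ((- s) m).2 a = - (s m).2 a.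
  by rewrite -scaleN1r [LHS](dual_scaleE (-1) (s m).2) mulN1r.
have D3 (s t : Gamma Q) : (s m + t m).2 a = (s m).2 a + (t m).2 a by exact: (dual_addE (s m).2).
rewrite /dskew !D3 !(DD, DN); lra.
Qed.

Lemma J_of_gcs : jcompatible j D -> (forall q1 q2, dskew j D q1 q2 = - dskew j D q2 q1) ->
  (forall q1 q2 q3, djac_nij q1 q2 q3 = 0) -> is_gcs J_of.
Proof.
move=> cD sk dj; apply: (nij_gcs (det := determined_TE hM hE dD) (through := TE_through hM hE dD) J_of_square (J_of_orthogonal sk) (fun p v => P_through hM hE dD v)).
exact: (nij_eq0 J_of_square (J_of_orthogonal sk) J_of_hl J_of_up cD dj).
Qed.

Lemma side_lift nu m (a : E m) b : side (hl nu a + up a b) = nu m.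
Proof.
have := side_linear hM hE 1 (hl nu a) (up a b).
by rewrite !scale1r (side_hl hM hE dD) (side_up hM hE) addr0.
Qed.

Lemma J_of_linear : is_linear_over j J_of.
Proof.
split=> [m a x|m a b x y z xyz|c m a x y xy].
- by have [nu [b ->]] := P_lift x; rewrite J_ofE -/(side _) -/(side _) !side_lift.
- have [sy sz] := side_sum_side hM hE xyz.
  have [nu nux] := side_section_through hM hE (side x).
  have [b1 xE] := P_decomposition hM hE dD nux.
  have [b2 yE] := P_decomposition hM hE dD (etrans nux (esym sy)).
  have [b3 zE] := P_decomposition hM hE dD (etrans nux (esym sz)).
  move: xyz; rewrite xE yE zE !J_ofE => /(side_sum_hl hM hE dD) ->.
  apply/(side_sum_hl hM hE dD).
  by have := core_dual_lin hM hE j 1 b1 b2; rewrite !scale1r.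
have sy := side_scaled_side hM hE xy.
have [nu nux] := side_section_through hM hE (side x).
have [b1 xE] := P_decomposition hM hE dD nux.
have [b2 yE] := P_decomposition hM hE dD (etrans nux (esym sy)).
move: xy; rewrite xE yE !J_ofE => /(side_scaled_hl hM hE dD) ->.
apply/(side_scaled_hl hM hE dD).
by have := core_dual_lin hM hE j c b1 0; rewrite core_dual0 !addr0.
Qed.

End construction.

End adapted_morphisms.

Lemma bmor_eq (R : realType) (T : Type) (n : nat) (A : atlas R T n) (B C : bundle A) (f g : bmor B C) : (forall m x, f m x = g m x) -> f = g.
Proof.
case: f g => f f1 f2 [g g1 g2] /= fg.
have E0 : f = g by apply: functional_extensionality_dep => m; apply/funext => x.
by subst g; congr Bmor; exact: Prop_irrelevance.
Qed.

(** * Comparison of dull brackets and the bijection *)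

Section correspondence.
Context {R : realType} {M : Type} {n k : nat} {E : M -> lmodType R}.
Context {A : atlas R M n} {F : set (triv E k)}.
Hypothesis hM : is_manifold A.
Hypothesis hE : is_vector_bundle A F.
Let pmA := manifold_premanifold hM.
Local Notation TA := (total_atlas A F).
Local Notation P := (pontryagin_bundle TA).
Local Notation pt m a := (existT (fun m0 => GRing.Lmodule.sort (E m0)) m a).
Local Notation TM := (tangent_bundle A).
Local Notation Ed := (dual_bundle A F).
Local Notation Q := (side_bundle A F).
Local Notation Cr := (core_bundle A F).
Local Notation ell := (lin hM hE).
Local Notation pull := (@pull R M n k E A F).
Local Notation bp u := (tangent_map A (@bproj _ _ E) u).
Local Notation sc := (@side_core_pairing _ _ _ _ _ A F _).
Local Notation cp := courant_pairing.
Local Notation hl := (hl hM hE).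
Variable j : bmor Q Q.
Hypothesis hj : forall m (x : Q m), j m (j m x) = - x.
Local Notation jG := (bmap j).
Implicit Types D : Gamma Q -> Gamma Q -> Gamma Q.
Local Notation dull D := (is_dull (side_anchor A F) D).

Lemma adaptedE D (J : bmor P P) : dull D -> adapted D j J <->
  forall nu m (a : E m), J (pt m a) (hl D nu a) = hl D (jG nu) a.
Proof.
move=> dD; split=> H nu m => [a|e].
  have [e <-] := section_through hM hE a.
  by rewrite -!(horizontal_liftE hM hE dD).
by rewrite !(horizontal_liftE hM hE dD).
Qed.

(** Testing the two lifts on linear functions gives the E-part of [b], testing their covectors on a
    lift of a vector field gives the T^*M-part. [hl_diff] is the converse. *)
Lemma hl_compare D D' q m (a : E m) b : dull D -> dull D' -> hl D' q a = hl D q a + up a b ->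
  forall q2, (D' q q2 m).2 a = (D q q2 m).2 a + sc (q2 m) b.
Proof.
move=> dD dD' H q2.
have E1 eta : (D' q (binr _ eta) m).2 a = (D q (binr _ eta) m).2 a + eta m b.1.
  by rewrite -(hl_lin hM hE dD') H P1D (hl_lin hM hE dD) (up_lin hM hE).
have E2 Y : (D' q (binl _ Y) m).2 a = (D q (binl _ Y) m).2 a + b.2 (Y m).
  pose u := (hl D (binl _ Y) a).1; have Yu : Y m = bp u by rewrite /u (hl_proj hM hE dD).
  have : (hl D' q a).2 u = (hl D q a + up a b).2 u by rewrite H.
  rewrite (hl2E hM hE dD' q Yu) P2D (hl2E hM hE dD q Yu) up2E -Yu; lra.
have DE D0 : dull D0 -> (D0 q q2 m).2 a = (D0 q (binl _ (bfst q2)) m).2 a + (D0 q (binr _ (bsnd q2)) m).2 a.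
  by move=> d0; rewrite {1}(bsum_split q2) (d2_Dr d0).
rewrite (DE D dD) (DE D' dD') E1 E2 /side_core_pairing /=; ring.
Qed.

Lemma hl_diff D D' q m (a : E m) b : dull D -> dull D' ->
  (forall q2, (D' q q2 m).2 a = (D q q2 m).2 a + sc (q2 m) b) -> hl D' q a = hl D q a + up a b.
Proof.
move=> dD dD' H; apply: (is_lift_unique (D := D') (nu := q)); first exact: hlP.
split=> [f|eta|u Y Yu].
- by rewrite P1D (hl_pull hM hE dD) (up_pull hM hE) addr0.
- rewrite P1D (hl_lin hM hE dD) (up_lin hM hE) H; congr (_ + _).
  by rewrite [sc _ _]sc_snd.
rewrite P2D (hl2E hM hE dD q Yu) up2E H -addrA; congr (_ + (_ + _)).
by rewrite [sc _ _]sc_fst Yu.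
Qed.

Lemma hl_difference D D' q m (a : E m) : dull D -> dull D' ->
  exists b, hl D' q a = hl D q a + up a b.
Proof.
by move=> dD dD'; apply: (P_decomposition hM hE dD); rewrite (side_hl hM hE dD').
Qed.

(** The core action is forced: J of a core element has side j 0 = 0, and its pairing with a lift is
    found by moving J onto the lift. *)
Lemma adapted_up D (J : bmor P P) : dull D -> is_gcs J -> is_linear_over j J -> adapted D j J ->
  forall m (a : E m) b, J (pt m a) (up a b) = up a (core_dual j b).
Proof.
move=> dD gJ lJ /(adaptedE _ dD) Jh m a b; apply/eqP; rewrite -subr_eq0; apply/eqP.
have cJ := cp_J (gcs_square gJ) (gcs_orthogonal gJ).
apply: (P_zero dD) => [b'|nu]; rewrite cpDl cpNl.
  rewrite (cp_up_up hM hE) subr0 (cp_side hM hE).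
  have -> : side (J (pt m a) (up a b)) = j m 0.
    by rewrite -(side_up hM hE a b); exact: (lo_side lJ).
  by rewrite bmor_0 -(scale0r (0 : Q m)) scZl mul0r.
rewrite cJ Jh !(cpC (up a _)) !(cp_hl_up hM hE dD) (core_dualE hM hE).
by rewrite opprK addNr.
Qed.

Lemma adapted_unique D (J J' : bmor P P) : dull D -> is_gcs J -> is_linear_over j J ->
  adapted D j J -> is_gcs J' -> is_linear_over j J' -> adapted D j J' -> J = J'.
Proof.
move=> dD gJ lJ aJ gJ' lJ' aJ'.
apply: bmor_eq => -[m a] x; have [nu [b ->]] := P_lift hM hE dD x.
have D2 (G : bmor P P) (u v : P (pt m a)) : G (pt m a) (u + v) = G (pt m a) u + G (pt m a) v by exact: bmor_D.
rewrite !D2 (adapted_up dD gJ lJ aJ) (adapted_up dD gJ' lJ' aJ').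
by rewrite ((adaptedE _ dD).1 aJ) ((adaptedE _ dD).1 aJ').
Qed.

(** * From generalised complex structures to complex Lie algebroids *)

Section from_gcs.
Variable J : bmor P P.
Hypothesis gJ : is_gcs J.
Hypothesis lJ : is_linear_over j J.
Variable D0 : Gamma Q -> Gamma Q -> Gamma Q.
Hypothesis dD0 : dull D0.
Local Notation hl0 := (hl D0).

(** The defect of adaptedness of [D0] at [a]: if [D0] were adapted, J would send the lift of jq to
    the lift of - q. *)
Definition J_core q m (a : E m) : Cr m :=
  xget 0 [set b | J (pt m a) (hl0 (jG q) a) = hl0 (- q) a + up a b].

Lemma J_coreE q m (a : E m) : J (pt m a) (hl0 (jG q) a) = hl0 (- q) a + up a (J_core q a).
Proof.
rewrite /J_core; case: xgetP => [b _ //|/= H].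
have [b bE] : exists b, J (pt m a) (hl0 (jG q) a) = hl0 (- q) a + up a b.
  apply: (P_decomposition hM hE dD0).
  rewrite [RHS](lo_side lJ) [side_proj _](side_hl hM hE dD0).
  by rewrite -(jGK hj).
by case: (H b).
Qed.

Lemma J_core_eq q m (a : E m) b : J (pt m a) (hl0 (jG q) a) = hl0 (- q) a + up a b -> J_core q a = b.
Proof. by rewrite J_coreE => /addrI; exact: (up_inj hM hE dD0). Qed.

(** Linearity of J over the side bundle enters here and in [J_core_scale]: sums of lifts over the
    side are sums of core parts, so the defect is linear in the point of E. *)
Lemma J_core_add q m (a b : E m) : J_core q (a + b) = J_core q a + J_core q b.
Proof.
have : side_sum (hl0 (jG q) a + up a 0) (hl0 (jG q) b + up b 0) (hl0 (jG q) (a + b) + up (a + b) 0).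
  by apply/(side_sum_hl hM hE dD0); rewrite addr0.
move=> /(lo_sum lJ); rewrite !(up0 hM hE) !addr0 !J_coreE.
by move=> /(side_sum_hl hM hE dD0).
Qed.

Lemma J_core_scale q m c (a : E m) : J_core q (c *: a) = c *: J_core q a.
Proof.
have : side_scaled (hl0 (jG q) a + up a 0) (hl0 (jG q) (c *: a) + up (c *: a) 0).
  by apply/(side_scaled_hl hM hE dD0); rewrite scaler0.
move=> /(lo_scale lJ); rewrite !(up0 hM hE) !addr0 !J_coreE.
by move=> /(side_scaled_hl hM hE dD0).
Qed.

Lemma J_coreD q q' m (a : E m) : J_core (q + q') a = J_core q a + J_core q' a.
Proof.
apply: J_core_eq; rewrite bmap_D (hlD hM hE dD0) bmor_D !J_coreE opprD (hlD hM hE dD0) (upD hM hE).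
by rewrite addrACA.
Qed.

Lemma J_core_fscale f q m (a : E m) : J_core (fscale f q) a = f m *: J_core q a.
Proof.
apply: J_core_eq; rewrite bmap_fscale (hl_fscale hM hE dD0) bmor_Z J_coreE scalerDr (upZ hM hE).
congr (_ + _); rewrite -(hl_fscale hM hE dD0); apply: (hl_eq hM hE dD0).
by rewrite /= !scaleN1r scalerN.
Qed.

(** Evaluated along a local frame of E, such a function yields smooth coefficients with respect to
    the coframe. The defect of adaptedness arises as a function on E and has to become a section
    over M. *)
Lemma fibrewise_linear_dual (g : cinf TA) :
  (forall m c (a b : E m), g (pt m (c *: a + b)) = c * g (pt m a) + g (pt m b)) ->
  smooth_section Ed (fun m => dual_of (fun a : E m => g (pt m a))).
Proof.
move=> gL t Ft v c Ac m tm cm.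
have [c0 [t0 [U [chi ld]]]] := local_data_exists hM hE m.
apply: (smooth_pt_local pmA (f := fun q => \sum_b coframe hM hE ld b q (tinv t q v) *
  along hM hE g (fframe hM hE ld b) q) (gc_open (ld_base ld)) (ld_mem ld) _ _ Ac cm).
  move=> q Uq; rewrite [RHS]dual_ofE; last exact: gL.
  rewrite [in RHS](fframe_expansion hM hE ld (tinv t q v) Uq).
  have g0 : g (pt q 0) = 0.
    by have /eqP := gL q 1 0 0; rewrite scaler0 addr0 mul1r -subr_eq subrr => /eqP.
  have gS (r : seq 'I_k) (x : 'I_k -> R) (w : 'I_k -> E q) :
      g (pt q (\sum_(i <- r) x i *: w i)) = \sum_(i <- r) x i * g (pt q (w i)).
    by elim: r => [|i r IH]; rewrite ?big_nil// !big_cons gL IH.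
  by rewrite gS.
apply: smooth_pt_sum => b; apply: smooth_ptM; last exact: smoothW (cinfP _).
by move=> c' Ac' cm'; exact: (gammaP (coframe hM hE ld b) t Ft v c' Ac' m tm cm').
Qed.

(** Written as a pairing of smooth sections of TE + T^*E, the pairing of [q2] with the defect is
    smooth on E by construction. *)
Definition J_defect q1 q2 : cinf TA :=
  cpf (hlG hM hE dD0 q2) (hlG hM hE dD0 q1 + bmap J (hlG hM hE dD0 (jG q1))).

Lemma J_defectE q1 q2 m (a : E m) : J_defect q1 q2 (pt m a) = sc (q2 m) (J_core q1 a).
Proof.
rewrite /J_defect -(cp_hl_up hM hE dD0 q2 a); congr cp.
have : hl0 q1 a + J (pt m a) (hl0 (jG q1) a) = up a (J_core q1 a).
  by rewrite J_coreE (hl_N hM hE dD0) addrA subrr add0r.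
by [].
Qed.

Lemma J_defect_linear q1 q2 m c (a b : E m) : J_defect q1 q2 (pt m (c *: a + b)) =
  c * J_defect q1 q2 (pt m a) + J_defect q1 q2 (pt m b).
Proof. by rewrite !J_defectE J_core_add J_core_scale scDr scZr. Qed.

Definition J_dual q1 q2 : Gamma Ed := MkGamma (fibrewise_linear_dual (J_defect_linear q1 q2)).

Lemma J_dualE q1 q2 m a : J_dual q1 q2 m a = sc (q2 m) (J_core q1 a).
Proof. by rewrite [LHS]dual_ofE ?J_defectE//; exact: J_defect_linear. Qed.

(* Chosen so that the lifts of this bracket are the J-invariant averages
   [(hl0 q - J (hl0 (j q))) / 2]. *)
Definition J_bracket q1 q2 : Gamma Q := D0 q1 q2 - 2^-1 *: binr TM (J_dual q1 q2).

Lemma J_bracket2 q1 q2 m (a : E m) :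
  (J_bracket q1 q2 m).2 a = (D0 q1 q2 m).2 a - 2^-1 * sc (q2 m) (J_core q1 a).
Proof.
rewrite -J_dualE -mulN1r.
have -> : (J_bracket q1 q2 m).2 a = ((D0 q1 q2 m).2 + -1 *: (2^-1 *: J_dual q1 q2 m)) a by [].
by rewrite dual_addE !dual_scaleE.
Qed.

Lemma J_bracket1 q1 q2 m : (J_bracket q1 q2 m).1 = (D0 q1 q2 m).1.
Proof.
have -> : (J_bracket q1 q2 m).1 = (D0 q1 q2 m).1 + -1 *: (2^-1 *: 0) by [].
by rewrite !scaler0 addr0.
Qed.

Lemma side_eq m (x y : Q m) : x.1 = y.1 -> (forall a, x.2 a = y.2 a) -> x = y.
Proof. by case: x y => x1 x2 [y1 y2] /= -> H; congr pair; exact: dual_ext. Qed.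

(** The correction is C^oo-bilinear with values in the dual of E, so the anchor and the Leibniz rule
    are those of [D0]. *)
Lemma J_bracket_dull : dull J_bracket.
Proof.
have q2D m (x y : Q m) a : (x + y).2 a = x.2 a + y.2 a by exact: (dual_addE x.2).
have q2Z m c (x : Q m) a : (c *: x).2 a = c * x.2 a by exact: (dual_scaleE c x.2).
have q2N m (x : Q m) a : (- x).2 a = - x.2 a by rewrite -scaleN1r q2Z mulN1r.
have gL c (s t : Gamma Q) m a : ((c *: s + t) m).2 a = c * (s m).2 a + (t m).2 a.
  by rewrite [LHS](dual_addE (c *: (s m).2)).
have JZ c q m (a : E m) : J_core (c *: q) a = c *: J_core q a by exact: (J_core_fscale (cinf_cst c)).
move: J_bracket J_bracket1 J_bracket2 => B B1 B2.
split=> [c q1 q2 q|c q q1 q2|q1 q2 m|f1 f2 q1 q2 m].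
- apply: gamma_eq => m; apply: side_eq => [|a].
    apply: etrans (B1 _ _ _) _; rewrite (dull_linearl dD0).
    exact: (congr2 (fun x y => c *: x + y) (esym (B1 q1 q m)) (esym (B1 q2 q m))).
  apply: etrans _ (esym (gL c (B q1 q) (B q2 q) m a)).
  rewrite !B2 (dull_linearl dD0) gL J_coreD JZ scDr scZr; ring.
- apply: gamma_eq => m; apply: side_eq => [|a].
    apply: etrans (B1 _ _ _) _; rewrite (dull_linearr dD0).
    exact: (congr2 (fun x y => c *: x + y) (esym (B1 q q1 m)) (esym (B1 q q2 m))).
  apply: etrans _ (esym (gL c (B q q1) (B q q2) m a)).
  by rewrite !B2 (dull_linearr dD0) gL [(c *: q1 + q2) m](_ : _ = c *: q1 m + q2 m)// scDl scZl; ring.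
- by rewrite -(dull_anchor dD0); exact: B1.
apply: side_eq => [|a].
  apply: etrans (B1 _ _ _) _; rewrite (dull_leibniz dD0).
  exact: (congr1 (fun x => (f1 m * f2 m) *: x + (f1 m * side_anchor A F m (q1 m) f2) *: (q2 m).1
    - (f2 m * side_anchor A F m (q2 m) f1) *: (q1 m).1) (esym (B1 q1 q2 m))).
have fE (f : cinf A) (q : Gamma Q) : fscale f q m = f m *: q m by [].
have q3 c1 c2 c3 (x y z : Q m) : (c1 *: x + c2 *: y - c3 *: z).2 a = c1 * x.2 a + c2 * y.2 a - c3 * z.2 a.
  by rewrite q2D q2N q2D !q2Z.
rewrite B2 (dull_leibniz dD0) !fE !q3 B2 J_core_fscale scZl scZr; ring.
Qed.

Lemma hl_J_bracket q m (a : E m) : hl J_bracket q a = hl0 q a + up a (- (2^-1 *: J_core q a)).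
Proof.
apply: hl_diff => //; first exact: J_bracket_dull.
by move=> q2; rewrite J_bracket2 scNr scZr.
Qed.

(** By J^2 = -1 and j^2 = -1, applying J to the average for q gives the average for jq. *)
Lemma J_bracket_adapted : adapted J_bracket j J.
Proof.
apply/(adaptedE _ J_bracket_dull) => q m a.
have E0 q' : hl J_bracket q' a = 2^-1 *: (hl0 q' a - J (pt m a) (hl0 (jG q') a)).
  rewrite hl_J_bracket J_coreE (hl_N hM hE dD0) opprD opprK addrA -mulr2n scalerBr.
  by rewrite -[hl0 q' a *+ 2]scaler_nat scalerA mulVf ?pnatr_eq0// scale1r (upN hM hE) (upZ hM hE).
rewrite !E0 bmor_Z bmor_D bmor_N (gcs_square gJ) opprK addrC (jGK hj) (hl_N hM hE dD0).
by rewrite bmor_N opprK addrC.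
Qed.

End from_gcs.

Lemma adapted_exists (J : bmor P P) : is_gcs J -> is_linear_over j J ->
  exists D, dull D /\ adapted D j J.
Proof.
move=> gJ lJ; have [D0 dD0] := dull_exists hM hE.
by exists (J_bracket lJ dD0); split; [exact: J_bracket_dull|exact: J_bracket_adapted].
Qed.

(** Asking for one bracket makes existence easy in both directions; [corresponds_adapted] then
    passes to every realising bracket. *)
Definition corresponds (C : quasi_real_cla j) (J : linear_gcs j) := exists D,
  [/\ dull D, realises j (side_anchor A F) D (side_lambda j) (sval C) & adapted D j (sval J)].

(** Quasi-reality leaves the real anchor open, but the real part of the complex anchor is half of
    it, so it is the projection to TM. *)
Lemma realising_exists (C : quasi_real_cla j) :
  exists D, dull D /\ realises j (side_anchor A F) D (side_lambda j) (sval C).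
Proof.
case: C => br [cla [rho [rhoE [D [dD rD]]]]] /=; exists D.
have rE : rho = side_anchor A F.
  apply: bmor_eq => m x; apply: esym; apply: (scalerI (a := 2^-1)).
    by rewrite invr_eq0 pnatr_eq0.
  exact: (congr1 fst (rhoE m x)).
by rewrite -rE.
Qed.

(** Polarising the alternating law gives skewness, which turns the cyclic Jacobi identity into the
    form used for [djac]. *)
Lemma cla_dskew br D : is_complex_lie_algebroid j (side_lambda j) br ->
  (forall q1 q2, br q1 q2 = half_dskew j D q1 q2) -> dull D ->
  (forall q1 q2, dskew j D q1 q2 = - dskew j D q2 q1) /\
  forall q1 q2 q3, dskew j D q1 (dskew j D q2 q3) - dskew j D q2 (dskew j D q1 q3)
    + dskew j D q3 (dskew j D q1 q2) = 0.
Proof.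
move=> cla brE dD; have n2 : 2^-1 != 0 :> R by rewrite invr_eq0 pnatr_eq0.
have s0 q : dskew j D q q = 0.
  by apply: (scalerI n2); rewrite scaler0 -[LHS]brE (cla_alternating cla).
have sk q1 q2 : dskew j D q1 q2 = - dskew j D q2 q1.
  have := s0 (q1 + q2); rewrite (dskewDl _ dD) !(dskewDr _ dD) !s0 add0r addr0.
  by move=> /eqP; rewrite addr_eq0 => /eqP.
split=> // q1 q2 q3; have := cla_jacobi cla q1 q2 q3.
rewrite !brE /half_dskew !(dskewZr _ dD) -!scalerDr !scalerA => /eqP.
rewrite scaler_eq0 mulf_eq0 (negbTE n2) /= => /eqP <-; congr (_ + _ + _).
by rewrite (sk q3 q1) -[RHS]opprK -(scaleN1r (dskew j D q1 q3)) (dskewZr _ dD) scaleN1r opprK.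
Qed.

Lemma realises_facts (C : quasi_real_cla j) D : dull D ->
  realises j (side_anchor A F) D (side_lambda j) (sval C) ->
  [/\ jcompatible j D, forall q1 q2, sval C q1 q2 = half_dskew j D q1 q2,
      forall q1 q2, dskew j D q1 q2 = - dskew j D q2 q1 &
      forall q1 q2 q3, djac_nij j D q1 q2 q3 = 0].
Proof.
move=> dD rD; have [cD brE] := realises_dskew dD rD.
have [sk jac] := cla_dskew (svalP C).1 brE dD.
split=> // q1 q2 q3; rewrite -(jac q1 q2 q3); symmetry; exact: dskew_jacobi.
Qed.

Lemma gcs_of_algebroid C : exists J, corresponds C J.
Proof.
have [D [dD rD]] := realising_exists C; have [cD brE sk dj] := realises_facts dD rD.
exists (exist _ (J_of hM hE j dD) (conj (J_of_gcs hM hE hj dD cD sk dj) (J_of_linear hM hE j dD))).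
exists D; split=> //; apply/(adaptedE _ dD) => nu m a; exact: J_of_hl.
Qed.

Lemma corresponds_adapted C J D' : corresponds C J -> dull D' ->
  realises j (side_anchor A F) D' (side_lambda j) (sval C) -> adapted D' j (sval J).
Proof.
move=> [D [dD rD aD]] dD' rD'; apply/(adaptedE _ dD') => q m a.
have [cD brE _ _] := realises_facts dD rD; have [cD' brE' _ _] := realises_facts dD' rD'.
have [gJ lJ] := svalP J.
have [b bE] := hl_difference q a dD dD'.
rewrite bE bmor_D ((adaptedE _ dD).1 aD) (adapted_up dD gJ lJ aD).
symmetry; apply: hl_diff => // q2; rewrite (core_dualE hM hE).
have := hl_compare dD dD' bE (jG q2).
(* Both brackets realise [C], so compatibility equates these sums. The change of D(q, jq2), a
   pairing with [b], is offset in D(jq, q2), whose change is therefore the pairing of q2 with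
   [core_dual j b]. *)
have : D' (jG q) q2 + D' q (jG q2) = D (jG q) q2 + D q (jG q2).
  rewrite cD cD'; congr bmap; apply: (scalerI (a := 2^-1)); first by rewrite invr_eq0 pnatr_eq0.
  by rewrite -[LHS]brE' -[RHS]brE.
move=> /(congr1 (fun s : Gamma Q => (s m).2 a)).
have DD (s t : Gamma Q) : ((s + t) m).2 a = (s m).2 a + (t m).2 a by exact: (dual_addE (s m).2).
rewrite !DD; have -> : jG q2 m = j m (q2 m) by []; lra.
Qed.

Lemma algebroid_of_gcs J : exists C, corresponds C J.
Proof.
have [gJ lJ] := svalP J; have [D [dD aD]] := adapted_exists gJ lJ.
have Jh := (adaptedE _ dD).1 aD; have Ju := adapted_up dD gJ lJ aD.
have n0 x y z e := @gcs_nij _ _ _ _ (determined_TE hM hE dD) (TE_through hM hE dD) (sval J)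
  (gcs_square gJ) (gcs_orthogonal gJ) x y z e gJ.
have cD := nij_jcompatible hj Jh Ju n0; have dj := nij_djac Jh n0.
(* The TM-part is skew as a difference of Lie brackets; the part in the dual of E is orthogonality
   of J on two lifts. *)
have sk q1 q2 : dskew j D q1 q2 = - dskew j D q2 q1.
  have bf q q' : bfst (dskew j D q q') = lieG (bfst q) (bfst q') - lieG (bfst (jG q)) (bfst (jG q')).
    rewrite -!(bfst_D dD); exact: gamma_eq.
  apply: gamma_eq => m; apply: side_eq => [|a].
    have : bfst (dskew j D q1 q2) = - bfst (dskew j D q2 q1).
      by rewrite !bf (lie_anti (bfst q1)) (lie_anti (bfst (jG q1))) opprD.
    by move=> /(congr1 (fun s : Gamma TM => s m)).
  have H := gcs_orthogonal gJ (hl D q1 a) (hl D q2 a).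
  rewrite !Jh !(cp_hl_hl hM hE dD) in H.
  have DD (s t : Gamma Q) : (s m + t m).2 a = (s m).2 a + (t m).2 a by exact: (dual_addE (s m).2).
  have DN (s : Gamma Q) : ((- s) m).2 a = - (s m).2 a.
    by rewrite -scaleN1r [LHS](dual_scaleE (-1) (s m).2) mulN1r.
  have DB (s t : Gamma Q) : ((s - t) m).2 a = (s m).2 a - (t m).2 a.
    by rewrite -DN; exact: (dual_addE (s m).2).
  rewrite !DD in H; rewrite DN /dskew !DB; lra.
have jac q1 q2 q3 : dskew j D q1 (dskew j D q2 q3) - dskew j D q2 (dskew j D q1 q3)
    + dskew j D q3 (dskew j D q1 q2) = 0.
  by apply: etrans (dj q1 q2 q3); exact: dskew_jacobi.
exists (exist _ (half_dskew j D) (conj (half_dskew_cla hj dD cD sk jac)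
  (half_dskew_quasi_real hj dD cD))).
by exists D; split=> //; exact: dskew_realises.
Qed.

Lemma sval_inj (X : Type) (Pr : X -> Prop) (x y : {x | Pr x}) : sval x = sval y -> x = y.
Proof.
by case: x y => x px [y py] /= xy; subst y; congr exist; exact: Prop_irrelevance.
Qed.

Lemma corresponds_gcs_unique C J J' : corresponds C J -> corresponds C J' -> J = J'.
Proof.
move=> CJ [D [dD rD aD']]; apply: sval_inj.
have [gJ lJ] := svalP J; have [gJ' lJ'] := svalP J'.
exact: (adapted_unique dD gJ lJ (corresponds_adapted CJ dD rD) gJ' lJ' aD').
Qed.

(** Another adapted bracket adds the pairing of q2 with b both to D(q1, q2) and to D(jq1, jq2),
    because j^2 = -1 cancels the sign of the transpose; so S does not change. *)
Lemma corresponds_algebroid_unique C C' J : corresponds C J -> corresponds C' J -> C = C'.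
Proof.
move=> [D [dD rD aD]] [D' [dD' rD' aD']]; apply: sval_inj.
have [cD brE _ _] := realises_facts dD rD; have [cD' brE' _ _] := realises_facts dD' rD'.
have [gJ lJ] := svalP J.
apply/funext => q1; apply/funext => q2; rewrite brE brE' /half_dskew; congr (_ *: _).
have bf D0 (d0 : dull D0) q q' : bfst (dskew j D0 q q') =
    lieG (bfst q) (bfst q') - lieG (bfst (jG q)) (bfst (jG q')).
  by rewrite -!(bfst_D d0); exact: gamma_eq.
apply: gamma_eq => m; apply: side_eq => [|a].
  have : bfst (dskew j D q1 q2) = bfst (dskew j D' q1 q2) by rewrite !bf.
  by move=> /(congr1 (fun s : Gamma TM => s m)).
have DN (s : Gamma Q) : ((- s) m).2 a = - (s m).2 a.
  by rewrite -scaleN1r [LHS](dual_scaleE (-1) (s m).2) mulN1r.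
have DB (s t : Gamma Q) : ((s - t) m).2 a = (s m).2 a - (t m).2 a.
  by rewrite -DN; exact: (dual_addE (s m).2).
have [b bE] := hl_difference q1 a dD dD'.
have bE' : hl D' (jG q1) a = hl D (jG q1) a + up a (core_dual j b).
  by rewrite -((adaptedE _ dD').1 aD') bE bmor_D ((adaptedE _ dD).1 aD) (adapted_up dD gJ lJ aD).
have := hl_compare dD dD' bE q2; have := hl_compare dD dD' bE' (jG q2).
rewrite (core_dualE hM hE); have -> : j m (jG q2 m) = - q2 m by exact: hj.
rewrite scNl opprK /dskew !DB; lra.
Qed.

End correspondence.

Theorem theorem1p3 (R : realType) (M : Type) (n k : nat) (A : atlas R M n)
    (E : M -> lmodType R) (F : set (triv E k))
    (hM : is_manifold A) (hE : is_vector_bundle A F)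
    (j : bmor (side_bundle A F) (side_bundle A F))
    (hj : forall m (x : side_bundle A F m), j m (j m x) = - x) :
  exists Phi : quasi_real_cla j -> linear_gcs j,
    bijective Phi /\
    forall (C : quasi_real_cla j) (J : linear_gcs j),
      Phi C = J <->
      forall D : Gamma (side_bundle A F) -> Gamma (side_bundle A F) ->
                 Gamma (side_bundle A F),
        is_dull (side_anchor A F) D ->
        realises j (side_anchor A F) D (side_lambda j) (sval C) ->
        adapted D j (sval J).
Proof.
have [Phi PhiP] := choice (gcs_of_algebroid hM hE hj).
have [Psi PsiP] := choice (algebroid_of_gcs hM hE hj).
exists Phi; split.
  exists Psi => [C|J].
    exact: corresponds_algebroid_unique (PsiP (Phi C)) (PhiP C).
  exact: corresponds_gcs_unique (PhiP (Psi J)) (PsiP J).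
move=> C J; split=> [<- D dD rD|H]; first exact: (corresponds_adapted hM hE (PhiP C) dD rD).
(* The condition on all realising brackets is not vacuous, so it yields one bracket witnessing the
   relation. *)
have [D [dD rD]] := realising_exists C.
apply: corresponds_gcs_unique (PhiP C) _ => //.
by exists D; split=> //; exact: H.
Qed.
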